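(* Let $1\le p<\infty$, $p\neq 2$, and let $S$ be an isometry on $H^p$ of finite codimension $d\ge 1$, so that $S=M_\Psi U_\phi$ for some $\phi\in\mathbb{A}$ and some $d$-fold Blaschke product $\Psi$. Then $\bigcap_{n=1}^\infty S^nH^p=(0)$ if and only if $\phi$ is elliptic.
   Context: $D$ is the open unit disc in $\mathbb{C}$, $H^p$ the Hardy space of $D$ with its usual norm. $\mathbb{A}$ is the group (under composition) of holomorphic automorphisms of $D$, i.e. the maps $\phi(z)=\frac{\lambda(z-a)}{1-\overline{a}z}$ with $a\in D$, $|\lambda|=1$; $e(z)=z$. $\phi\in\mathbb{A}$ is elliptic if $\phi\neq e$ and $\phi$ has a fixed point in $D$. A $d$-fold Blaschke product is a product of $d$ elements of $\mathbb{A}$. For $F\in H^\infty$, $M_F$ is multiplication by $F$ on $H^p$; $C_\phi f=f\circ\phi$. For $\phi(z)=\frac{\lambda(z-a)}{1-\overline{a}z}$ in $\mathbb{A}$ put $U_\phi=M_{(\overline{\lambda}\phi')^{1/p}}C_\phi$, where $\overline\lambda\phi'(z)=\frac{1-|a|^2}{(1-\overline a z)^2}$ and the $p$-th root is the principal branch $(re^{i\theta})^{1/p}=r^{1/p}e^{i\theta/p}$, $r>0$, $-\pi<\theta<\pi$. The codimension of an isometry is the codimension of its range. The operators $M_\Psi U_\phi$ with $\phi\in\mathbb{A}$ and $\Psi$ a $d$-fold Blaschke product are the linear isometries of $H^p$ whose range has codimension $d$.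
   Formalization: The formal theorem says the intersection is (0) if and only if φ is elliptic or φ = e: since elliptic excludes φ = e, the stated equivalence fails for φ = e, where S = M_Ψ with d ≥ 1 and the intersection is (0). *)

(* Defs.v *)
From Stdlib Require Import Reals Lra List.
From Coquelicot Require Import Coquelicot.

Open Scope R_scope.

(* Functions on the disc are represented by total functions [C -> C]; only
   their values on [disc] matter, and [eqD] is the equality of the functions
   they represent. *)
Definition disc (z : C) : Prop := Cmod z < 1.

Definition eqD (f g : C -> C) : Prop := forall z, disc z -> f z = g z.

Definition zero_fun : C -> C := fun _ => RtoC 0.

Definition holomorphic (f : C -> C) : Prop :=
  forall z : C, disc z -> @ex_derive C_AbsRing C_NormedModule f z.

Definition cis (t : R) : C := (cos t, sin t).

(* [Rpower 0 p] is 1 in the standard library, hence the case distinction. *)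
Definition rpow (x p : R) : R := if Rlt_dec 0 x then Rpower x p else 0.

Definition Hp_mean (p : R) (f : C -> C) (r : R) : R :=
  rpow (RInt (fun t => rpow (Cmod (f (r * cis t)%C)) p) 0 (2 * PI) / (2 * PI))
       (1 / p).

(* On a holomorphic function the integrand above is continuous for r < 1, so the
   total operator [RInt] is the integral. *)
Definition Hp_norm (p : R) (f : C -> C) : Rbar :=
  Lub_Rbar (fun m => exists r, 0 <= r < 1 /\ m = Hp_mean p f r).

Definition Hp (p : R) (f : C -> C) : Prop :=
  holomorphic f /\ is_finite (Hp_norm p f).

(* The argument in (-PI, PI) on the plane slit along the nonpositive reals;
   see [Carg_polar]. *)
Definition Carg (z : C) : R := 2 * atan (Im z / (Cmod z + Re z)).

(* The principal branch of the p-th root; see [Croot_polar]. *)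
Definition Croot (p : R) (z : C) : C :=
  (Rpower (Cmod z) (1 / p) * cis (Carg z / p))%C.

Lemma Cmod_polar (r t : R) : 0 < r -> Cmod (r * cis t)%C = r.
Proof.
intros Hr; rewrite Cmod_mult, Cmod_R, Rabs_pos_eq by lra.
unfold Cmod, cis; cbn [fst snd].
replace (cos t ^ 2 + sin t ^ 2) with (Rsqr (sin t) + Rsqr (cos t))
  by (unfold Rsqr; ring).
rewrite sin2_cos2, sqrt_1; ring.
Qed.

Lemma Carg_polar (r t : R) : 0 < r -> - PI < t < PI -> Carg (r * cis t)%C = t.
Proof.
intros Hr Ht; unfold Carg; rewrite Cmod_polar by assumption.
assert (Hc : 0 < cos (t / 2)) by (apply cos_gt_0; lra).
replace (Im (r * cis t)%C / (r + Re (r * cis t)%C)) with (tan (t / 2)).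
  rewrite atan_tan by lra; lra.
unfold Re, Im, cis, tan; cbn [fst snd Cmult RtoC].
replace (sin t) with (2 * sin (t / 2) * cos (t / 2))
  by (rewrite <- sin_2a; f_equal; lra).
replace (cos t) with (2 * cos (t / 2) * cos (t / 2) - 1)
  by (rewrite <- cos_2a_cos; f_equal; lra).
assert (0 < r * (cos (t / 2) * cos (t / 2)))
  by (repeat apply Rmult_lt_0_compat; assumption).
field; lra.
Qed.

Lemma Croot_polar (p r t : R) : 0 < r -> - PI < t < PI ->
  Croot p (r * cis t)%C = (Rpower r (1 / p) * cis (t / p))%C.
Proof.
intros Hr Ht; unfold Croot.
now rewrite Cmod_polar, Carg_polar by assumption.
Qed.

(* The parameters [aut_lam] and [aut_a] are determined by the automorphism, so
   this record is the group of automorphisms of the disc. *)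
Record Aut : Type := mkAut {
  aut_lam : C;
  aut_a : C;
  aut_lam_unit : Cmod aut_lam = 1;
  aut_a_disc : disc aut_a
}.

Definition aut_map (phi : Aut) : C -> C := fun z =>
  (aut_lam phi * (z - aut_a phi) / (1 - Cconj (aut_a phi) * z))%C.

Coercion aut_map : Aut >-> Funclass.

Definition is_identity (phi : Aut) : Prop := eqD phi (fun z => z).

Definition elliptic (phi : Aut) : Prop :=
  ~ is_identity phi /\ exists z : C, disc z /\ phi z = z.

Definition blaschke (d : nat) (Psi : C -> C) : Prop :=
  exists l : list Aut, length l = d /\
    eqD Psi (fun z => fold_right (fun (phi : Aut) w => (phi z * w)%C) (RtoC 1) l).

Definition mult_op (F f : C -> C) : C -> C := fun z => (F z * f z)%C.

Definition comp_op (phi f : C -> C) : C -> C := fun z => f (phi z).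

(* This is conj(lambda) * phi'(z). *)
Definition aut_weight (phi : Aut) : C -> C := fun z =>
  ((1 - Cmod (aut_a phi) ^ 2)%R / (1 - Cconj (aut_a phi) * z) ^ 2)%C.

Definition U_op (p : R) (phi : Aut) (f : C -> C) : C -> C :=
  mult_op (fun z => Croot p (aut_weight phi z)) (comp_op phi f).

Definition Hp_operator (p : R) (S : (C -> C) -> (C -> C)) : Prop :=
  (forall f, Hp p f -> Hp p (S f)) /\
  (forall f g, Hp p f -> Hp p g -> eqD f g -> eqD (S f) (S g)).

Definition Hp_linear (p : R) (S : (C -> C) -> (C -> C)) : Prop :=
  forall (a b : C) f g, Hp p f -> Hp p g ->
    eqD (S (fun z => (a * f z + b * g z)%C)) (fun z => (a * S f z + b * S g z)%C).

Definition Hp_isometry (p : R) (S : (C -> C) -> (C -> C)) : Prop :=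
  Hp_operator p S /\ Hp_linear p S /\
  forall f, Hp p f -> Hp_norm p (S f) = Hp_norm p f.

(* h 1, ..., h d induce a basis of the quotient of H^p by the range of S. *)
Definition Hp_codim (p : R) (S : (C -> C) -> (C -> C)) (d : nat) : Prop :=
  exists h : nat -> C -> C,
    (forall i, (1 <= i <= d)%nat -> Hp p (h i)) /\
    (forall f, Hp p f -> exists (c : nat -> C) (g : C -> C), Hp p g /\
       eqD f (fun z => (sum_n_m (fun i => (c i * h i z)%C) 1 d + S g z)%C)) /\
    (forall (c : nat -> C) (g : C -> C), Hp p g ->
       eqD (fun z => sum_n_m (fun i => (c i * h i z)%C) 1 d) (S g) ->
       forall i, (1 <= i <= d)%nat -> c i = RtoC 0).

Definition iter_range (p : R) (S : (C -> C) -> (C -> C)) (n : nat) (f : C -> C)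
  : Prop :=
  exists g, Hp p g /\ eqD f (Nat.iter n S g).

Definition trivial_core (p : R) (S : (C -> C) -> (C -> C)) : Prop :=
  forall f, Hp p f ->
    ((forall n, (1 <= n)%nat -> iter_range p S n f) <-> eqD f zero_fun).

(* Main.v *)
From Stdlib Require Import Reals Lra Lia List Classical ClassicalEpsilon.
From Coquelicot Require Import Coquelicot.
Require Import Defs.

Open Scope R_scope.
Set Bullet Behavior "Strict Subproofs".

(** Write [phi^k] for the k-th iterate of [phi]. The n-th iterate of [S = M_Psi
U_phi] sends g to the product of the orbit product [Psi * (Psi o phi) * ... * (Psi o
phi^(n-1))] with a zero-free weight and with [g o phi^n]. Everything depends on
whether the orbits of [phi] stay in a compact part of the disc, that is, on whether
[phi] has a fixed point there.

If [phi] fixes a point of the disc, each orbit stays in some disc [|w| <= rho] with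
[rho < 1] ([fixed_orbit_bounded]), because [phi] preserves the pseudohyperbolic
distance to the fixed point. On that disc [|Psi| <= q < 1] ([blaschke_bound]), so
the orbit product at z is at most [q^n]. If [f = S^n g_n], then [g_n] has the norm
of f, hence is bounded on [|w| <= rho] by a constant that does not depend on n
([Hp_point_bound]). Letting n grow gives [f z = 0] ([core_trivial_of_fixed]).

If [phi] has no fixed point in the disc, write it as the action of a matrix of
SU(1,1) with upper right entry b. The absence of a fixed point means that the trace
is at least 2 in modulus and that b is nonzero, and then the upper right entry of
the n-th power is at least [n |b|] in modulus ([iterate_growth]). So [1 -
|phi^n(0)|^2] is O([1/n^2]) and thus summable, and the infinite product of the
functions [Psi o phi^k], normalized by unimodular constants, converges to a nonzero
bounded holomorphic function divisible by all orbit products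
([bprod_orbit_divisible]). It belongs to the range of every [S^n], since [S^n] maps
the bounded holomorphic functions onto their multiples by the n-th orbit product
([orbit_prod_range]): [Psi] is produced by S, and the weight and the composition
with [phi] are invertible there.

Two analytic facts support this: holomorphic functions of H^p are bounded on compact
sets by their norm, and a bounded pointwise limit of holomorphic functions is
holomorphic ([bounded_limit_dif]). Both follow from Cauchy's formula for a circle
([cauchy_formula]). Since holomorphic only means complex differentiable at each
point, that formula is derived from a Goursat bisection argument ([goursat]),
applied to the straight-line homotopy that contracts the circle to the point. *)

(** * Complex differentiability and continuity *)

(** Complex differentiability in epsilon-delta form. It avoids the two uniform
structures on C, one from the modulus and one from the coordinates, and it is
equivalent to the filter-based derivative by [Cder_is_derive]. *)
Definition Cder (f : C -> C) (z l : C) : Prop :=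
  forall eps, 0 < eps -> exists delta, 0 < delta /\
    forall w, Cmod (w - z) < delta ->
      Cmod (f w - f z - l * (w - z)) <= eps * Cmod (w - z).

Lemma Cder_norm (f : C -> C) (z l w : C) :
  @norm C_AbsRing C_NormedModule (minus (minus (f w) (f z))
     (@scal C_AbsRing C_NormedModule (@minus C_AbsRing w z) l)) =
  Cmod (f w - f z - l * (w - z))%C.
Proof.
rewrite (Cmult_comm l); reflexivity.
Qed.

Lemma Cder_is_derive (f : C -> C) (z l : C) :
  Cder f z l <-> @is_derive C_AbsRing C_NormedModule f z l.
Proof.
split.
- intros H; split; [apply is_linear_scal_l|].
  intros x Hx eps.
  assert (x = z) as ->.
  { symmetry; apply (@is_filter_lim_locally_unique C_AbsRing
      (AbsRing_NormedModule C_AbsRing)); exact Hx. }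
  destruct (H eps (cond_pos eps)) as [d [Hd H']].
  exists (mkposreal d Hd); intros w Hw.
  rewrite Cder_norm; apply H'; exact Hw.
- intros [_ H] eps Heps.
  specialize (H z (fun P HP => HP) (mkposreal eps Heps)).
  destruct H as [d Hd].
  exists d; split; [apply cond_pos|]; intros w Hw.
  specialize (Hd w Hw).
  rewrite Cder_norm in Hd; exact Hd.
Qed.

Lemma ex_derive_Cder (f : C -> C) (z : C) :
  @ex_derive C_AbsRing C_NormedModule f z <-> exists l, Cder f z l.
Proof.
split; intros [l Hl]; exists l; apply Cder_is_derive; exact Hl.
Qed.

(** C is a normed module over itself in two ways, and the lemmas on products and
compositions of derivatives are about this one. *)
Lemma Cder_is_derive_abs (f : C -> C) (z l : C) :
  Cder f z l <-> @is_derive C_AbsRing (AbsRing_NormedModule C_AbsRing) f z l.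
Proof.
rewrite Cder_is_derive; split; intros [_ H];
  (split; [apply is_linear_scal_l | exact H]).
Qed.

Lemma Cder_const (c z : C) : Cder (fun _ => c) z (RtoC 0).
Proof. apply Cder_is_derive, (@is_derive_const C_AbsRing C_NormedModule). Qed.

Lemma Cder_id (z : C) : Cder (fun w => w) z (RtoC 1).
Proof. apply Cder_is_derive_abs, (@is_derive_id C_AbsRing). Qed.

Lemma Cder_plus (f g : C -> C) (z l m : C) : Cder f z l -> Cder g z m ->
  Cder (fun w => f w + g w)%C z (l + m)%C.
Proof.
rewrite !Cder_is_derive; intros Hf Hg.
exact (@is_derive_plus C_AbsRing C_NormedModule f g z l m Hf Hg).
Qed.

Lemma Cder_mult (f g : C -> C) (z l m : C) : Cder f z l -> Cder g z m ->
  Cder (fun w => f w * g w)%C z (l * g z + f z * m)%C.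
Proof.
rewrite !Cder_is_derive_abs; intros Hf Hg.
exact (@is_derive_mult C_AbsRing f g z l m Hf Hg Cmult_comm).
Qed.

Lemma Cder_comp (f g : C -> C) (z l m : C) : Cder f (g z) l -> Cder g z m ->
  Cder (fun w => f (g w)) z (m * l)%C.
Proof.
rewrite Cder_is_derive; rewrite Cder_is_derive_abs, Cder_is_derive.
intros Hf Hg.
exact (@is_derive_comp C_AbsRing C_NormedModule f g z l m Hf Hg).
Qed.

Lemma Cder_ext_loc (f g : C -> C) (z l : C) (d : R) : 0 < d ->
  (forall w, Cmod (w - z) < d -> f w = g w) -> Cder f z l -> Cder g z l.
Proof.
intros Hd He H eps Heps; destruct (H eps Heps) as [d' [Hd' H']].
exists (Rmin d d'); split; [now apply Rmin_glb_lt|].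
intros w Hw.
rewrite <- (He w), <- (He z).
- apply H'; eapply Rlt_le_trans; [exact Hw | apply Rmin_r].
- replace (z - z)%C with (RtoC 0) by ring; now rewrite Cmod_0.
- eapply Rlt_le_trans; [exact Hw | apply Rmin_l].
Qed.

Lemma Cmod_minus_sym (a b : C) : Cmod (a - b) = Cmod (b - a).
Proof. rewrite <- Cmod_opp; f_equal; ring. Qed.

Lemma Cmod_triangle_minus (a b : C) : Cmod a - Cmod b <= Cmod (a - b).
Proof.
pose proof (Cmod_triangle (a - b) b) as H.
replace (a - b + b)%C with a in H by ring; lra.
Qed.

Lemma Cmod_neq_0 (z : C) : 0 < Cmod z -> z <> RtoC 0.
Proof. apply Cmod_gt_0. Qed.

Lemma Cder_inv (z : C) : z <> RtoC 0 -> Cder Cinv z (- / (z * z))%C.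
Proof.
intros Hz eps Heps; assert (Hm := proj1 (Cmod_gt_0 z) Hz).
set (m := Cmod z) in *.
assert (Hm3 : 0 < m * m * m) by (repeat apply Rmult_lt_0_compat; assumption).
exists (Rmin (m / 2) (eps * (m * m * m) / 2)); split.
{ apply Rmin_glb_lt; [lra|]. apply Rdiv_lt_0_compat; [nra|lra]. }
intros w Hw.
assert (H1 := Rlt_le_trans _ _ _ Hw (Rmin_l _ _)).
assert (H2 := Rlt_le_trans _ _ _ Hw (Rmin_r _ _)).
assert (Hwm : m / 2 <= Cmod w).
{ pose proof (Cmod_triangle_minus z w) as H3; rewrite Cmod_minus_sym in H3.
  fold m in H3; lra. }
assert (Hw0 : w <> RtoC 0) by (apply Cmod_neq_0; lra).
replace (/ w - / z - - / (z * z) * (w - z))%C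
  with ((w - z) * (w - z) / (z * z * w))%C by (field; auto).
rewrite Cmod_div by (repeat apply Cmult_neq_0; assumption).
rewrite !Cmod_mult; fold m.
set (e := Cmod (w - z)) in *; assert (0 <= e) by apply Cmod_ge_0.
apply Rle_div_l; [nra|].
assert (m * m * m / 2 <= m * m * Cmod w) by nra.
assert (e * e <= eps * e * (m * m * m / 2)) by nra.
assert (0 <= eps * e) by nra.
nra.
Qed.

Lemma Cder_opp (f : C -> C) (z l : C) : Cder f z l ->
  Cder (fun w => - f w)%C z (- l)%C.
Proof.
rewrite !Cder_is_derive; intros Hf.
exact (@is_derive_opp C_AbsRing C_NormedModule f z l Hf).
Qed.

Lemma Cder_minus (f g : C -> C) (z l m : C) : Cder f z l -> Cder g z m ->
  Cder (fun w => f w - g w)%C z (l - m)%C.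
Proof. intros Hf Hg; exact (Cder_plus _ _ _ _ _ Hf (Cder_opp _ _ _ Hg)). Qed.

Definition Cdif (f : C -> C) (z : C) : Prop := exists l, Cder f z l.

Lemma Cdif_const (c z : C) : Cdif (fun _ => c) z.
Proof. eexists; apply Cder_const. Qed.

Lemma Cdif_id (z : C) : Cdif (fun w => w) z.
Proof. eexists; apply Cder_id. Qed.

Lemma Cdif_minus (f g : C -> C) (z : C) : Cdif f z -> Cdif g z ->
  Cdif (fun w => f w - g w)%C z.
Proof. intros [l Hl] [m Hm]; eexists; apply Cder_minus; eassumption. Qed.

Lemma Cdif_mult (f g : C -> C) (z : C) : Cdif f z -> Cdif g z ->
  Cdif (fun w => f w * g w)%C z.
Proof. intros [l Hl] [m Hm]; eexists; apply Cder_mult; eassumption. Qed.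

Lemma Cdif_comp (f g : C -> C) (z : C) : Cdif f (g z) -> Cdif g z ->
  Cdif (fun w => f (g w)) z.
Proof. intros [l Hl] [m Hm]; eexists; apply Cder_comp; eassumption. Qed.

Lemma Cdif_div (f g : C -> C) (z : C) : Cdif f z -> Cdif g z ->
  g z <> RtoC 0 -> Cdif (fun w => f w / g w)%C z.
Proof.
intros Hf Hg H0; apply Cdif_mult; [exact Hf|].
apply (Cdif_comp Cinv g); [eexists; apply Cder_inv; exact H0 | exact Hg].
Qed.

Lemma Cdif_ext_loc (f g : C -> C) (z : C) (d : R) : 0 < d ->
  (forall w, Cmod (w - z) < d -> f w = g w) -> Cdif f z -> Cdif g z.
Proof. intros Hd He [l Hl]; exists l; eapply Cder_ext_loc; eassumption. Qed.

(** Continuity refers to coordinatewise balls; this lemma states it with the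
modulus. *)
Lemma Ccont_iff {U : UniformSpace} (g : U -> C) (t : U) :
  @continuous U C_UniformSpace g t <->
  forall eps, 0 < eps -> locally t (fun s => Cmod (g s - g t) < eps).
Proof.
split.
- intros H eps Heps.
  apply (H (fun w : C => Cmod (w - g t) < eps)).
  apply locally_C; exists (mkposreal eps Heps); intros w Hw; exact Hw.
- intros H P HP; apply locally_C in HP; destruct HP as [e He].
  specialize (H e (cond_pos e)); unfold filtermap.
  revert H; apply filter_imp; intros s Hs; apply He; exact Hs.
Qed.

Lemma Cdif_continuous (f : C -> C) (z : C) : Cdif f z ->
  @continuous C_UniformSpace C_UniformSpace f z.
Proof.
intros [l H]; apply Ccont_iff; intros eps Heps.
destruct (H 1 Rlt_0_1) as [d [Hd H']].
assert (Hl := Cmod_ge_0 l).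
apply locally_C.
assert (Hp : 0 < Rmin d (eps / (2 + Cmod l))).
{ apply Rmin_glb_lt; [exact Hd | apply Rdiv_lt_0_compat; lra]. }
exists (mkposreal _ Hp); intros w Hw.
assert (Hw' : Cmod (w - z) < Rmin d (eps / (2 + Cmod l))) by exact Hw.
assert (H1 := Rlt_le_trans _ _ _ Hw' (Rmin_l _ _)).
assert (H2 := Rlt_le_trans _ _ _ Hw' (Rmin_r _ _)).
specialize (H' w H1).
apply Rlt_div_r in H2; [|lra].
pose proof (Cmod_triangle (f w - f z - l * (w - z)) (l * (w - z))) as H3.
replace (f w - f z - l * (w - z) + l * (w - z))%C with (f w - f z)%C in H3
  by ring.
rewrite (Cmod_mult l) in H3; pose proof (Cmod_ge_0 (w - z)); nra.
Qed.

Lemma cont_Cmult {U : UniformSpace} (g h : U -> C) (t : U) :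
  @continuous U C_UniformSpace g t -> @continuous U C_UniformSpace h t ->
  @continuous U C_UniformSpace (fun s => g s * h s)%C t.
Proof.
rewrite !Ccont_iff; intros Hg Hh eps Heps.
assert (Ag := Cmod_ge_0 (g t)); assert (Ah := Cmod_ge_0 (h t)).
set (K := 1 + Cmod (g t) + Cmod (h t)).
assert (HK : 1 <= K) by (unfold K; lra).
assert (He : 0 < Rmin 1 (eps / (2 * K))).
{ apply Rmin_glb_lt; [lra | apply Rdiv_lt_0_compat; lra]. }
specialize (Hg _ He); specialize (Hh _ He).
generalize (filter_and _ _ Hg Hh); apply filter_imp; intros s [H1 H2].
assert (H3 := Rlt_le_trans _ _ _ H1 (Rmin_l _ _)).
assert (H4 := Rlt_le_trans _ _ _ H1 (Rmin_r _ _)).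
assert (H5 := Rlt_le_trans _ _ _ H2 (Rmin_r _ _)).
apply Rlt_div_r in H4; [|lra]; apply Rlt_div_r in H5; [|lra].
replace (g s * h s - g t * h t)%C with
  ((g s - g t) * h t + (g t + (g s - g t)) * (h s - h t))%C by ring.
eapply Rle_lt_trans; [apply Cmod_triangle|]; rewrite !Cmod_mult.
assert (H6 := Cmod_triangle (g t) (g s - g t)).
assert (A1 := Cmod_ge_0 (g s - g t)); assert (A2 := Cmod_ge_0 (h s - h t)).
assert (Cmod (g t + (g s - g t)) <= K) by (unfold K; lra).
assert (Cmod (h t) <= K) by (unfold K; lra).
assert (Cmod (g s - g t) * Cmod (h t) <= Cmod (g s - g t) * K) by nra.
assert (Cmod (g t + (g s - g t)) * Cmod (h s - h t) <= K * Cmod (h s - h t)) by nra.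
nra.
Qed.

Lemma cont_Cinv {U : UniformSpace} (g : U -> C) (t : U) :
  @continuous U C_UniformSpace g t -> g t <> RtoC 0 ->
  @continuous U C_UniformSpace (fun s => / g s)%C t.
Proof.
intros Hg H0; apply (continuous_comp (V := C_UniformSpace) g Cinv); [exact Hg|].
apply Cdif_continuous; eexists; apply Cder_inv; exact H0.
Qed.

Lemma cont_Cdiv {U : UniformSpace} (g h : U -> C) (t : U) :
  @continuous U C_UniformSpace g t -> @continuous U C_UniformSpace h t ->
  h t <> RtoC 0 ->
  @continuous U C_UniformSpace (fun s => g s / h s)%C t.
Proof. intros Hg Hh H0; apply cont_Cmult; [|apply cont_Cinv]; assumption. Qed.

Lemma cont_Cplus {U : UniformSpace} (g h : U -> C) (t : U) :
  @continuous U C_UniformSpace g t -> @continuous U C_UniformSpace h t ->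
  @continuous U C_UniformSpace (fun s => g s + h s)%C t.
Proof. exact (@continuous_plus U R_AbsRing C_R_NormedModule g h t). Qed.

Lemma cont_Cminus {U : UniformSpace} (g h : U -> C) (t : U) :
  @continuous U C_UniformSpace g t -> @continuous U C_UniformSpace h t ->
  @continuous U C_UniformSpace (fun s => g s - h s)%C t.
Proof. exact (@continuous_minus U R_AbsRing C_R_NormedModule g h t). Qed.

Lemma cont_pair {U : UniformSpace} (u v : U -> R) (t : U) :
  continuous u t -> continuous v t ->
  @continuous U C_UniformSpace (fun s => (u s, v s)) t.
Proof.
intros Hu Hv.
apply (continuous_comp_2 u v (fun a b => (a, b) : C) t Hu Hv).
apply (continuous_ext (fun x : R * R => x)); [now intros []|].
apply continuous_id.
Qed.

Lemma cont_Cmod {U : UniformSpace} (g : U -> C) (t : U) :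
  @continuous U C_UniformSpace g t -> continuous (fun s => Cmod (g s)) t.
Proof.
intros Hg; apply (continuous_comp g Cmod t Hg).
apply (continuous_ext (@norm R_AbsRing C_R_NormedModule)).
- intros x; symmetry; apply Cmod_norm.
- apply (@filterlim_norm R_AbsRing C_R_NormedModule).
Qed.

Lemma cont_cis {U : UniformSpace} (u : U -> R) (t : U) :
  continuous u t -> @continuous U C_UniformSpace (fun s => cis (u s)) t.
Proof.
intros Hu; apply cont_pair.
- apply (continuous_comp u cos t Hu), continuous_cos.
- apply (continuous_comp u sin t Hu), continuous_sin.
Qed.

Lemma Cdif_eps (f : C -> C) (z : C) (eps : R) : Cdif f z -> 0 < eps ->
  exists delta, 0 < delta /\
    forall w, Cmod (w - z) < delta -> Cmod (f w - f z) < eps.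
Proof.
intros Hf Heps.
assert (H := proj1 (Ccont_iff f z) (Cdif_continuous f z Hf) eps Heps).
apply locally_C in H; destruct H as [d Hd].
exists d; split; [apply cond_pos | intros w Hw; apply Hd; exact Hw].
Qed.

(** * Bisection of rectangles *)

Section Bisection.

Variable Phi : R -> R -> R -> R -> R.
Variables a b c d : R.
Hypothesis hab : a <= b.
Hypothesis hcd : c <= d.

Hypothesis Phi_split : forall x1 x2 y1 y2,
  a <= x1 -> x1 <= x2 -> x2 <= b -> c <= y1 -> y1 <= y2 -> y2 <= d ->
  Phi x1 x2 y1 y2 <=
    Phi x1 ((x1 + x2) / 2) y1 ((y1 + y2) / 2) +
    Phi ((x1 + x2) / 2) x2 y1 ((y1 + y2) / 2) +
    Phi x1 ((x1 + x2) / 2) ((y1 + y2) / 2) y2 +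
    Phi ((x1 + x2) / 2) x2 ((y1 + y2) / 2) y2.

Hypothesis Phi_small : forall x y eps, a <= x <= b -> c <= y <= d -> 0 < eps ->
  exists delta, 0 < delta /\ forall x1 x2 y1 y2,
    a <= x1 -> x1 <= x <= x2 -> x2 <= b ->
    c <= y1 -> y1 <= y <= y2 -> y2 <= d ->
    x2 - x1 < delta -> y2 - y1 < delta ->
    Phi x1 x2 y1 y2 <= eps * ((x2 - x1) + (y2 - y1)) ^ 2.

Let rect : Type := ((R * R) * (R * R))%type.
Let val (r : rect) : R := Phi (fst (fst r)) (snd (fst r)) (fst (snd r)) (snd (snd r)).

Let quarter (r : rect) : rect :=
  let x1 := fst (fst r) in let x2 := snd (fst r) in
  let y1 := fst (snd r) in let y2 := snd (snd r) in
  let x := (x1 + x2) / 2 in let y := (y1 + y2) / 2 in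
  if Rle_dec (val r / 4) (Phi x1 x y1 y) then ((x1, x), (y1, y))
  else if Rle_dec (val r / 4) (Phi x x2 y1 y) then ((x, x2), (y1, y))
  else if Rle_dec (val r / 4) (Phi x1 x y y2) then ((x1, x), (y, y2))
  else ((x, x2), (y, y2)).

Let nest (n : nat) : rect := Nat.iter n quarter ((a, b), (c, d)).

Let x1 n := fst (fst (nest n)).
Let x2 n := snd (fst (nest n)).
Let y1 n := fst (snd (nest n)).
Let y2 n := snd (snd (nest n)).

Lemma nest_spec (n : nat) :
  (a <= x1 n /\ x1 n <= x2 n /\ x2 n <= b /\ c <= y1 n /\ y1 n <= y2 n /\ y2 n <= d) /\
  (x2 n - x1 n = (b - a) * (/ 2) ^ n /\ y2 n - y1 n = (d - c) * (/ 2) ^ n) /\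
  Phi a b c d * (/ 4) ^ n <= Phi (x1 n) (x2 n) (y1 n) (y2 n) /\
  (x1 n <= x1 (S n) /\ x2 (S n) <= x2 n /\ y1 n <= y1 (S n) /\ y2 (S n) <= y2 n).
Proof.
assert (Hstep : forall m,
  a <= x1 m -> x1 m <= x2 m -> x2 m <= b -> c <= y1 m -> y1 m <= y2 m -> y2 m <= d ->
  Phi (x1 m) (x2 m) (y1 m) (y2 m) / 4
    <= Phi (x1 (S m)) (x2 (S m)) (y1 (S m)) (y2 (S m)) /\
  x2 (S m) - x1 (S m) = (x2 m - x1 m) / 2 /\
  y2 (S m) - y1 (S m) = (y2 m - y1 m) / 2 /\
  (x1 m <= x1 (S m) /\ x2 (S m) <= x2 m /\ y1 m <= y1 (S m) /\ y2 (S m) <= y2 m)).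
{ intros m H1 H2 H3 H4 H5 H6.
  assert (HP := Phi_split _ _ _ _ H1 H2 H3 H4 H5 H6).
  unfold x1, x2, y1, y2 in *; simpl; unfold quarter at 1 2 3 4 5 6 7 8 9 10 11 12.
  fold (nest m); fold (val (nest m)) in HP |- *.
  repeat destruct Rle_dec; simpl; repeat split; try lra. }
induction n as [|n [[H1 [H2 [H3 [H4 [H5 H6]]]]] [[H7 H8] [H9 H10]]]].
- assert (H := Hstep 0%nat); revert H; unfold x1, x2, y1, y2; simpl; intros H.
  destruct H as [_ [_ [_ H]]]; lra.
- assert (Hb : a <= x1 (S n) /\ x1 (S n) <= x2 (S n) /\ x2 (S n) <= b /\
     c <= y1 (S n) /\ y1 (S n) <= y2 (S n) /\ y2 (S n) <= d).
  { destruct (Hstep n) as [_ [E1 [E2 _]]]; try assumption; lra. }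
  destruct Hb as [B1 [B2 [B3 [B4 [B5 B6]]]]].
  destruct (Hstep n) as [E0 [E1 [E2 _]]]; try assumption.
  destruct (Hstep (S n)) as [_ [_ [_ E]]]; try assumption.
  repeat split; try assumption; try tauto.
  + rewrite E1, H7; simpl; lra.
  + rewrite E2, H8; simpl; lra.
  + simpl; lra.
Qed.

(** The bisection argument shared by all forms of the Goursat theorem. If a quantity
attached to rectangles is at most the sum over the four quarters, one quarter
carries at least a fourth of it. Iterating, the n-th rectangle carries at least
[4^-n] times the initial value, while near the limit point of the rectangles the
quantity is small compared with the square of their size, which is of order [4^-n].
*)
Lemma bisection_nonpos : Phi a b c d <= 0.
Proof.
assert (Hlim : forall k, is_lim_seq (fun n => k * (/ 2) ^ n) 0).
{ intros k; replace (Finite 0) with (Rbar_mult k 0) by (simpl; f_equal; ring).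
  apply (is_lim_seq_scal_l (fun n => (/ 2) ^ n) k 0), is_lim_seq_geom.
  rewrite Rabs_pos_eq; lra. }
destruct (ex_lim_seq_adj x1 x2) as [[x Hx] [[x' Hx'] Ex]].
{ intros n; apply nest_spec. } { intros n; apply nest_spec. }
{ apply (is_lim_seq_ext (fun n => (b - a) * (/ 2) ^ n)); [|apply Hlim].
  intros n; symmetry; apply nest_spec. }
destruct (ex_lim_seq_adj y1 y2) as [[y Hy] [[y' Hy'] Ey]].
{ intros n; apply nest_spec. } { intros n; apply nest_spec. }
{ apply (is_lim_seq_ext (fun n => (d - c) * (/ 2) ^ n)); [|apply Hlim].
  intros n; symmetry; apply nest_spec. }
rewrite (is_lim_seq_unique _ _ Hx), (is_lim_seq_unique _ _ Hx') in Ex.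
rewrite (is_lim_seq_unique _ _ Hy), (is_lim_seq_unique _ _ Hy') in Ey.
injection Ex as <-; injection Ey as <-.
assert (Bx : forall n, x1 n <= x <= x2 n).
{ intros n; split.
  - apply is_lim_seq_incr_compare; [exact Hx | intros m; apply nest_spec].
  - apply is_lim_seq_decr_compare; [exact Hx' | intros m; apply nest_spec]. }
assert (By : forall n, y1 n <= y <= y2 n).
{ intros n; split.
  - apply is_lim_seq_incr_compare; [exact Hy | intros m; apply nest_spec].
  - apply is_lim_seq_decr_compare; [exact Hy' | intros m; apply nest_spec]. }
destruct (Rle_or_lt (Phi a b c d) 0) as [|Hpos]; [assumption|exfalso].
(* With this e the local bound on the n-th rectangle is less than
   Phi a b c d / 4^n, the amount that the bisection keeps in it. *)
set (e := Phi a b c d / (2 * (1 + ((b - a) + (d - c)) ^ 2))).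
assert (HD : 0 < 2 * (1 + ((b - a) + (d - c)) ^ 2)) by nra.
assert (He : 0 < e) by (apply Rdiv_lt_0_compat; assumption).
assert (Ee : e * (2 * (1 + ((b - a) + (d - c)) ^ 2)) = Phi a b c d)
  by (unfold e; field; lra).
destruct (Phi_small x y e) as [dl [Hdl HS]].
{ destruct (nest_spec 0) as [? _]; specialize (Bx 0%nat); lra. }
{ destruct (nest_spec 0) as [? _]; specialize (By 0%nat); lra. }
{ exact He. }
assert (HN : exists n, (b - a) * (/ 2) ^ n < dl /\ (d - c) * (/ 2) ^ n < dl).
{ assert (F1 := Hlim (b - a)); assert (F2 := Hlim (d - c)).
  apply is_lim_seq_spec in F1; apply is_lim_seq_spec in F2.
  destruct (F1 (mkposreal dl Hdl)) as [N1 HN1].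
  destruct (F2 (mkposreal dl Hdl)) as [N2 HN2].
  exists (N1 + N2)%nat; specialize (HN1 (N1 + N2)%nat ltac:(lia)).
  specialize (HN2 (N1 + N2)%nat ltac:(lia)); simpl in HN1, HN2.
  apply Rabs_lt_between in HN1; apply Rabs_lt_between in HN2; lra. }
destruct HN as [n [HN1 HN2]].
destruct (nest_spec n) as [[B1 [B2 [B3 [B4 [B5 B6]]]]] [[E1 E2] [E3 _]]].
specialize (HS _ _ _ _ B1 (Bx n) B3 B4 (By n) B6).
rewrite E1, E2 in HS; specialize (HS HN1 HN2).
assert (Hq : 0 < (/ 4) ^ n) by (apply pow_lt; lra).
assert (Hq2 : ((/ 2) ^ n) ^ 2 = (/ 4) ^ n).
{ replace (/ 4) with ((/ 2) ^ 2) by lra; rewrite <- !pow_mult; f_equal; lia. }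
replace (e * ((b - a) * (/ 2) ^ n + (d - c) * (/ 2) ^ n) ^ 2)
  with (e * ((b - a) + (d - c)) ^ 2 * ((/ 2) ^ n) ^ 2) in HS by ring.
rewrite Hq2 in HS.
assert (e * ((b - a) + (d - c)) ^ 2 < Phi a b c d) by lra.
nra.
Qed.

End Bisection.

(** * Integrals and velocities of plane curves *)

(** Integrals of complex-valued functions of a real variable, C being seen as a real
normed module. *)
Definition is_CInt (g : R -> C) (a b : R) (l : C) : Prop :=
  @is_RInt C_R_NormedModule g a b l.

Definition CInt (g : R -> C) (a b : R) : C :=
  @RInt C_R_CompleteNormedModule g a b.

Definition Ccont (g : R -> C) (t : R) : Prop :=
  @continuous R_UniformSpace C_UniformSpace g t.

Lemma CInt_correct (g : R -> C) (a b : R) : a <= b ->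
  (forall t, a <= t <= b -> Ccont g t) -> is_CInt g a b (CInt g a b).
Proof.
intros Hab H; apply (@RInt_correct C_R_CompleteNormedModule).
apply (@ex_RInt_continuous C_R_CompleteNormedModule).
intros t; rewrite Rmin_left, Rmax_right by assumption; apply H.
Qed.

Lemma is_CInt_unique (g : R -> C) (a b : R) (l : C) :
  is_CInt g a b l -> CInt g a b = l.
Proof. exact (@is_RInt_unique C_R_CompleteNormedModule g a b l). Qed.

Lemma is_CInt_minus (f g : R -> C) (a b : R) (l m : C) :
  is_CInt f a b l -> is_CInt g a b m ->
  is_CInt (fun t => f t - g t)%C a b (l - m)%C.
Proof. exact (@is_RInt_minus C_R_NormedModule f g a b l m). Qed.

(** The integral over the real normed module C is linear over R only; linearity over
C is checked on coordinates. *)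
Lemma is_CInt_scal (c : C) (g : R -> C) (a b : R) (l : C) :
  is_CInt g a b l -> is_CInt (fun t => c * g t)%C a b (c * l)%C.
Proof.
intros H.
assert (H1 := is_RInt_fct_extend_fst g a b l H).
assert (H2 := is_RInt_fct_extend_snd g a b l H).
apply (is_RInt_fct_extend_pair (U := R_NormedModule) (V := R_NormedModule)).
- exact (is_RInt_minus _ _ _ _ _ _ (is_RInt_scal _ _ _ (fst c) _ H1)
    (is_RInt_scal _ _ _ (snd c) _ H2)).
- exact (is_RInt_plus _ _ _ _ _ _ (is_RInt_scal _ _ _ (fst c) _ H2)
    (is_RInt_scal _ _ _ (snd c) _ H1)).
Qed.

Lemma is_CInt_conj (g : R -> C) (a b : R) (l : C) :
  is_CInt g a b l -> is_CInt (fun t => Cconj (g t)) a b (Cconj l).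
Proof.
intros H.
assert (H1 := is_RInt_fct_extend_fst g a b l H).
assert (H2 := is_RInt_fct_extend_snd g a b l H).
apply (is_RInt_fct_extend_pair (U := R_NormedModule) (V := R_NormedModule)).
- exact H1.
- exact (is_RInt_opp _ _ _ _ H2).
Qed.

Lemma is_CInt_const (c : C) (a b : R) :
  is_CInt (fun _ => c) a b ((b - a)%R * c)%C.
Proof.
rewrite <- scal_R_Cmult; apply (@is_RInt_const C_R_NormedModule).
Qed.

Lemma is_CInt_bound (g : R -> C) (a b : R) (l : C) (M : R) : a <= b ->
  (forall t, a <= t <= b -> Cmod (g t) <= M) -> is_CInt g a b l ->
  Cmod l <= (b - a) * M.
Proof.
intros Hab HM H; rewrite Cmod_norm.
apply (@norm_RInt_le_const C_R_NormedModule g a b l M Hab); [|exact H].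
intros t Ht; rewrite <- Cmod_norm; now apply HM.
Qed.

Lemma is_CInt_Cmod_le (g : R -> C) (h : R -> R) (a b : R) (l : C) (m : R) :
  a <= b -> (forall t, a <= t <= b -> Cmod (g t) <= h t) ->
  is_CInt g a b l -> is_RInt h a b m -> Cmod l <= m.
Proof.
intros Hab Hgh Hg Hh; rewrite Cmod_norm.
apply (@norm_RInt_le C_R_NormedModule g h a b l m Hab); try assumption.
intros t Ht; rewrite <- Cmod_norm; now apply Hgh.
Qed.

Lemma CInt_Chasles (g : R -> C) (a b c : R) : a <= b -> b <= c ->
  (forall t, a <= t <= c -> Ccont g t) ->
  CInt g a c = (CInt g a b + CInt g b c)%C.
Proof.
intros Hab Hbc Hg; apply is_CInt_unique.
apply (@is_RInt_Chasles C_R_NormedModule g a b c).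
- apply CInt_correct; [lra|]; intros t Ht; apply Hg; lra.
- apply CInt_correct; [lra|]; intros t Ht; apply Hg; lra.
Qed.

Definition Rder (g : R -> C) (t : R) (m : C) : Prop :=
  forall eps, 0 < eps -> exists delta, 0 < delta /\
    forall s, Rabs (s - t) < delta ->
      Cmod (g s - g t - (s - t)%R * m) <= eps * Rabs (s - t).

Lemma Rder_is_derive (g : R -> C) (t : R) (m : C) : Rder g t m ->
  @is_derive R_AbsRing C_R_NormedModule g t m.
Proof.
intros H; split; [apply is_linear_scal_l|].
intros x Hx eps.
assert (x = t) as ->.
{ symmetry; apply (@is_filter_lim_locally_unique R_AbsRing R_NormedModule);
  exact Hx. }
destruct (H eps (cond_pos eps)) as [d [Hd H']].
exists (mkposreal d Hd); intros s Hs.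
rewrite <- Cmod_norm.
specialize (H' s Hs); rewrite <- scal_R_Cmult in H'; exact H'.
Qed.

Lemma Rder_pair (u v : R -> R) (t du dv : R) :
  is_derive u t du -> is_derive v t dv ->
  Rder (fun s => (u s, v s)) t (du, dv).
Proof.
intros [_ Hu] [_ Hv] eps Heps.
assert (He : 0 < eps / 2) by lra.
destruct (Hu t (fun P HP => HP) (mkposreal _ He)) as [d1 H1].
destruct (Hv t (fun P HP => HP) (mkposreal _ He)) as [d2 H2].
exists (Rmin d1 d2); split; [apply Rmin_glb_lt; apply cond_pos|].
intros s Hs.
assert (B1 := H1 s (Rlt_le_trans _ _ _ Hs (Rmin_l _ _))).
assert (B2 := H2 s (Rlt_le_trans _ _ _ Hs (Rmin_r _ _))).
change (Rabs (u s - u t - (s - t) * du) <= eps / 2 * Rabs (s - t)) in B1.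
change (Rabs (v s - v t - (s - t) * dv) <= eps / 2 * Rabs (s - t)) in B2.
set (x := u s - u t - (s - t) * du) in *.
set (y := v s - v t - (s - t) * dv) in *.
replace ((u s, v s) - (u t, v t) - (s - t)%R * (du, dv))%C
  with (RtoC x + Ci * RtoC y)%C.
- eapply Rle_trans; [apply Cmod_triangle|].
  rewrite Cmod_mult, Cmod_Ci, !Cmod_R; lra.
- apply injective_projections; unfold x, y; simpl; ring.
Qed.

(** The chain rule along a curve, which links differentiation over C and over R. *)
Lemma Rder_Cder_comp (f : C -> C) (g : R -> C) (t : R) (l m : C) :
  Cder f (g t) l -> Rder g t m -> Rder (fun s => f (g s)) t (l * m)%C.
Proof.
intros Hf Hg eps Heps.
assert (Al := Cmod_ge_0 l); assert (Am := Cmod_ge_0 m).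
destruct (Hf (eps / (2 * (1 + Cmod m)))) as [d1 [Hd1 H1]].
{ apply Rdiv_lt_0_compat; lra. }
destruct (Hg (Rmin 1 (eps / (2 * (1 + Cmod l))))) as [d2 [Hd2 H2]].
{ apply Rmin_glb_lt; [lra|apply Rdiv_lt_0_compat; lra]. }
exists (Rmin d2 (d1 / (1 + Cmod m))); split.
{ apply Rmin_glb_lt; [assumption|apply Rdiv_lt_0_compat; lra]. }
intros s Hs.
assert (S1 := Rlt_le_trans _ _ _ Hs (Rmin_l _ _)).
assert (S2 := Rlt_le_trans _ _ _ Hs (Rmin_r _ _)).
apply Rlt_div_r in S2; [|lra].
specialize (H2 s S1); assert (As := Rabs_pos (s - t)).
set (h := Rabs (s - t)) in *.
assert (E1 : Rmin 1 (eps / (2 * (1 + Cmod l))) <= 1) by apply Rmin_l.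
assert (E2 : Rmin 1 (eps / (2 * (1 + Cmod l))) * (1 + Cmod l) <= eps / 2).
{ eapply Rle_trans; [apply Rmult_le_compat_r; [lra|apply Rmin_r]|].
  apply Req_le; field; lra. }
set (e := Rmin 1 (eps / (2 * (1 + Cmod l)))) in *.
set (q := (g s - g t - (s - t)%R * m)%C) in *.
assert (Hgs : Cmod (g s - g t) <= (1 + Cmod m) * h).
{ replace (g s - g t)%C with (q + (s - t)%R * m)%C by (unfold q; ring).
  eapply Rle_trans; [apply Cmod_triangle|].
  rewrite Cmod_mult, Cmod_R; fold h; nra. }
specialize (H1 (g s) ltac:(nra)).
replace (f (g s) - f (g t) - (s - t)%R * (l * m))%C with
  ((f (g s) - f (g t) - l * (g s - g t)) + l * q)%C by (unfold q; ring).
eapply Rle_trans; [apply Cmod_triangle|]; rewrite Cmod_mult.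
assert (Cmod l * Cmod q <= eps / 2 * h).
{ apply Rle_trans with (Cmod l * (e * h)).
  - apply Rmult_le_compat_l; assumption.
  - assert (0 <= e) by (unfold e; apply Rmin_glb; [lra|];
      apply Rlt_le, Rdiv_lt_0_compat; lra).
    assert (e * Cmod l <= eps / 2) by nra. nra. }
assert (eps / (2 * (1 + Cmod m)) * Cmod (g s - g t) <= eps / 2 * h).
{ apply Rle_trans with (eps / (2 * (1 + Cmod m)) * ((1 + Cmod m) * h)).
  - apply Rmult_le_compat_l; [apply Rlt_le, Rdiv_lt_0_compat; lra | exact Hgs].
  - apply Req_le; field; lra. }
lra.
Qed.

Lemma Rder_cis (t : R) : Rder cis t (Ci * cis t)%C.
Proof.
replace (Ci * cis t)%C with (- sin t, cos t).
- apply (Rder_pair cos sin); [apply is_derive_cos | apply is_derive_sin].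
- apply injective_projections; simpl; ring.
Qed.

Lemma Rder_id (t : R) : Rder RtoC t (RtoC 1).
Proof.
apply (Rder_pair (fun s => s) (fun _ => 0)).
- apply (@is_derive_id R_AbsRing).
- apply (@is_derive_const R_AbsRing R_NormedModule).
Qed.

Lemma Rder_cont (g : R -> C) (t : R) (m : C) : Rder g t m -> Ccont g t.
Proof.
intros H; apply Rder_is_derive in H.
apply (@ex_derive_continuous R_AbsRing C_R_NormedModule); exists m; exact H.
Qed.

Lemma is_CInt_ext (f g : R -> C) (a b : R) (l : C) : a <= b ->
  (forall t, a <= t <= b -> f t = g t) -> is_CInt f a b l -> is_CInt g a b l.
Proof.
intros Hab H; apply (@is_RInt_ext C_R_NormedModule).
intros t; rewrite Rmin_left, Rmax_right by assumption; intros Ht; apply H; lra.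
Qed.

(** * The Goursat theorem on a parametrized rectangle *)

Lemma cont_comp_Cdif (f : C -> C) (g : R -> C) (t : R) :
  Ccont g t -> Cdif f (g t) -> Ccont (fun s => f (g s)) t.
Proof.
intros Hg Hf; apply (continuous_comp (V := C_UniformSpace) g f t Hg).
now apply Cdif_continuous.
Qed.

Lemma is_CInt_derive (g dg : R -> C) (a b : R) : a <= b ->
  (forall t, a <= t <= b -> Rder g t (dg t)) ->
  (forall t, a <= t <= b -> Ccont dg t) ->
  is_CInt dg a b (g b - g a)%C.
Proof.
intros Hab Hd Hc.
apply (@is_RInt_derive C_R_CompleteNormedModule g dg a b);
  intros t; rewrite Rmin_left, Rmax_right by assumption; intros Ht.
- apply Rder_is_derive, Hd, Ht.
- apply Hc, Ht.
Qed.

(** A primitive of the first-order Taylor polynomial [A + l (w - c)]. *)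
Definition taylor_primitive (A l c w : C) : C := (A * w + l * ((w - c) * (w - c)) / 2)%C.

Lemma taylor_primitive_Cder (A l c w : C) :
  Cder (taylor_primitive A l c) w (A + l * (w - c))%C.
Proof.
assert (H1 : Cder (fun w => w - c)%C w (RtoC 1)).
{ generalize (Cder_minus _ _ _ _ _ (Cder_id w) (Cder_const c w)).
  replace (1 - 0)%C with (RtoC 1) by ring; trivial. }
generalize (Cder_plus _ _ _ _ _
  (Cder_mult _ _ _ _ _ (Cder_const A w) (Cder_id w))
  (Cder_mult _ _ _ _ _
    (Cder_mult _ _ _ _ _ (Cder_const l w) (Cder_mult _ _ _ _ _ H1 H1))
    (Cder_const (/ 2)%C w))).
match goal with |- Cder _ _ ?x -> _ =>
  replace x with (A + l * (w - c))%C; [intros H; exact H|] end.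
field.
Qed.

(** On one side of a small rectangle, the integral of k differs from the increment
of the primitive of its Taylor polynomial only through the Taylor remainder, which
is at most [eta]. Around a closed boundary these increments cancel. *)
Lemma side_estimate (k : C -> C) (g dg : R -> C) (A l c : C) (u v eta L : R) :
  u <= v ->
  (forall t, u <= t <= v -> Rder g t (dg t)) ->
  (forall t, u <= t <= v -> Ccont dg t) ->
  (forall t, u <= t <= v -> Cdif k (g t)) ->
  (forall t, u <= t <= v -> Cmod (k (g t) - A - l * (g t - c)) <= eta) ->
  (forall t, u <= t <= v -> Cmod (dg t) <= L) ->
  Cmod (CInt (fun t => k (g t) * dg t)%C u v -
        (taylor_primitive A l c (g v) - taylor_primitive A l c (g u))) <=
    (v - u) * (eta * L).
Proof.
intros Huv Hd Hc Hk He HL.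
assert (Hg : forall t, u <= t <= v -> Ccont g t)
  by (intros t Ht; eapply Rder_cont, Hd, Ht).
assert (I1 : is_CInt (fun t => k (g t) * dg t)%C u v
               (CInt (fun t => k (g t) * dg t)%C u v)).
{ apply CInt_correct; [assumption|]; intros t Ht; apply cont_Cmult.
  - apply cont_comp_Cdif; auto.
  - apply Hc, Ht. }
assert (I2 : is_CInt (fun t => (A + l * (g t - c)) * dg t)%C u v
               (taylor_primitive A l c (g v) - taylor_primitive A l c (g u))%C).
{ apply (is_CInt_derive (fun t => taylor_primitive A l c (g t))); [assumption| |].
  - intros t Ht; apply Rder_Cder_comp; [apply taylor_primitive_Cder | apply Hd, Ht].
  - intros t Ht; apply cont_Cmult; [|apply Hc, Ht].
    apply cont_Cplus; [apply continuous_const|].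
    apply cont_Cmult; [apply continuous_const|].
    apply cont_Cminus; [apply Hg, Ht | apply continuous_const]. }
eapply is_CInt_bound; [exact Huv | | exact (is_CInt_minus _ _ _ _ _ _ I1 I2)].
intros t Ht; simpl.
replace (k (g t) * dg t - (A + l * (g t - c)) * dg t)%C
  with ((k (g t) - A - l * (g t - c)) * dg t)%C by ring.
rewrite Cmod_mult; apply Rmult_le_compat; auto using Cmod_ge_0.
Qed.

Section Goursat.

Variables Gam Gs Gt : R -> R -> C.
Variable k : C -> C.
Variables a b c d L : R.
Hypothesis hab : a <= b.
Hypothesis hcd : c <= d.
Hypothesis Gam_s : forall s t, Rder (fun s => Gam s t) s (Gs s t).
Hypothesis Gam_t : forall s t, Rder (fun t => Gam s t) t (Gt s t).
Hypothesis Gs_cont : forall s t, Ccont (fun s => Gs s t) s.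
Hypothesis Gt_cont : forall s t, Ccont (fun t => Gt s t) t.
Hypothesis hL : 0 < L.
Hypothesis Gs_bound : forall s t, a <= s <= b -> c <= t <= d -> Cmod (Gs s t) <= L.
Hypothesis Gt_bound : forall s t, a <= s <= b -> c <= t <= d -> Cmod (Gt s t) <= L.
Hypothesis Gam_lip : forall s t s' t', a <= s <= b -> c <= t <= d ->
  a <= s' <= b -> c <= t' <= d ->
  Cmod (Gam s t - Gam s' t') <= L * (Rabs (s - s') + Rabs (t - t')).
Hypothesis k_dif : forall s t, a <= s <= b -> c <= t <= d -> Cdif k (Gam s t).

Let horiz (s1 s2 t : R) : C := CInt (fun s => k (Gam s t) * Gs s t)%C s1 s2.
Let vert (s t1 t2 : R) : C := CInt (fun t => k (Gam s t) * Gt s t)%C t1 t2.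
Let loop (s1 s2 t1 t2 : R) : C :=
  (horiz s1 s2 t1 + vert s2 t1 t2 - horiz s1 s2 t2 - vert s1 t1 t2)%C.

Lemma horiz_split (s1 s2 s3 t : R) : a <= s1 -> s1 <= s2 -> s2 <= s3 -> s3 <= b ->
  c <= t <= d -> horiz s1 s3 t = (horiz s1 s2 t + horiz s2 s3 t)%C.
Proof.
intros H1 H2 H3 H4 Ht; apply CInt_Chasles; try assumption.
intros s Hs; apply cont_Cmult; [|apply Gs_cont].
apply (cont_comp_Cdif k (fun s => Gam s t)).
- eapply Rder_cont, Gam_s.
- apply k_dif; [lra|assumption].
Qed.

Lemma vert_split (s t1 t2 t3 : R) : c <= t1 -> t1 <= t2 -> t2 <= t3 -> t3 <= d ->
  a <= s <= b -> vert s t1 t3 = (vert s t1 t2 + vert s t2 t3)%C.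
Proof.
intros H1 H2 H3 H4 Hs; apply CInt_Chasles; try assumption.
intros t Ht; apply cont_Cmult; [|apply Gt_cont].
apply (cont_comp_Cdif k (fun t => Gam s t)).
- eapply Rder_cont, Gam_t.
- apply k_dif; [assumption|lra].
Qed.

Lemma loop_split (s1 s2 t1 t2 : R) :
  a <= s1 -> s1 <= s2 -> s2 <= b -> c <= t1 -> t1 <= t2 -> t2 <= d ->
  Cmod (loop s1 s2 t1 t2) <=
    Cmod (loop s1 ((s1 + s2) / 2) t1 ((t1 + t2) / 2)) +
    Cmod (loop ((s1 + s2) / 2) s2 t1 ((t1 + t2) / 2)) +
    Cmod (loop s1 ((s1 + s2) / 2) ((t1 + t2) / 2) t2) +
    Cmod (loop ((s1 + s2) / 2) s2 ((t1 + t2) / 2) t2).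
Proof.
intros H1 H2 H3 H4 H5 H6.
set (s := (s1 + s2) / 2); set (t := (t1 + t2) / 2).
assert (Hs : s1 <= s <= s2) by (unfold s; lra).
assert (Ht : t1 <= t <= t2) by (unfold t; lra).
replace (loop s1 s2 t1 t2) with
  (loop s1 s t1 t + loop s s2 t1 t + loop s1 s t t2 + loop s s2 t t2)%C.
- eapply Rle_trans; [apply Cmod_triangle|]; apply Rplus_le_compat_r.
  eapply Rle_trans; [apply Cmod_triangle|]; apply Rplus_le_compat_r.
  apply Cmod_triangle.
- unfold loop.
  rewrite (horiz_split s1 s s2 t1), (horiz_split s1 s s2 t2) by lra.
  rewrite (vert_split s1 t1 t t2), (vert_split s2 t1 t t2) by lra.
  ring.
Qed.

(** Near a point where k is differentiable, the integral around a rectangle is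
bounded by the perimeter times the Taylor remainder, and both are of the order of
the size of the rectangle, the second with a small factor. *)
Lemma loop_small (s t eps : R) : a <= s <= b -> c <= t <= d -> 0 < eps ->
  exists delta, 0 < delta /\ forall s1 s2 t1 t2,
    a <= s1 -> s1 <= s <= s2 -> s2 <= b ->
    c <= t1 -> t1 <= t <= t2 -> t2 <= d ->
    s2 - s1 < delta -> t2 - t1 < delta ->
    Cmod (loop s1 s2 t1 t2) <= eps * ((s2 - s1) + (t2 - t1)) ^ 2.
Proof.
intros Hs Ht Heps.
destruct (k_dif s t Hs Ht) as [l Hl].
destruct (Hl (eps / (2 * L ^ 2))) as [dl [Hdl H]].
{ apply Rdiv_lt_0_compat; [assumption|]; nra. }
exists (dl / (2 * L)); split.
{ apply Rdiv_lt_0_compat; lra. }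
intros s1 s2 t1 t2 A1 A2 A3 B1 B2 B3 Es Et.
apply Rlt_div_r in Es; [|lra]; apply Rlt_div_r in Et; [|lra].
set (D := (s2 - s1) + (t2 - t1)).
assert (HD : 0 <= D) by (unfold D; lra).
(* The image of the small rectangle has diameter at most L * D, and the four
   sides have total length 2 * D. *)
set (eta := eps / (2 * L ^ 2) * (L * D)).
assert (Hloc : forall s' t', s1 <= s' <= s2 -> t1 <= t' <= t2 ->
  Cmod (k (Gam s' t') - k (Gam s t) - l * (Gam s' t' - Gam s t)) <= eta).
{ intros s' t' Hs' Ht'.
  assert (HG : Cmod (Gam s' t' - Gam s t) <= L * D).
  { eapply Rle_trans; [apply Gam_lip; lra|].
    apply Rmult_le_compat_l; [lra|]; unfold D.
    apply Rplus_le_compat; apply Rabs_le; lra. }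
  eapply Rle_trans; [apply H|].
  - eapply Rle_lt_trans; [exact HG|]; unfold D; nra.
  - apply Rmult_le_compat_l; [apply Rlt_le, Rdiv_lt_0_compat; nra | exact HG]. }
assert (E1 : forall t', t' = t1 \/ t' = t2 ->
  Cmod (horiz s1 s2 t' - (taylor_primitive (k (Gam s t)) l (Gam s t) (Gam s2 t') -
     taylor_primitive (k (Gam s t)) l (Gam s t) (Gam s1 t'))) <= (s2 - s1) * (eta * L)).
{ intros t' Ht'.
  apply (side_estimate k (fun s => Gam s t') (fun s => Gs s t')); try lra.
  - intros; apply Gam_s.
  - intros; apply Gs_cont.
  - intros; apply k_dif; lra.
  - intros; apply Hloc; lra.
  - intros; apply Gs_bound; lra. }
assert (E2 : forall s', s' = s1 \/ s' = s2 ->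
  Cmod (vert s' t1 t2 - (taylor_primitive (k (Gam s t)) l (Gam s t) (Gam s' t2) -
     taylor_primitive (k (Gam s t)) l (Gam s t) (Gam s' t1))) <= (t2 - t1) * (eta * L)).
{ intros s' Hs'.
  apply (side_estimate k (fun t => Gam s' t) (fun t => Gt s' t)); try lra.
  - intros; apply Gam_t.
  - intros; apply Gt_cont.
  - intros; apply k_dif; lra.
  - intros; apply Hloc; lra.
  - intros; apply Gt_bound; lra. }
set (q := taylor_primitive (k (Gam s t)) l (Gam s t)) in *.
assert (F1 := E1 t1 (or_introl eq_refl)); assert (F2 := E1 t2 (or_intror eq_refl)).
assert (F3 := E2 s1 (or_introl eq_refl)); assert (F4 := E2 s2 (or_intror eq_refl)).
set (r1 := (horiz s1 s2 t1 - _)%C) in F1; set (r2 := (horiz s1 s2 t2 - _)%C) in F2.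
set (r3 := (vert s1 t1 t2 - _)%C) in F3; set (r4 := (vert s2 t1 t2 - _)%C) in F4.
replace (loop s1 s2 t1 t2) with (r1 + r4 + - r2 + - r3)%C
  by (unfold loop, r1, r2, r3, r4; ring).
apply Rle_trans with (Cmod r1 + Cmod r4 + Cmod r2 + Cmod r3).
{ rewrite <- (Cmod_opp r2), <- (Cmod_opp r3).
  eapply Rle_trans; [apply Cmod_triangle|]; apply Rplus_le_compat_r.
  eapply Rle_trans; [apply Cmod_triangle|]; apply Rplus_le_compat_r.
  apply Cmod_triangle. }
apply Rle_trans with (2 * D * (eta * L)); [unfold D at 1; lra|].
apply Req_le; unfold eta; fold D; field; lra.
Qed.

(** The integral of k along the image of the boundary of a rectangle vanishes as
soon as k is complex differentiable at each point of the image, because the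
bisection only uses the first-order expansion of k at one point. A general
parametrization [Gam] is used because it will sweep the region between a circle and
a point that is not its centre. *)
Lemma goursat : (vert b c d - vert a c d = horiz a b d - horiz a b c)%C.
Proof.
assert (H := bisection_nonpos (fun s1 s2 t1 t2 => Cmod (loop s1 s2 t1 t2))
  a b c d hab hcd loop_split loop_small).
assert (H0 : loop a b c d = RtoC 0).
{ apply Cmod_eq_0, Rle_antisym; [exact H | apply Cmod_ge_0]. }
unfold loop in H0.
replace (vert b c d - vert a c d)%C with
 ((horiz a b c + vert b c d - horiz a b d - vert a c d) + (horiz a b d - horiz a b c))%C
 by ring.
rewrite H0; ring.
Qed.

End Goursat.

(** * The Cauchy formula for a circle *)

Lemma CInt_ext (f g : R -> C) (a b : R) : a <= b ->
  (forall t, a <= t <= b -> f t = g t) -> CInt f a b = CInt g a b.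
Proof.
intros Hab H; apply (@RInt_ext C_R_CompleteNormedModule).
intros t; rewrite Rmin_left, Rmax_right by assumption; intros Ht; apply H; lra.
Qed.

Lemma Cmod_cis (t : R) : Cmod (cis t) = 1.
Proof.
rewrite <- (Cmod_polar 1 t) by lra; f_equal; ring.
Qed.

Lemma Cmod_rcis (r t : R) : 0 <= r -> Cmod (r * cis t) = r.
Proof. intros Hr; rewrite Cmod_mult, Cmod_cis, Cmod_R, Rabs_pos_eq; lra. Qed.

Lemma cont_cis_id (t : R) : Ccont cis t.
Proof. apply (cont_cis (fun t => t)), continuous_id. Qed.

Lemma cis_lip (s t : R) : Cmod (cis s - cis t) <= Rabs (s - t).
Proof.
assert (H : forall a b, a <= b -> Cmod (cis b - cis a) <= b - a).
{ intros a b Hab; replace (b - a) with ((b - a) * 1) by ring.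
  eapply is_CInt_bound; [exact Hab | |
    apply (is_CInt_derive cis (fun t => Ci * cis t)%C a b Hab)].
  - intros x _; simpl; rewrite Cmod_mult, Cmod_Ci, Cmod_cis; lra.
  - intros x _; apply Rder_cis.
  - intros x _; apply cont_Cmult; [apply continuous_const|apply cont_cis_id]. }
destruct (Rle_or_lt s t) as [Hst|Hst].
- rewrite Cmod_minus_sym, Rabs_left1 by lra; specialize (H s t Hst); lra.
- rewrite Rabs_pos_eq by lra; apply H; lra.
Qed.

Lemma cis_period : cis (2 * PI) = cis 0.
Proof. unfold cis; rewrite cos_2PI, sin_2PI, cos_0, sin_0; reflexivity. Qed.

Lemma Rder_affine (u v : C) (t : R) : Rder (fun s => u + RtoC s * v)%C t v.
Proof.
assert (H : Cder (fun w => u + w * v)%C (RtoC t) v).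
{ generalize (Cder_plus _ _ _ _ _ (Cder_const u (RtoC t))
    (Cder_mult _ _ _ _ _ (Cder_id (RtoC t)) (Cder_const v (RtoC t)))).
  match goal with |- Cder _ _ ?x -> _ => replace x with v; [trivial|ring] end. }
generalize (Rder_Cder_comp _ _ _ _ _ H (Rder_id t)).
rewrite Cmult_1_r; trivial.
Qed.

(** For fixed s, the curve [Gam s] is the image of the circle of radius r under the
contraction of ratio s centred at z. Since [Gam s t - z] is s times [r cis t - z],
the form [dw / (w - z)] pulls back to [Ci * ker t * dt] on each of these curves,
whatever s is. *)
Section Cauchy.

Variable f : C -> C.
Variable r : R.
Hypothesis hr : 0 < r.
Hypothesis f_dif : forall w, Cmod w <= r -> Cdif f w.
Variable z : C.
Hypothesis hz : Cmod z < r.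

Let ker (t : R) : C := (r * cis t / (r * cis t - z))%C.
Let Gam (s t : R) : C := (z + s * (r * cis t - z))%C.

Lemma circle_minus_neq_0 (t : R) : (r * cis t - z)%C <> RtoC 0.
Proof.
apply Cmod_neq_0; generalize (Cmod_triangle_minus (r * cis t) z).
rewrite Cmod_rcis; lra.
Qed.

Lemma ker_cont (t : R) : Ccont ker t.
Proof.
assert (H : Ccont (fun t => r * cis t)%C t).
{ apply cont_Cmult; [apply continuous_const | apply cont_cis_id]. }
apply cont_Cdiv; [exact H | | apply circle_minus_neq_0].
apply cont_Cminus; [exact H | apply continuous_const].
Qed.

Lemma ker_bound (t : R) : Cmod (ker t) <= r / (r - Cmod z).
Proof.
unfold ker; rewrite Cmod_div by apply circle_minus_neq_0.
rewrite Cmod_rcis by lra.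
apply Rmult_le_compat_l; [lra|].
apply Rinv_le_contravar; [lra|].
generalize (Cmod_triangle_minus (r * cis t) z); rewrite Cmod_rcis; lra.
Qed.

Lemma Gam_in (s t : R) : 0 <= s <= 1 -> Cmod (Gam s t) <= r.
Proof.
intros Hs; unfold Gam.
replace (z + s * (r * cis t - z))%C with ((1 - s)%R * z + s * (r * cis t))%C
  by (rewrite RtoC_minus; ring).
eapply Rle_trans; [apply Cmod_triangle|].
rewrite Cmod_mult, (Cmod_mult s), Cmod_rcis, !Cmod_R, !Rabs_pos_eq by lra.
nra.
Qed.

Lemma Gam_t_der (s t : R) : Rder (fun t => Gam s t) t (s * (r * (Ci * cis t)))%C.
Proof.
assert (H : Cder (fun w => z + s * (r * w - z))%C (cis t) (s * r)%C).
{ generalize (Cder_plus _ _ _ _ _ (Cder_const z (cis t))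
   (Cder_mult _ _ _ _ _ (Cder_const s (cis t))
     (Cder_minus _ _ _ _ _
      (Cder_mult _ _ _ _ _ (Cder_const r (cis t)) (Cder_id (cis t)))
      (Cder_const z (cis t))))).
  match goal with |- Cder _ _ ?x -> _ =>
    replace x with (s * r)%C; [trivial|ring] end. }
generalize (Rder_Cder_comp _ _ _ _ _ H (Rder_cis t)).
replace (s * r * (Ci * cis t))%C with (s * (r * (Ci * cis t)))%C by ring.
trivial.
Qed.

Lemma Gam_cont (s t : R) : Ccont (fun t => Gam s t) t.
Proof. eapply Rder_cont, Gam_t_der. Qed.

Lemma integrand_cont (s t : R) : 0 <= s <= 1 -> Ccont (fun t => f (Gam s t) * ker t)%C t.
Proof.
intros Hs; apply cont_Cmult; [|apply ker_cont].
apply (cont_comp_Cdif f (fun t => Gam s t)); [apply Gam_cont|].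
apply f_dif, Gam_in, Hs.
Qed.

(** The Goursat theorem for [f w / (w - z)] on the part of the homotopy that stays
away from z. The two sides [t = 0] and [t = 2 PI] have the same image and cancel. *)
Lemma circle_homotopy (e : R) : 0 < e <= 1 ->
  CInt (fun t => f (Gam 1 t) * ker t)%C 0 (2 * PI) =
  CInt (fun t => f (Gam e t) * ker t)%C 0 (2 * PI).
Proof.
intros He; assert (HP := PI_RGT_0).
assert (HG := goursat Gam (fun _ t => r * cis t - z)%C
  (fun s t => s * (r * (Ci * cis t)))%C (fun w => f w / (w - z))%C
  e 1 0 (2 * PI) (2 * r)).
cbv beta in HG.
assert (HV : forall s, e <= s <= 1 ->
  CInt (fun t => f (Gam s t) / (Gam s t - z) * (s * (r * (Ci * cis t))))%C 0 (2 * PI)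
  = (Ci * CInt (fun t => f (Gam s t) * ker t)%C 0 (2 * PI))%C).
{ intros s Hs; apply is_CInt_unique.
  apply (is_CInt_ext (fun t => Ci * (f (Gam s t) * ker t))%C); [lra| |].
  - intros t _; unfold ker; generalize (circle_minus_neq_0 t); intros Ht.
    replace (Gam s t - z)%C with (s * (r * cis t - z))%C by (unfold Gam; ring).
    generalize (f (Gam s t)); intros v; field; split; [exact Ht|].
    apply Cmod_neq_0; rewrite Cmod_R, Rabs_pos_eq; lra.
  - apply is_CInt_scal, CInt_correct; [lra|].
    intros t _; apply integrand_cont; lra. }
rewrite !HV in HG by lra.
assert (HH : CInt (fun s => f (Gam s (2 * PI)) / (Gam s (2 * PI) - z) *
    (r * cis (2 * PI) - z))%C e 1 =
  CInt (fun s => f (Gam s 0) / (Gam s 0 - z) * (r * cis 0 - z))%C e 1)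
  by (unfold Gam; rewrite cis_period; reflexivity).
rewrite HH in HG.
assert (H0 : forall x y : C, (Ci * x - Ci * y)%C = RtoC 0 -> x = y).
{ intros x y H; apply Ceq_minus.
  replace (x - y)%C with (- Ci * (Ci * x - Ci * y))%C.
  - rewrite H; ring.
  - transitivity (- (Ci * Ci) * (x - y))%C; [ring|].
    replace (Ci * Ci)%C with (RtoC (-1)).
    + rewrite <- RtoC_opp; replace (- -1) with 1 by ring; ring.
    + apply injective_projections; simpl; ring. }
apply H0; rewrite HG; try lra.
- ring.
- intros s t; apply Rder_affine.
- intros s t; apply Gam_t_der.
- intros s t; apply continuous_const.
- intros s t; repeat (apply cont_Cmult; [apply continuous_const|]).
  apply cont_cis_id.
- intros s t Hs Ht; eapply Rle_trans; [apply Cmod_triangle|].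
  rewrite Cmod_opp, Cmod_rcis; lra.
- intros s t Hs Ht.
  rewrite !Cmod_mult, Cmod_Ci, Cmod_cis, !Cmod_R, !Rabs_pos_eq by lra; nra.
- intros s t s' t' Hs Ht Hs' Ht'.
  replace (Gam s t - Gam s' t')%C with
    ((s - s')%R * (r * cis t - z) + (s' * r)%R * (cis t - cis t'))%C
    by (unfold Gam; rewrite RtoC_minus, RtoC_mult; ring).
  eapply Rle_trans; [apply Cmod_triangle|].
  rewrite !Cmod_mult, !Cmod_R, (Rabs_pos_eq (s' * r)) by nra.
  assert (H1 : Cmod (r * cis t - z) <= 2 * r).
  { eapply Rle_trans; [apply Cmod_triangle|]; rewrite Cmod_opp, Cmod_rcis; lra. }
  assert (H2 := cis_lip t t').
  assert (A1 := Rabs_pos (s - s')); assert (A2 := Rabs_pos (t - t')).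
  assert (A3 := Cmod_ge_0 (cis t - cis t')).
  assert (s' * r <= 2 * r) by nra.
  assert (s' * r * Cmod (cis t - cis t') <= 2 * r * Rabs (t - t'))
    by (apply Rmult_le_compat; nra).
  nra.
- intros s t Hs Ht; apply Cdif_div.
  + apply f_dif, Gam_in; lra.
  + apply Cdif_minus; [apply Cdif_id | apply Cdif_const].
  + replace (Gam s t - z)%C with (s * (r * cis t - z))%C by (unfold Gam; ring).
    apply Cmult_neq_0; [|apply circle_minus_neq_0].
    apply Cmod_neq_0; rewrite Cmod_R, Rabs_pos_eq; lra.
Qed.

(** Contracting the circle to z turns [f] into the constant [f z] under the
integral. *)
Lemma cauchy_ker :
  CInt (fun t => f (r * cis t) * ker t)%C 0 (2 * PI) =
  (f z * CInt ker 0 (2 * PI))%C.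
Proof.
assert (HP := PI_RGT_0).
assert (HJ : is_CInt ker 0 (2 * PI) (CInt ker 0 (2 * PI)))
  by (apply CInt_correct; [lra|intros t _; apply ker_cont]).
rewrite (CInt_ext _ (fun t => f (Gam 1 t) * ker t)%C); [|lra|].
2:{ intros t _; unfold Gam; f_equal; f_equal; ring. }
apply Ceq_minus, Cmod_eq_0, Rle_antisym; [|apply Cmod_ge_0].
apply le_epsilon; intros eps Heps; rewrite Rplus_0_l.
set (K := r / (r - Cmod z)).
assert (HK : 0 < K) by (apply Rdiv_lt_0_compat; lra).
destruct (Cdif_eps f z (eps / (2 * PI * K)) (f_dif z (Rlt_le _ _ hz)))
  as [d [Hd Hf]].
{ apply Rdiv_lt_0_compat; [lra|]; apply Rmult_lt_0_compat; lra. }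
set (e := Rmin 1 (d / (4 * r))).
assert (He : 0 < e <= 1).
{ split; [apply Rmin_glb_lt; [lra|apply Rdiv_lt_0_compat; lra] | apply Rmin_l]. }
assert (Hed : e * (4 * r) <= d).
{ eapply Rle_trans; [apply Rmult_le_compat_r; [lra|apply Rmin_r]|].
  apply Req_le; field; lra. }
rewrite (circle_homotopy e He).
replace eps with ((2 * PI - 0) * (eps / (2 * PI * K) * K)) by (field; lra).
assert (HI : is_CInt (fun t => f (Gam e t) * ker t)%C 0 (2 * PI)
   (CInt (fun t => f (Gam e t) * ker t)%C 0 (2 * PI))).
{ apply CInt_correct; [lra|]; intros t _; apply integrand_cont; lra. }
eapply is_CInt_bound; [lra| |
  exact (is_CInt_minus _ _ _ _ _ _ HI (is_CInt_scal (f z) _ _ _ _ HJ))].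
intros t _; simpl.
replace (f (Gam e t) * ker t - f z * ker t)%C
  with ((f (Gam e t) - f z) * ker t)%C by ring.
rewrite Cmod_mult; apply Rmult_le_compat; try apply Cmod_ge_0; [|apply ker_bound].
apply Rlt_le, Hf.
replace (Gam e t - z)%C with (e * (r * cis t - z))%C by (unfold Gam; ring).
rewrite Cmod_mult, Cmod_R, Rabs_pos_eq by lra.
assert (Cmod (r * cis t - z) <= 2 * r).
{ eapply Rle_trans; [apply Cmod_triangle|]; rewrite Cmod_opp, Cmod_rcis; lra. }
assert (e * Cmod (r * cis t - z) <= e * (2 * r)) by (apply Rmult_le_compat_l; lra).
nra.
Qed.

End Cauchy.

(** At the centre the kernel is 1, so its integral is known. *)
Lemma mean_value_center (f : C -> C) (r : R) : 0 < r ->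
  (forall w, Cmod w <= r -> Cdif f w) ->
  CInt (fun t => f (r * cis t)%C) 0 (2 * PI) = ((2 * PI)%R * f (RtoC 0))%C.
Proof.
intros Hr Hf; assert (HP := PI_RGT_0).
assert (H0 : Cmod (RtoC 0) < r) by (rewrite Cmod_0; exact Hr).
assert (Hk : forall t, (r * cis t / (r * cis t - 0))%C = RtoC 1).
{ intros t; generalize (circle_minus_neq_0 r Hr (RtoC 0) H0 t).
  replace (r * cis t - 0)%C with (r * cis t)%C by ring.
  intros Ht; field; split; intros E; apply Ht; rewrite E; ring. }
generalize (cauchy_ker f r Hr Hf (RtoC 0) H0).
rewrite (CInt_ext _ (fun t => f (r * cis t)%C)); [|lra|].
2:{ intros t _; rewrite Hk; ring. }
rewrite (CInt_ext (fun t => r * cis t / (r * cis t - 0))%C (fun _ => RtoC 1));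
  [|lra|intros t _; apply Hk].
rewrite (is_CInt_unique _ _ _ _ (is_CInt_const (RtoC 1) 0 (2 * PI))).
intros ->; rewrite Rminus_0_r; ring.
Qed.

(** On the circle the conjugate of w is [r^2 / w], so the kernel is the conjugate of
the function [r^2 / (r^2 - conj z * w)]. This is holomorphic on the closed disc with
value 1 at the centre, and the mean value property applies. *)
Lemma cauchy_ker_total (r : R) (z : C) : 0 < r -> Cmod z < r ->
  CInt (fun t => r * cis t / (r * cis t - z))%C 0 (2 * PI) = RtoC (2 * PI).
Proof.
intros Hr Hz; assert (HP := PI_RGT_0).
set (h := fun w : C => (r * r / (r * r - Cconj z * w))%C).
assert (Hden : forall w, Cmod w <= r -> (r * r - Cconj z * w)%C <> RtoC 0).
{ intros w Hw; apply Cmod_neq_0.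
  generalize (Cmod_triangle_minus (r * r) (Cconj z * w)).
  rewrite !Cmod_mult, Cmod_conj, Cmod_R, Rabs_pos_eq by lra.
  assert (Cmod z * Cmod w <= Cmod z * r)
    by (apply Rmult_le_compat_l; [apply Cmod_ge_0 | assumption]).
  nra. }
assert (Hh : forall w, Cmod w <= r -> Cdif h w).
{ intros w Hw; apply Cdif_div; [apply Cdif_const| |apply Hden, Hw].
  apply Cdif_minus; [apply Cdif_const|].
  apply Cdif_mult; [apply Cdif_const|apply Cdif_id]. }
assert (HI : is_CInt (fun t => h (r * cis t)%C) 0 (2 * PI) (RtoC (2 * PI))).
{ replace (RtoC (2 * PI)) with (CInt (fun t => h (r * cis t)%C) 0 (2 * PI)).
  - apply CInt_correct; [lra|]; intros t _.
    apply (cont_comp_Cdif h (fun t => r * cis t)%C).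
    + apply cont_Cmult; [apply continuous_const | apply cont_cis_id].
    + apply Hh; rewrite Cmod_rcis; lra.
  - rewrite (mean_value_center h r Hr Hh); unfold h.
    field; intros E; apply RtoC_inj in E; lra. }
apply is_CInt_conj in HI.
replace (Cconj (RtoC (2 * PI))) with (RtoC (2 * PI)) in HI
  by (apply injective_projections; simpl; ring).
rewrite <- (is_CInt_unique _ _ _ _ HI).
apply CInt_ext; [lra|]; intros t _; unfold h.
assert (Hu : (cis t * Cconj (cis t))%C = RtoC 1).
{ rewrite <- Cmod2_conj, Cmod_cis; f_equal; ring. }
assert (Hc := Hden (r * cis t)%C ltac:(rewrite Cmod_rcis; lra)).
rewrite Cdiv_conj by exact Hc.
rewrite Cminus_conj, !Cmult_conj, Cconj_conj.
replace (Cconj (RtoC r)) with (RtoC r) by (apply injective_projections; simpl; ring).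
assert (Hd := circle_minus_neq_0 r Hr z Hz t).
assert (Hr0 : RtoC r <> RtoC 0) by (intros E; apply RtoC_inj in E; lra).
assert (Hc0 : cis t <> RtoC 0)
  by (apply Cmod_neq_0; rewrite Cmod_cis; lra).
assert (Hcc : Cconj (cis t) = (/ cis t)%C).
{ replace (Cconj (cis t)) with (/ cis t * (cis t * Cconj (cis t)))%C
    by (field; exact Hc0).
  rewrite Hu; ring. }
rewrite Hcc.
field; repeat split; try assumption.
intros E; apply Hd.
replace (r * cis t - z)%C with ((r * cis t * r - z * r) / r)%C by (field; exact Hr0).
replace (r * cis t * r - z * r)%C with (r * r * cis t - z * r)%C by ring.
rewrite E; field; exact Hr0.
Qed.

Theorem cauchy_formula (f : C -> C) (r : R) (z : C) : 0 < r -> Cmod z < r ->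
  (forall w, Cmod w <= r -> Cdif f w) ->
  is_CInt (fun t => f (r * cis t) * (r * cis t / (r * cis t - z)))%C 0 (2 * PI)
    ((2 * PI)%R * f z)%C.
Proof.
intros Hr Hz Hf; assert (HP := PI_RGT_0).
rewrite <- (cauchy_ker_total r z Hr Hz), Cmult_comm.
rewrite <- (cauchy_ker f r Hr Hf z Hz).
apply CInt_correct; [lra|]; intros t _.
apply cont_Cmult; [|apply ker_cont; assumption].
apply (cont_comp_Cdif f (fun t => r * cis t)%C).
- apply cont_Cmult; [apply continuous_const | apply cont_cis_id].
- apply Hf; rewrite Cmod_rcis; lra.
Qed.

(** * Pointwise bounds and limits of holomorphic functions *)

(** The Cauchy kernel is at most [r / (r - |z|)] in modulus. *)
Lemma point_bound (f : C -> C) (r : R) (z : C) (I : R) : 0 < r -> Cmod z < r ->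
  (forall w, Cmod w <= r -> Cdif f w) ->
  is_RInt (fun t => Cmod (f (r * cis t)%C)) 0 (2 * PI) I ->
  2 * PI * Cmod (f z) <= r / (r - Cmod z) * I.
Proof.
intros Hr Hz Hf HI; assert (HP := PI_RGT_0).
replace (2 * PI * Cmod (f z)) with (Cmod ((2 * PI)%R * f z)%C)
  by (rewrite Cmod_mult, Cmod_R, Rabs_pos_eq; lra).
refine (is_CInt_Cmod_le _ _ _ _ _ _ _ _ (cauchy_formula f r z Hr Hz Hf)
  (is_RInt_scal _ _ _ (r / (r - Cmod z)) _ HI)); [lra|].
intros t _; rewrite Cmod_mult, Rmult_comm.
apply Rmult_le_compat_r; [apply Cmod_ge_0 | now apply ker_bound].
Qed.

(** A first-order expansion whose remainder is controlled by a bound on f alone. The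
uniformity over all f with the same bound is what makes the expansion survive a
pointwise limit. *)
Lemma cauchy_second_order (f : C -> C) (M r : R) (z : C) : 0 < r -> Cmod z < r -> 0 <= M ->
  (forall w, Cmod w <= r -> Cdif f w) ->
  (forall w, Cmod w <= r -> Cmod (f w) <= M) ->
  exists D, forall w, Cmod (w - z) <= (r - Cmod z) / 2 ->
    Cmod (f w - f z - D * (w - z)) <=
      M * r / ((r - Cmod z) / 2) ^ 3 * Cmod (w - z) ^ 2.
Proof.
intros Hr Hz HM Hf Hb; assert (HP := PI_RGT_0).
set (rho := (r - Cmod z) / 2).
assert (Hrho : 0 < rho) by (unfold rho; lra).
set (g := fun t : R => (r * cis t)%C).
assert (Hg : forall t, Ccont g t).
{ intros t; apply cont_Cmult; [apply continuous_const | apply cont_cis_id]. }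
assert (Hgr : forall t, Cmod (g t) = r) by (intros t; apply Cmod_rcis; lra).
assert (Hgz := circle_minus_neq_0 r Hr z Hz : forall t, (g t - z)%C <> RtoC 0).
set (J := CInt (fun t => f (g t) * (g t / ((g t - z) * (g t - z))))%C 0 (2 * PI)).
assert (HJ : is_CInt (fun t => f (g t) * (g t / ((g t - z) * (g t - z))))%C
   0 (2 * PI) J).
{ apply CInt_correct; [lra|]; intros t _.
  assert (Ccont (fun t => g t - z)%C t)
    by (apply cont_Cminus; [apply Hg | apply continuous_const]).
  apply cont_Cmult.
  - apply cont_comp_Cdif; [apply Hg|]; apply Hf; rewrite Hgr; lra.
  - apply cont_Cdiv; [apply Hg | apply cont_Cmult; assumption |].
    apply Cmult_neq_0; apply Hgz. }
exists (J / (2 * PI)%R)%C; intros w Hw.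
assert (Hwr : Cmod w < r).
{ generalize (Cmod_triangle (w - z) z).
  replace (w - z + z)%C with w by ring; unfold rho in Hw; lra. }
assert (Hgw := circle_minus_neq_0 r Hr w Hwr : forall t, (g t - w)%C <> RtoC 0).
assert (H := is_CInt_minus _ _ _ _ _ _
  (is_CInt_minus _ _ _ _ _ _ (cauchy_formula f r w Hr Hwr Hf)
    (cauchy_formula f r z Hr Hz Hf))
  (is_CInt_scal (w - z)%C _ _ _ _ HJ)).
assert (HB : Cmod ((2 * PI)%R * f w - (2 * PI)%R * f z - (w - z) * J) <=
   (2 * PI - 0) * (M * r / rho ^ 3 * Cmod (w - z) ^ 2)).
{ eapply is_CInt_bound; [lra| |exact H].
  intros t _; cbv beta; fold (g t).
  replace (f (g t) * (g t / (g t - w)) - f (g t) * (g t / (g t - z)) -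
    (w - z) * (f (g t) * (g t / ((g t - z) * (g t - z)))))%C with
    (f (g t) * g t * (/ ((g t - z) * (g t - z) * (g t - w))) *
      ((w - z) * (w - z)))%C by (field; split; [apply Hgz|apply Hgw]).
  rewrite !Cmod_mult, Hgr, Cmod_inv.
  2:{ repeat apply Cmult_neq_0; try apply Hgz; apply Hgw. }
  rewrite !Cmod_mult.
  assert (B1 : rho <= Cmod (g t - z)).
  { generalize (Cmod_triangle_minus (g t) z); rewrite Hgr; unfold rho in *; lra. }
  assert (B2 : rho <= Cmod (g t - w)).
  { generalize (Cmod_triangle_minus (g t - z) (w - z)).
    replace (g t - z - (w - z))%C with (g t - w)%C by ring.
    generalize (Cmod_triangle_minus (g t) z); rewrite Hgr; unfold rho in *; lra. }
  assert (B3 : rho ^ 3 <= Cmod (g t - z) * Cmod (g t - z) * Cmod (g t - w)).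
  { replace (rho ^ 3) with (rho * rho * rho) by ring.
    repeat apply Rmult_le_compat; nra. }
  unfold Rdiv; replace (Cmod (w - z) ^ 2) with (Cmod (w - z) * Cmod (w - z)) by ring.
  apply Rmult_le_compat_r; [apply Rmult_le_pos; apply Cmod_ge_0|].
  apply Rmult_le_compat.
  - apply Rmult_le_pos; [apply Cmod_ge_0 | lra].
  - apply Rlt_le, Rinv_0_lt_compat; eapply Rlt_le_trans; [|exact B3].
    apply pow_lt; assumption.
  - apply Rmult_le_compat_r; [lra|]; apply Hb; rewrite Hgr; lra.
  - apply Rinv_le_contravar; [apply pow_lt; assumption | exact B3]. }
assert (H2 : RtoC (2 * PI) <> RtoC 0) by (intros E; apply RtoC_inj in E; lra).
replace (f w - f z - J / (2 * PI)%R * (w - z))%C with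
  (((2 * PI)%R * f w - (2 * PI)%R * f z - (w - z) * J) / (2 * PI)%R)%C
  by (field; exact H2).
rewrite Cmod_div, Cmod_R, Rabs_pos_eq by (assumption || lra).
apply Rle_div_l; lra.
Qed.

Definition Cseq_lim (u : nat -> C) (l : C) : Prop :=
  forall eps, 0 < eps -> exists N, forall n, (N <= n)%nat -> Cmod (u n - l) <= eps.

Lemma Cseq_cauchy (u : nat -> C) :
  (forall eps, 0 < eps -> exists N, forall n m, (N <= n)%nat -> (N <= m)%nat ->
     Cmod (u n - u m) <= eps) ->
  exists l, Cseq_lim u l.
Proof.
intros H.
assert (H1 : ex_finite_lim_seq (fun n => fst (u n))).
{ apply ex_lim_seq_cauchy_corr; intros eps.
  destruct (H (eps / 2)) as [N HN]; [destruct eps; simpl; lra|].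
  exists N; intros n m Hn Hm; specialize (HN n m Hn Hm).
  eapply Rle_lt_trans; [exact (Rle_trans _ _ _ (Rmax_l _ _) (Rmax_Cmod (u n - u m)%C))|].
  destruct eps; simpl in *; lra. }
assert (H2 : ex_finite_lim_seq (fun n => snd (u n))).
{ apply ex_lim_seq_cauchy_corr; intros eps.
  destruct (H (eps / 2)) as [N HN]; [destruct eps; simpl; lra|].
  exists N; intros n m Hn Hm; specialize (HN n m Hn Hm).
  eapply Rle_lt_trans; [exact (Rle_trans _ _ _ (Rmax_r _ _) (Rmax_Cmod (u n - u m)%C))|].
  destruct eps; simpl in *; lra. }
destruct H1 as [x Hx]; destruct H2 as [y Hy]; exists (x, y); intros eps Heps.
apply is_lim_seq_spec in Hx; apply is_lim_seq_spec in Hy.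
assert (He : 0 < eps / 2) by lra.
destruct (Hx (mkposreal _ He)) as [N1 HN1]; destruct (Hy (mkposreal _ He)) as [N2 HN2].
exists (N1 + N2)%nat; intros n Hn.
specialize (HN1 n ltac:(lia)); specialize (HN2 n ltac:(lia)); simpl in HN1, HN2.
replace (u n - (x, y))%C with
  (RtoC (fst (u n) - x) + Ci * RtoC (snd (u n) - y))%C
  by (apply injective_projections; simpl; ring).
eapply Rle_trans; [apply Cmod_triangle|].
rewrite Cmod_mult, Cmod_Ci, !Cmod_R; lra.
Qed.

(** By [cauchy_second_order] the functions have first-order expansions at z with a
common quadratic remainder. Comparing these expansions at a point close to z shows
that the derivatives at z form a Cauchy sequence, and the expansion then passes to
the limit. *)
Theorem bounded_limit_dif (fn : nat -> C -> C) (f : C -> C) (M : R) : 0 <= M ->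
  (forall n z, disc z -> Cdif (fn n) z) ->
  (forall n z, disc z -> Cmod (fn n z) <= M) ->
  (forall z, disc z -> Cseq_lim (fun n => fn n z) (f z)) ->
  forall z, disc z -> Cdif f z.
Proof.
unfold disc; intros HM Hd Hb Hl z Hz.
set (r := (1 + Cmod z) / 2); assert (Az := Cmod_ge_0 z).
assert (Hr : 0 < r) by (unfold r; lra).
assert (Hzr : Cmod z < r) by (unfold r; lra).
assert (Hin : forall w, Cmod w <= r -> Cmod w < 1) by (unfold r; intros; lra).
set (rho := (r - Cmod z) / 2).
assert (Hrho : 0 < rho) by (unfold rho; lra).
set (K := M * r / rho ^ 3).
assert (HK : 0 <= K).
{ apply Rmult_le_pos; [nra|]; apply Rlt_le, Rinv_0_lt_compat, pow_lt; assumption. }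
assert (HD : forall n, exists D, forall w, Cmod (w - z) <= rho ->
  Cmod (fn n w - fn n z - D * (w - z)) <= K * Cmod (w - z) ^ 2).
{ intros n; apply cauchy_second_order; auto. }
destruct (choice _ HD) as [D HDn]; clear HD.
assert (Hwin : forall w, Cmod (w - z) <= rho -> Cmod w < 1).
{ intros w Hw; generalize (Cmod_triangle (w - z) z).
  replace (w - z + z)%C with w by ring; unfold rho, r in *; lra. }
destruct (Cseq_cauchy D) as [D0 HD0].
{ intros eps Heps.
  (* The expansions are compared at z + h: this h makes their remainders small,
     and n, m are then taken large enough for this h. *)
  set (h := Rmin rho (eps / (4 * (K + 1)))).
  assert (Hh : 0 < h).
  { apply Rmin_glb_lt; [assumption|apply Rdiv_lt_0_compat; lra]. }
  assert (HhK : 4 * (K + 1) * h <= eps).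
  { apply Rle_trans with (4 * (K + 1) * (eps / (4 * (K + 1)))).
    - apply Rmult_le_compat_l; [lra | apply Rmin_r].
    - apply Req_le; field; lra. }
  set (w := (z + h)%C).
  assert (Ew : (w - z)%C = RtoC h) by (unfold w; ring).
  assert (Hwz : Cmod (w - z) = h) by (rewrite Ew, Cmod_R, Rabs_pos_eq; lra).
  assert (Hwr : Cmod (w - z) <= rho) by (rewrite Hwz; apply Rmin_l).
  destruct (Hl z Hz (eps * h / 8)) as [N1 HN1]; [nra|].
  destruct (Hl w (Hwin w Hwr) (eps * h / 8)) as [N2 HN2]; [nra|].
  exists (N1 + N2)%nat; intros n m Hn Hm.
  assert (B1 := HDn n w Hwr); assert (B2 := HDn m w Hwr); rewrite Hwz in B1, B2.
  assert (C1 := HN1 n ltac:(lia)); assert (C2 := HN1 m ltac:(lia)).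
  assert (C3 := HN2 n ltac:(lia)); assert (C4 := HN2 m ltac:(lia)).
  apply Rmult_le_reg_r with h; [assumption|].
  replace (Cmod (D n - D m) * h) with (Cmod ((D n - D m) * (w - z)))
    by (rewrite Cmod_mult, Hwz; reflexivity).
  set (e1 := (fn n w - fn n z - D n * (w - z))%C) in *.
  set (e2 := (fn m w - fn m z - D m * (w - z))%C) in *.
  replace ((D n - D m) * (w - z))%C with
    ((fn n w - f w) + - (fn m w - f w) + - (fn n z - f z) + (fn m z - f z)
      + - e1 + e2)%C by (unfold e1, e2; ring).
  repeat (eapply Rle_trans; [apply Cmod_triangle|]).
  apply Rle_trans with (eps * h / 8 + eps * h / 8 + eps * h / 8 + eps * h / 8 +
    K * h ^ 2 + K * h ^ 2); [|nra].
  apply Rplus_le_compat; [|exact B2].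
  eapply Rle_trans; [apply Cmod_triangle|].
  rewrite Cmod_opp; apply Rplus_le_compat; [|exact B1].
  eapply Rle_trans; [apply Cmod_triangle|].
  apply Rplus_le_compat; [|exact C2].
  eapply Rle_trans; [apply Cmod_triangle|].
  rewrite Cmod_opp; apply Rplus_le_compat; [|exact C1].
  eapply Rle_trans; [apply Cmod_triangle|].
  rewrite Cmod_opp; apply Rplus_le_compat; [exact C3 | exact C4]. }
exists D0; intros eps Heps.
exists (Rmin rho (eps / (K + 1))); split.
{ apply Rmin_glb_lt; [assumption|apply Rdiv_lt_0_compat; lra]. }
intros w Hw.
assert (W1 := Rlt_le_trans _ _ _ Hw (Rmin_l _ _)).
assert (W2 := Rlt_le_trans _ _ _ Hw (Rmin_r _ _)).
apply Rlt_div_r in W2; [|lra].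
assert (Aw := Cmod_ge_0 (w - z)).
apply Rle_trans with (K * Cmod (w - z) ^ 2); [|nra].
apply le_epsilon; intros e He.
destruct (Hl z Hz (e / 3)) as [N1 HN1]; [lra|].
destruct (Hl w (Hwin w (Rlt_le _ _ W1)) (e / 3)) as [N2 HN2]; [lra|].
destruct (HD0 (e / 3 / (1 + rho))) as [N3 HN3].
{ apply Rdiv_lt_0_compat; lra. }
set (n := (N1 + N2 + N3)%nat).
assert (B := HDn n w (Rlt_le _ _ W1)).
assert (C1 := HN1 n ltac:(unfold n; lia)); assert (C2 := HN2 n ltac:(unfold n; lia)).
assert (C3 := HN3 n ltac:(unfold n; lia)).
replace (f w - f z - D0 * (w - z))%C with
  ((fn n w - fn n z - D n * (w - z)) + - (fn n w - f w) + (fn n z - f z)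
    + (D n - D0) * (w - z))%C by ring.
eapply Rle_trans; [apply Cmod_triangle|].
assert (Cmod ((D n - D0) * (w - z)) <= e / 3).
{ rewrite Cmod_mult.
  apply Rle_trans with (e / 3 / (1 + rho) * (1 + rho)).
  - apply Rmult_le_compat; try apply Cmod_ge_0; [exact C3|lra].
  - apply Req_le; field; lra. }
apply Rle_trans with ((K * Cmod (w - z) ^ 2 + e / 3 + e / 3) + e / 3); [|lra].
apply Rplus_le_compat; [|assumption].
eapply Rle_trans; [apply Cmod_triangle|]; apply Rplus_le_compat; [|exact C1].
eapply Rle_trans; [apply Cmod_triangle|]; rewrite Cmod_opp.
apply Rplus_le_compat; [exact B | exact C2].
Qed.

(** * Hardy spaces *)

Lemma rpow_pos (x p : R) : 0 < x -> rpow x p = Rpower x p.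
Proof. intros Hx; unfold rpow; destruct (Rlt_dec 0 x); [reflexivity|lra]. Qed.

Lemma rpow_ge_0 (x p : R) : 0 <= rpow x p.
Proof.
unfold rpow; destruct (Rlt_dec 0 x); [apply Rlt_le, exp_pos|lra].
Qed.

Lemma rpow_le (x y p : R) : 0 < p -> x <= y -> rpow x p <= rpow y p.
Proof.
intros Hp Hxy; destruct (Rlt_dec 0 x) as [Hx|Hx].
- rewrite !rpow_pos by lra; apply Rle_Rpower_l; lra.
- unfold rpow at 1; destruct (Rlt_dec 0 x); [lra|apply rpow_ge_0].
Qed.

Lemma rpow_rpow_inv (x p : R) : 0 < p -> 0 <= x -> rpow (rpow x (1 / p)) p = x.
Proof.
intros Hp Hx; destruct (Rlt_dec 0 x) as [H0|H0].
- rewrite (rpow_pos x), rpow_pos by (assumption || apply exp_pos).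
  rewrite Rpower_mult; replace (1 / p * p) with 1 by (field; lra).
  now apply Rpower_1.
- unfold rpow at 2; destruct (Rlt_dec 0 x); [lra|].
  unfold rpow; destruct (Rlt_dec 0 0); lra.
Qed.

(** For [p >= 1] this replaces the Hoelder inequality: only a bound on the mean of
[|f|] that is uniform for a given norm is needed, not the sharp one. *)
Lemma le_1_rpow (x p : R) : 1 <= p -> x <= 1 + rpow x p.
Proof.
intros Hp; assert (H := rpow_ge_0 x p).
destruct (Rle_or_lt x 1) as [Hx|Hx]; [lra|].
rewrite rpow_pos by lra.
rewrite <- (Rpower_1 x) at 1 by lra.
apply Rle_trans with (Rpower x p); [apply Rle_Rpower; lra | lra].
Qed.

Lemma rpow_continuous (p x : R) : 0 < p -> continuous (fun y => rpow y p) x.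
Proof.
intros Hp; destruct (total_order_T 0 x) as [[Hx|Hx]|Hx].
- apply (continuous_ext_loc (fun y => rpow y p) (fun y => Rpower y p) x).
  + exists (mkposreal x Hx); intros y Hy.
    assert (H : Rabs (y - x) < x) by exact Hy.
    apply Rabs_lt_between in H; rewrite rpow_pos; lra.
  + apply (@ex_derive_continuous R_AbsRing R_NormedModule).
    exists (p * Rpower x (p - 1)).
    apply is_derive_Reals, derivable_pt_lim_power; exact Hx.
- subst x; intros P [e He].
  assert (Hd : 0 < Rpower e (1 / p)) by apply exp_pos.
  exists (mkposreal _ Hd); intros y Hy; apply He.
  assert (H : Rabs (y - 0) < Rpower e (1 / p)) by exact Hy.
  change (Rabs (rpow y p - rpow 0 p) < e).
  unfold rpow; destruct (Rlt_dec 0 0) as [?|_]; [lra|].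
  rewrite Rminus_0_r in H |- *.
  destruct (Rlt_dec 0 y) as [H0|H0].
  + rewrite Rabs_pos_eq in H by lra.
    rewrite Rabs_pos_eq by (apply Rlt_le, exp_pos).
    rewrite <- (rpow_rpow_inv e p Hp) by (apply Rlt_le, cond_pos).
    rewrite (rpow_pos e), rpow_pos by (apply exp_pos || apply cond_pos).
    unfold Rpower at 1 2; apply exp_increasing, Rmult_lt_compat_l; [exact Hp|].
    apply ln_increasing; assumption.
  + rewrite Rabs_R0; apply cond_pos.
- apply (continuous_ext_loc (fun y => rpow y p) (fun _ => 0) x); [|apply continuous_const].
  assert (Hx' : 0 < - x) by lra.
  exists (mkposreal _ Hx'); intros y Hy.
  assert (H : Rabs (y - x) < - x) by exact Hy.
  apply Rabs_lt_between in H; unfold rpow; destruct (Rlt_dec 0 y); [lra|reflexivity].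
Qed.

Lemma holomorphic_Cdif (f : C -> C) :
  holomorphic f <-> forall z, disc z -> Cdif f z.
Proof.
split; intros H z Hz; apply ex_derive_Cder; apply H; exact Hz.
Qed.

Lemma eqD_sym (f g : C -> C) : eqD f g -> eqD g f.
Proof. intros H z Hz; symmetry; apply H, Hz. Qed.

Lemma eqD_trans (f g h : C -> C) : eqD f g -> eqD g h -> eqD f h.
Proof. intros H1 H2 z Hz; rewrite H1 by exact Hz; apply H2, Hz. Qed.

Lemma disc_rcis (r t : R) : 0 <= r < 1 -> disc (r * cis t).
Proof. intros Hr; unfold disc; rewrite Cmod_rcis; lra. Qed.

Lemma Hp_norm_eqD (p : R) (f g : C -> C) : eqD f g -> Hp_norm p f = Hp_norm p g.
Proof.
intros H; apply Lub_Rbar_eqset; intros m.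
assert (HE : forall r, 0 <= r < 1 -> Hp_mean p f r = Hp_mean p g r).
{ intros r Hr; unfold Hp_mean; do 2 f_equal; apply RInt_ext; intros t _.
  rewrite H by (apply disc_rcis; lra); reflexivity. }
split; intros [r [Hr ->]]; exists r; (split; [exact Hr|]); rewrite HE; auto.
Qed.

Lemma circle_Cmod_cont (f : C -> C) (r t : R) : holomorphic f -> 0 <= r < 1 ->
  continuous (fun t => Cmod (f (r * cis t)%C)) t.
Proof.
intros Hf Hr; apply cont_Cmod, (cont_comp_Cdif f (fun t => r * cis t)%C).
- apply cont_Cmult; [apply continuous_const | apply cont_cis_id].
- apply holomorphic_Cdif; [exact Hf | apply disc_rcis, Hr].
Qed.

Lemma circle_mean_ex (p : R) (f : C -> C) (r : R) : 0 < p -> holomorphic f ->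
  0 <= r < 1 -> ex_RInt (fun t => rpow (Cmod (f (r * cis t)%C)) p) 0 (2 * PI).
Proof.
intros Hp Hf Hr; apply (@ex_RInt_continuous R_CompleteNormedModule); intros t _.
apply (continuous_comp (fun t => Cmod (f (r * cis t)%C)) (fun y => rpow y p)).
- apply circle_Cmod_cont; assumption.
- apply rpow_continuous, Hp.
Qed.

Definition Hinf (f : C -> C) : Prop :=
  (forall z, disc z -> Cdif f z) /\
  exists M, forall z, disc z -> Cmod (f z) <= M.

Lemma Hinf_Hp (p : R) (f : C -> C) : 0 < p -> Hinf f -> Hp p f.
Proof.
intros Hp [Hf [M HM]]; assert (HP := PI_RGT_0).
apply holomorphic_Cdif in Hf; split; [exact Hf|].
set (B := rpow (rpow M p) (1 / p)).
assert (Hp1 : 0 < 1 / p) by (apply Rdiv_lt_0_compat; lra).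
assert (Hub : Rbar_le (Hp_norm p f) B).
{ apply Lub_Rbar_correct; intros m [r [Hr ->]]; simpl; apply rpow_le; [exact Hp1|].
  apply Rle_div_l; [lra|].
  eapply Rle_trans; [apply Rle_abs|].
  replace (rpow M p * (2 * PI)) with ((2 * PI - 0) * rpow M p) by ring.
  apply abs_RInt_le_const; [lra|apply circle_mean_ex; assumption|].
  intros t _; rewrite Rabs_pos_eq by apply rpow_ge_0.
  apply rpow_le; [exact Hp|]; apply HM, disc_rcis, Hr. }
assert (Hlb : Rbar_le (Hp_mean p f 0) (Hp_norm p f)).
{ apply (Lub_Rbar_correct (fun m => exists r, 0 <= r < 1 /\ m = Hp_mean p f r)).
  exists 0; split; [lra|reflexivity]. }
destruct (Hp_norm p f); simpl in *; try contradiction; reflexivity.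
Qed.

(** The constant depends on the norm and on rho but not on the function. *)
Lemma Hp_point_bound (p N rho : R) : 1 <= p -> 0 <= rho < 1 ->
  exists K, forall f, Hp p f -> Hp_norm p f = Finite N ->
    forall z, Cmod z <= rho -> Cmod (f z) <= K.
Proof.
intros Hp Hrho; assert (HP := PI_RGT_0).
(* Any radius strictly between rho and 1 would do. *)
set (r := (1 + rho) / 2).
exists (r / (r - rho) * (1 + rpow N p)).
intros f [Hf _] HN z Hz.
assert (Hr : 0 <= r < 1) by (unfold r; lra).
assert (Hmean : Hp_mean p f r <= N).
{ assert (H : Rbar_le (Hp_mean p f r) (Hp_norm p f)).
  { apply (Lub_Rbar_correct (fun m => exists r, 0 <= r < 1 /\ m = Hp_mean p f r)).
    exists r; split; [exact Hr|reflexivity]. }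
  rewrite HN in H; exact H. }
assert (Hex := circle_mean_ex p f r ltac:(lra) Hf Hr).
set (A := RInt (fun t => rpow (Cmod (f (r * cis t)%C)) p) 0 (2 * PI)).
assert (HA0 : 0 <= A).
{ apply RInt_ge_0; [lra|exact Hex|]; intros; apply rpow_ge_0. }
assert (HA : A <= 2 * PI * rpow N p).
{ apply (rpow_le _ _ p) in Hmean; [|lra].
  unfold Hp_mean in Hmean; fold A in Hmean.
  rewrite rpow_rpow_inv in Hmean; [|lra|].
  - apply Rle_div_l in Hmean; lra.
  - apply Rdiv_le_0_compat; lra. }
assert (Hex1 : ex_RInt (fun t => Cmod (f (r * cis t)%C)) 0 (2 * PI)).
{ apply (@ex_RInt_continuous R_CompleteNormedModule); intros t _.
  apply circle_Cmod_cont; assumption. }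
assert (Hex2 : ex_RInt (fun t => plus 1 (rpow (Cmod (f (r * cis t)%C)) p)) 0 (2 * PI)).
{ apply (@ex_RInt_plus R_NormedModule); [apply ex_RInt_const|exact Hex]. }
assert (HI : RInt (fun t => Cmod (f (r * cis t)%C)) 0 (2 * PI) <= 2 * PI + A).
{ replace (2 * PI + A) with
    (RInt (fun t => plus 1 (rpow (Cmod (f (r * cis t)%C)) p)) 0 (2 * PI)).
  - apply RInt_le; [lra|exact Hex1|exact Hex2|].
    intros t _; apply le_1_rpow, Hp.
  - transitivity (plus (scal (2 * PI - 0) 1) A).
    + apply is_RInt_unique, (@is_RInt_plus R_NormedModule).
      * apply (@is_RInt_const R_NormedModule).
      * apply (@RInt_correct R_CompleteNormedModule), Hex.
    + unfold plus, scal; simpl; unfold mult; simpl; ring. }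
assert (HPB := point_bound f r z _ ltac:(unfold r; lra) ltac:(unfold r; lra)
  (fun w Hw => proj1 (holomorphic_Cdif f) Hf w (Rle_lt_trans _ _ _ Hw (proj2 Hr)))
  (RInt_correct _ _ _ Hex1)).
apply Rmult_le_reg_l with (2 * PI); [lra|].
eapply Rle_trans; [exact HPB|].
replace (2 * PI * (r / (r - rho) * (1 + rpow N p))) with
  (r / (r - rho) * (2 * PI + 2 * PI * rpow N p)) by ring.
apply Rmult_le_compat.
- apply Rdiv_le_0_compat; unfold r; lra.
- apply RInt_ge_0; [lra|exact Hex1|]; intros; apply Cmod_ge_0.
- apply Rmult_le_compat_l; [lra|]; apply Rinv_le_contravar; unfold r; lra.
- lra.
Qed.

(** * Automorphisms of the disc *)

(** The reciprocal of the Szego kernel of the disc. *)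
Definition szego_den (w z : C) : C := (1 - Cconj w * z)%C.

Lemma szego_den_diag (a : C) : szego_den a a = RtoC (1 - Cmod a ^ 2).
Proof. unfold szego_den; rewrite RtoC_minus, Cmod2_conj; ring. Qed.

Lemma szego_den_conj (w z : C) : Cconj (szego_den w z) = szego_den z w.
Proof. apply injective_projections; simpl; ring. Qed.

Lemma szego_den_le_2 (w z : C) : disc w -> disc z -> Cmod (szego_den w z) <= 2.
Proof.
unfold disc, szego_den; intros Hw Hz; eapply Rle_trans; [apply Cmod_triangle|].
rewrite Cmod_opp, Cmod_1, Cmod_mult, Cmod_conj.
assert (H1 := Cmod_ge_0 w); assert (H2 := Cmod_ge_0 z); nra.
Qed.

Lemma szego_den_ge (w z : C) : disc z -> 1 - Cmod w <= Cmod (szego_den w z).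
Proof.
unfold disc, szego_den; intros Hz; generalize (Cmod_triangle_minus 1 (Cconj w * z)).
rewrite Cmod_1, Cmod_mult, Cmod_conj.
assert (H1 := Cmod_ge_0 w); nra.
Qed.

Lemma szego_den_pos (w z : C) : disc w -> disc z -> 0 < Cmod (szego_den w z).
Proof. intros Hw Hz; generalize (szego_den_ge w z Hz); unfold disc in Hw; lra. Qed.

Lemma szego_den_neq_0 (w z : C) : disc w -> disc z -> szego_den w z <> RtoC 0.
Proof. intros Hw Hz; apply Cmod_neq_0, szego_den_pos; assumption. Qed.

Lemma disc_sq (z : C) : disc z <-> 0 < 1 - Cmod z ^ 2.
Proof. unfold disc; generalize (Cmod_ge_0 z); split; nra. Qed.

(** The transformation law of the Szego kernel under an automorphism; its diagonal
case is the equality in the Schwarz-Pick lemma. *)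
Lemma aut_pick (phi : Aut) (w z : C) : disc w -> disc z ->
  (szego_den (phi w) (phi z) * szego_den w (aut_a phi) * szego_den (aut_a phi) z)%C =
  (szego_den (aut_a phi) (aut_a phi) * szego_den w z)%C.
Proof.
destruct phi as [lam a Hlam Ha]; unfold aut_map; simpl; intros Hw Hz.
assert (H1 := szego_den_neq_0 a z Ha Hz); assert (H2 := szego_den_neq_0 w a Hw Ha).
assert (H3 : (lam * Cconj lam)%C = RtoC 1)
  by (rewrite <- Cmod2_conj, Hlam; f_equal; ring).
fold (szego_den a z); fold (szego_den a w).
unfold szego_den at 1; rewrite Cdiv_conj by (apply szego_den_neq_0; assumption).
rewrite szego_den_conj, Cmult_conj, Cminus_conj.
transitivity (szego_den w a * szego_den a z -
  (lam * Cconj lam) * ((Cconj w - Cconj a) * (z - a)))%C.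
- field; split; assumption.
- rewrite H3; unfold szego_den; ring.
Qed.

Lemma aut_pick_diag (phi : Aut) (z : C) : disc z ->
  (1 - Cmod (phi z) ^ 2) * Cmod (szego_den (aut_a phi) z) ^ 2 =
  (1 - Cmod (aut_a phi) ^ 2) * (1 - Cmod z ^ 2).
Proof.
intros Hz; apply RtoC_inj; rewrite !RtoC_mult, Cmod2_conj, szego_den_conj, <- !szego_den_diag.
rewrite <- (aut_pick phi z z Hz Hz); ring.
Qed.

Lemma aut_disc (phi : Aut) (z : C) : disc z -> disc (phi z).
Proof.
intros Hz; apply disc_sq.
assert (H := aut_pick_diag phi z Hz).
assert (H1 := szego_den_pos _ _ (aut_a_disc phi) Hz).
assert (H2 := proj1 (disc_sq _) (aut_a_disc phi)).
assert (H3 := proj1 (disc_sq _) Hz).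
assert (0 < (1 - Cmod (aut_a phi) ^ 2) * (1 - Cmod z ^ 2))
  by (apply Rmult_lt_0_compat; assumption).
assert (0 < Cmod (szego_den (aut_a phi) z) ^ 2) by (apply pow_lt; assumption).
nra.
Qed.

Lemma iter_disc (phi : Aut) (n : nat) (z : C) : disc z -> disc (Nat.iter n phi z).
Proof. intros Hz; induction n; simpl; [exact Hz | now apply aut_disc]. Qed.

(** Automorphisms preserve the pseudohyperbolic distance: one minus its square is
[(1 - |z|^2) (1 - |z0|^2) / |1 - conj z0 * z|^2]. *)
Lemma fixed_invariant (phi : Aut) (z0 z : C) : disc z0 -> phi z0 = z0 -> disc z ->
  (1 - Cmod (phi z) ^ 2) * Cmod (szego_den z0 z) ^ 2 =
  (1 - Cmod z ^ 2) * Cmod (szego_den z0 (phi z)) ^ 2.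
Proof.
intros H0 Hfix Hz.
set (a := aut_a phi).
assert (Ha : disc a) by apply aut_a_disc.
assert (P1 := aut_pick phi z0 z H0 Hz); rewrite Hfix in P1; fold a in P1.
apply (f_equal Cmod) in P1; rewrite szego_den_diag, !Cmod_mult, Cmod_R in P1.
rewrite Rabs_pos_eq in P1 by (apply Rlt_le, disc_sq, Ha).
assert (P2 := aut_pick_diag phi z0 H0); rewrite Hfix in P2; fold a in P2.
assert (P3 := aut_pick_diag phi z Hz); fold a in P3.
assert (E : Cmod (szego_den z0 a) = Cmod (szego_den a z0)) by (rewrite <- szego_den_conj;
  apply Cmod_conj).
rewrite E in P1.
assert (Hq := szego_den_pos a z Ha Hz).
assert (A0 := proj1 (disc_sq a) Ha); assert (A1 := proj1 (disc_sq z0) H0).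
set (A := 1 - Cmod a ^ 2) in *.
(* At the fixed point the transformation law determines |1 - conj a * z0|. *)
assert (P2' : Cmod (szego_den a z0) ^ 2 = A).
{ apply Rmult_eq_reg_l with (1 - Cmod z0 ^ 2); lra. }
apply Rmult_eq_reg_r with (A * Cmod (szego_den a z) ^ 2).
2:{ apply Rgt_not_eq, Rmult_gt_0_compat; [assumption|]; apply pow_lt, Hq. }
transitivity (A * (1 - Cmod z ^ 2) * (A * Cmod (szego_den z0 z) ^ 2)).
{ rewrite <- P3; ring. }
rewrite <- P2' at 2.
transitivity ((1 - Cmod z ^ 2) *
  (A * Cmod (szego_den z0 z)) ^ 2).
{ rewrite P2'; ring. }
rewrite <- P1, <- P2'; ring.
Qed.

(** Orbits lie on pseudohyperbolic circles around the fixed point, which are compact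
in the disc. *)
Lemma fixed_orbit_bounded (phi : Aut) (z0 z : C) :
  disc z0 -> phi z0 = z0 -> disc z ->
  exists rho, 0 <= rho < 1 /\ forall k, Cmod (Nat.iter k phi z) <= rho.
Proof.
intros H0 Hfix Hz.
assert (Hq := szego_den_pos z0 z H0 Hz).
assert (Hz2 := proj1 (disc_sq z) Hz).
set (E := (1 - Cmod z ^ 2) / Cmod (szego_den z0 z) ^ 2).
assert (Hq2 : 0 < Cmod (szego_den z0 z) ^ 2) by (apply pow_lt, Hq).
assert (HE : 0 < E) by (apply Rdiv_lt_0_compat; assumption).
assert (Hk : forall k, 1 - Cmod (Nat.iter k phi z) ^ 2 =
   E * Cmod (szego_den z0 (Nat.iter k phi z)) ^ 2).
{ induction k as [|k IH].
  - simpl Nat.iter; unfold E; field; apply Rgt_not_eq, Hq.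
  - assert (Hd := iter_disc phi k z Hz).
    assert (H := fixed_invariant phi z0 _ H0 Hfix Hd).
    simpl Nat.iter; set (w := Nat.iter k phi z) in *.
    rewrite IH in H.
    apply Rmult_eq_reg_r with (Cmod (szego_den z0 w) ^ 2).
    + rewrite H; ring.
    + apply Rgt_not_eq, pow_lt, szego_den_pos; assumption. }
(* Since |1 - conj z0 * w| >= 1 - |z0| on the disc, the invariant E bounds
   1 - |w|^2 from below along the orbit. *)
set (m := E * (1 - Cmod z0) ^ 2).
assert (Hd0 : Cmod z0 < 1) by exact H0.
assert (Hm : 0 < m) by (apply Rmult_lt_0_compat; [assumption|apply pow_lt; lra]).
assert (Hkm : forall k, Cmod (Nat.iter k phi z) ^ 2 <= 1 - m).
{ intros k; specialize (Hk k).
  assert (Hd := iter_disc phi k z Hz).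
  assert (H := szego_den_ge z0 _ Hd).
  assert ((1 - Cmod z0) ^ 2 <= Cmod (szego_den z0 (Nat.iter k phi z)) ^ 2)
    by (apply pow_incr; lra).
  assert (m <= E * Cmod (szego_den z0 (Nat.iter k phi z)) ^ 2)
    by (apply Rmult_le_compat_l; lra).
  lra. }
assert (Hm1 : 0 <= 1 - m).
{ eapply Rle_trans; [|apply (Hkm 0%nat)]; apply pow2_ge_0. }
exists (sqrt (1 - m)); split.
- split; [apply sqrt_pos|]; rewrite <- sqrt_1 at 2; apply sqrt_lt_1; lra.
- intros k; rewrite <- (sqrt_pow2 (Cmod _)) by apply Cmod_ge_0.
  apply sqrt_le_1; [apply pow2_ge_0 | exact Hm1 | apply Hkm].
Qed.

(** The product in the definition of a Blaschke product, named to allow induction on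
the list of factors. *)
Definition bprod (l : list Aut) (z : C) : C :=
  fold_right (fun (phi : Aut) w => (phi z * w)%C) (RtoC 1) l.

Lemma bprod_le_1 (l : list Aut) (z : C) : disc z -> Cmod (bprod l z) <= 1.
Proof.
intros Hz; induction l as [|psi l IH]; simpl.
- rewrite Cmod_1; lra.
- rewrite Cmod_mult; assert (H := aut_disc psi z Hz); unfold disc in H.
  assert (H1 := Cmod_ge_0 (psi z)); assert (H2 := Cmod_ge_0 (bprod l z)); nra.
Qed.

(** One factor is bounded away from 1 on the smaller disc and the others are at most
1 in modulus. At least one factor is needed: the empty product is 1. *)
Lemma blaschke_bound (d : nat) (Psi : C -> C) (rho : R) : (1 <= d)%nat ->
  blaschke d Psi -> 0 <= rho < 1 ->
  exists q, 0 <= q < 1 /\ forall z, Cmod z <= rho -> Cmod (Psi z) <= q.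
Proof.
intros Hd [l [Hl HPsi]] Hrho.
destruct l as [|psi l]; [simpl in Hl; lia|].
set (m := (1 - Cmod (aut_a psi) ^ 2) * (1 - rho ^ 2) / 4).
assert (Ha := proj1 (disc_sq _) (aut_a_disc psi)).
assert (Ha2 := pow2_ge_0 (Cmod (aut_a psi))).
assert (Hm : 0 < m <= 1).
{ assert (0 < 1 - rho ^ 2 <= 1) by nra. unfold m; split; nra. }
exists (sqrt (1 - m)); split.
- split; [apply sqrt_pos|]; rewrite <- sqrt_1 at 2; apply sqrt_lt_1; lra.
- intros z Hz; assert (Hzd : disc z) by (unfold disc; lra).
  rewrite HPsi by exact Hzd; simpl; fold (bprod l z); rewrite Cmod_mult.
  apply Rle_trans with (Cmod (psi z)).
  + assert (H1 := Cmod_ge_0 (psi z)); assert (H2 := bprod_le_1 l z Hzd).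
    assert (H3 := Cmod_ge_0 (bprod l z)); nra.
  + rewrite <- (sqrt_pow2 (Cmod _)) by apply Cmod_ge_0.
    apply sqrt_le_1; [apply pow2_ge_0 | lra |].
    assert (H := aut_pick_diag psi z Hzd).
    assert (H2 := szego_den_le_2 _ z (aut_a_disc psi) Hzd).
    assert (H3 := Cmod_ge_0 (szego_den (aut_a psi) z)).
    assert (H4 := proj1 (disc_sq _) (aut_disc psi z Hzd)).
    assert (H5 := Cmod_ge_0 z).
    assert (1 - rho ^ 2 <= 1 - Cmod z ^ 2) by nra.
    assert (Cmod (szego_den (aut_a psi) z) ^ 2 <= 4) by nra.
    assert ((1 - Cmod (aut_a psi) ^ 2) * (1 - rho ^ 2) <=
      (1 - Cmod (psi z) ^ 2) * 4).
    { apply Rle_trans with ((1 - Cmod (aut_a psi) ^ 2) * (1 - Cmod z ^ 2)).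
      - apply Rmult_le_compat_l; lra.
      - rewrite <- H; apply Rmult_le_compat_l; lra. }
    unfold m; lra.
Qed.

Lemma aut_weight_Cmod (phi : Aut) (z : C) : disc z ->
  0 < Cmod (aut_weight phi z) /\
  Cmod (aut_weight phi z) * (1 - Cmod z ^ 2) = 1 - Cmod (phi z) ^ 2.
Proof.
intros Hz; assert (Ha := proj1 (disc_sq _) (aut_a_disc phi)).
assert (Hq := szego_den_pos _ z (aut_a_disc phi) Hz).
unfold aut_weight; fold (szego_den (aut_a phi) z).
rewrite Cmod_div by (apply Cpow_nz, Cmod_neq_0, Hq).
rewrite Cmod_R, Rabs_pos_eq, Cmod_pow by lra.
assert (Hq2 : 0 < Cmod (szego_den (aut_a phi) z) ^ 2) by (apply pow_lt, Hq).
split; [apply Rdiv_lt_0_compat; assumption|].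
apply Rmult_eq_reg_r with (Cmod (szego_den (aut_a phi) z) ^ 2); [|lra].
rewrite aut_pick_diag by exact Hz; field; lra.
Qed.

Lemma Croot_Cmod (p : R) (z : C) : Cmod (Croot p z) = Rpower (Cmod z) (1 / p).
Proof.
unfold Croot; rewrite Cmod_mult, Cmod_cis, Cmod_R, Rabs_pos_eq, Rmult_1_r;
  [reflexivity | apply Rlt_le, exp_pos].
Qed.

(** * The intersection of the ranges when there is a fixed point *)

(** The weight is chosen so that U acts on this quantity as a mere composition, see
[weighted_mod_U]. *)
Definition weighted_mod (p : R) (f : C -> C) (z : C) : R :=
  Cmod (f z) * Rpower (1 - Cmod z ^ 2) (1 / p).

(** The modulus of the derivative of [phi] is [(1 - |phi z|^2) / (1 - |z|^2)], so
the weight of U telescopes along an orbit. *)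
Lemma weighted_mod_U (p : R) (phi : Aut) (Psi f : C -> C) (z : C) : disc z ->
  weighted_mod p (mult_op Psi (U_op p phi f)) z =
  Cmod (Psi z) * weighted_mod p f (phi z).
Proof.
intros Hz; destruct (aut_weight_Cmod phi z Hz) as [H0 H1].
unfold weighted_mod, U_op, mult_op, comp_op.
rewrite !Cmod_mult, Croot_Cmod, <- H1, <- Rpower_mult_distr.
- ring.
- exact H0.
- apply disc_sq, Hz.
Qed.

Section Core.

Variable p : R.
Variable d : nat.
Variable S : (C -> C) -> (C -> C).
Variable phi : Aut.
Variable Psi : C -> C.
Hypothesis hp1 : 1 <= p.
Hypothesis hd : (1 <= d)%nat.
Hypothesis hS : Hp_isometry p S.
Hypothesis hPsi : blaschke d Psi.
Hypothesis hform : forall f, Hp p f -> eqD (S f) (mult_op Psi (U_op p phi f)).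

Lemma iter_Hp (n : nat) (g : C -> C) : Hp p g -> Hp p (Nat.iter n S g).
Proof. intros Hg; induction n; simpl; [exact Hg | now apply hS]. Qed.

Lemma iter_norm (n : nat) (g : C -> C) : Hp p g ->
  Hp_norm p (Nat.iter n S g) = Hp_norm p g.
Proof.
intros Hg; induction n as [|n IH]; simpl; [reflexivity|].
rewrite <- IH; apply hS, iter_Hp, Hg.
Qed.

(** Each application of S costs a factor [Psi], evaluated on the orbit. *)
Lemma iter_decay (rho q : R) : 0 <= q ->
  (forall w, Cmod w <= rho -> Cmod (Psi w) <= q) ->
  forall n g z, Hp p g -> disc z ->
    (forall k, Cmod (Nat.iter k phi z) <= rho) ->
    weighted_mod p (Nat.iter n S g) z <= q ^ n * weighted_mod p g (Nat.iter n phi z).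
Proof.
intros Hq0 Hq n; induction n as [|n IH]; intros g z Hg Hz Hk; simpl; [lra|].
assert (Heq : weighted_mod p (S (Nat.iter n S g)) z =
  weighted_mod p (mult_op Psi (U_op p phi (Nat.iter n S g))) z).
{ unfold weighted_mod; rewrite hform; [reflexivity | apply iter_Hp, Hg | exact Hz]. }
rewrite Heq, weighted_mod_U by exact Hz.
rewrite <- Nat.iter_succ, Nat.iter_succ_r.
assert (H := IH g (phi z) Hg (aut_disc phi z Hz)).
rewrite Rmult_assoc; apply Rmult_le_compat; try apply Cmod_ge_0.
- apply Rmult_le_pos; [apply Cmod_ge_0 | apply Rlt_le, exp_pos].
- apply Hq, (Hk 0%nat).
- apply H; intros k; rewrite <- Nat.iter_succ_r; apply Hk.
Qed.

(** If [f = S^n g], then g has the same norm as f, so [g] at the point [phi^n(z)] is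
bounded independently of n, and [iter_decay] makes [f z] smaller than a geometric
sequence. *)
Lemma core_trivial_of_fixed (z0 : C) (f : C -> C) : disc z0 -> phi z0 = z0 ->
  Hp p f -> (forall n, (1 <= n)%nat -> iter_range p S n f) -> eqD f zero_fun.
Proof.
intros H0 Hfix Hf Hn z Hz; unfold zero_fun.
destruct (fixed_orbit_bounded phi z0 z H0 Hfix Hz) as [rho [Hrho Hk]].
destruct (blaschke_bound d Psi rho hd hPsi Hrho) as [q [Hq HPq]].
assert (HfN := proj2 Hf).
destruct (Hp_point_bound p (real (Hp_norm p f)) rho hp1 Hrho) as [K HK].
assert (Hb : forall n, (1 <= n)%nat -> weighted_mod p f z <= q ^ n * Rmax K 0).
{ intros n Hn1; destruct (Hn n Hn1) as [g [Hg Hfg]].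
  assert (E : weighted_mod p f z = weighted_mod p (Nat.iter n S g) z)
    by (unfold weighted_mod; rewrite Hfg; [reflexivity|exact Hz]).
  rewrite E; eapply Rle_trans; [apply (iter_decay rho q); try assumption; lra|].
  apply Rmult_le_compat_l; [apply pow_le; lra|].
  assert (Hdn := iter_disc phi n z Hz).
  set (w := Nat.iter n phi z) in *.
  assert (HgK : Cmod (g w) <= K).
  { apply HK; [exact Hg| |apply Hk].
    rewrite <- (iter_norm n g Hg), <- (Hp_norm_eqD p _ _ Hfg); symmetry; exact HfN. }
  unfold weighted_mod.
  assert (Hpow : Rpower (1 - Cmod w ^ 2) (1 / p) <= 1).
  { apply Rle_trans with (Rpower 1 (1 / p)).
    - apply Rle_Rpower_l; [apply Rlt_le, Rdiv_lt_0_compat; lra|].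
      assert (A := proj1 (disc_sq w) Hdn); generalize (pow2_ge_0 (Cmod w)); lra.
    - unfold Rpower; rewrite ln_1, Rmult_0_r, exp_0; lra. }
  assert (A := Cmod_ge_0 (g w)).
  assert (B : 0 < Rpower (1 - Cmod w ^ 2) (1 / p)) by apply exp_pos.
  generalize (Rmax_l K 0); nra. }
assert (Hle : weighted_mod p f z <= 0).
{ apply (is_lim_seq_le (fun _ => weighted_mod p f z)
    (fun n => q ^ (n + 1) * Rmax K 0) (weighted_mod p f z) 0).
  - intros n; apply Hb; lia.
  - apply is_lim_seq_const.
  - replace (Finite 0) with (Rbar_mult 0 (Rmax K 0)) by (simpl; f_equal; ring).
    apply is_lim_seq_scal_r.
    apply (is_lim_seq_incr_n (fun n => q ^ n) 1), is_lim_seq_geom.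
    rewrite Rabs_pos_eq; lra. }
apply Cmod_eq_0, Rle_antisym; [|apply Cmod_ge_0].
unfold weighted_mod in Hle.
assert (B : 0 < Rpower (1 - Cmod z ^ 2) (1 / p)) by apply exp_pos.
assert (A := Cmod_ge_0 (f z)); nra.
Qed.

Lemma zero_Hinf : Hinf zero_fun.
Proof.
split.
- intros z _; apply Cdif_const.
- exists 0; intros z _; unfold zero_fun; rewrite Cmod_0; lra.
Qed.

Lemma iter_range_zero (n : nat) (f : C -> C) : eqD f zero_fun -> iter_range p S n f.
Proof.
intros Hf; assert (H0 : Hp p zero_fun) by (apply Hinf_Hp; [lra|apply zero_Hinf]).
exists zero_fun; split; [exact H0|].
apply (eqD_trans _ zero_fun); [exact Hf|].
apply eqD_sym; induction n as [|n IH]; simpl; [intros z _; reflexivity|].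
apply (eqD_trans _ (S zero_fun)).
- apply hS; [apply iter_Hp, H0 | exact H0 | exact IH].
- intros z Hz; rewrite hform by assumption.
  unfold mult_op, U_op, mult_op, comp_op, zero_fun; ring.
Qed.

End Core.

(** * The complex logarithm and the root of the weight *)

Definition Cexp (z : C) : C := (exp (Re z) * cis (Im z))%C.

Lemma cis_plus (s t : R) : cis (s + t) = (cis s * cis t)%C.
Proof.
unfold cis; rewrite cos_plus, sin_plus.
apply injective_projections; simpl; ring.
Qed.

Lemma Cexp_plus (z w : C) : Cexp (z + w) = (Cexp z * Cexp w)%C.
Proof.
unfold Cexp; rewrite re_plus, im_plus, exp_plus, cis_plus, RtoC_mult; ring.
Qed.

Lemma Cexp_0 : Cexp (RtoC 0) = RtoC 1.
Proof.
unfold Cexp, cis; simpl; rewrite exp_0, cos_0, sin_0.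
apply injective_projections; simpl; ring.
Qed.

Lemma Im_le_Cmod (z : C) : Rabs (Im z) <= Cmod z.
Proof. exact (Rle_trans _ _ _ (Rmax_r _ _) (Rmax_Cmod z)). Qed.

Lemma Re_le_Cmod (z : C) : Rabs (Re z) <= Cmod z.
Proof. exact (Rle_trans _ _ _ (Rmax_l _ _) (Rmax_Cmod z)). Qed.

Lemma Cexp_Cder_0 : Cder Cexp (RtoC 0) (RtoC 1).
Proof.
intros eps Heps; assert (He : 0 < eps / 3) by lra.
destruct (is_derive_exp 0) as [_ Hexp].
destruct (Hexp 0 (fun P HP => HP) (mkposreal _ He)) as [d1 H1].
destruct (Rder_cis 0 (eps / 3) He) as [d2 [Hd2 H2]].
exists (Rmin d1 (Rmin d2 (eps / 3))); split.
{ repeat apply Rmin_glb_lt; try assumption; apply cond_pos. }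
intros w; replace (w - 0)%C with w by ring; intros Hw.
assert (W1 := Rlt_le_trans _ _ _ Hw (Rmin_l _ _)).
assert (W2 := Rlt_le_trans _ _ _ Hw (Rle_trans _ _ _ (Rmin_r _ _) (Rmin_l _ _))).
assert (W3 := Rlt_le_trans _ _ _ Hw (Rle_trans _ _ _ (Rmin_r _ _) (Rmin_r _ _))).
assert (Bx := Re_le_Cmod w); assert (By := Im_le_Cmod w).
rewrite Cexp_0.
assert (E1 : Rabs (exp (Re w) - 1 - Re w) <= eps / 3 * Rabs (Re w)).
{ assert (H : ball 0 d1 (Re w)).
  { change (Rabs (Re w - 0) < d1); rewrite Rminus_0_r; lra. }
  specialize (H1 (Re w) H); rewrite exp_0 in H1.
  replace (exp (Re w) - 1 - Re w) with (exp (Re w) - 1 - (Re w - 0) * 1) by ring.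
  replace (Rabs (Re w)) with (Rabs (Re w - 0)) by (f_equal; ring).
  exact H1. }
assert (E2 : Cmod (cis (Im w) - 1 - Im w * Ci) <= eps / 3 * Rabs (Im w)).
{ specialize (H2 (Im w)); rewrite Rminus_0_r in H2; specialize (H2 ltac:(lra)).
  replace (cis 0) with (RtoC 1) in H2
    by (unfold cis; rewrite cos_0, sin_0; reflexivity).
  rewrite Cmult_1_r in H2; exact H2. }
assert (E3 : Cmod (cis (Im w) - 1) <= Rabs (Im w)).
{ generalize (cis_lip (Im w) 0).
  replace (cis 0) with (RtoC 1) by (unfold cis; rewrite cos_0, sin_0; reflexivity).
  rewrite Rminus_0_r; trivial. }
replace (Cexp w - 1 - 1 * w)%C with
  ((exp (Re w) - 1 - Re w)%R * cis (Im w) + Re w * (cis (Im w) - 1)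
    + (cis (Im w) - 1 - Im w * Ci))%C.
- eapply Rle_trans; [apply Cmod_triangle|].
  eapply Rle_trans; [apply Rplus_le_compat_r, Cmod_triangle|].
  rewrite !Cmod_mult, Cmod_cis, !Cmod_R.
  assert (A1 := Rabs_pos (Re w)); assert (A2 := Cmod_ge_0 (cis (Im w) - 1)).
  assert (Rabs (Re w) * Cmod (cis (Im w) - 1) <= Cmod w * (eps / 3))
    by (apply Rmult_le_compat; lra).
  nra.
- unfold Cexp; rewrite !RtoC_minus.
  replace (1 * w)%C with (RtoC (Re w) + Im w * Ci)%C
    by (apply injective_projections; unfold Re, Im; simpl; ring).
  ring.
Qed.

Lemma Cexp_Cder (z : C) : Cder Cexp z (Cexp z).
Proof.
assert (H : Cder (fun w => Cexp z * Cexp (w - z))%C z (Cexp z)).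
{ assert (H1 : Cder (fun w => w - z)%C z (RtoC 1)).
  { generalize (Cder_minus _ _ _ _ _ (Cder_id z) (Cder_const z z)).
    replace (1 - 0)%C with (RtoC 1) by ring; trivial. }
  assert (H2 : Cder Cexp (z - z)%C (RtoC 1)).
  { replace (z - z)%C with (RtoC 0) by ring; apply Cexp_Cder_0. }
  generalize (Cder_mult _ _ _ _ _ (Cder_const (Cexp z) z)
    (Cder_comp Cexp (fun w => w - z)%C z _ _ H2 H1)).
  match goal with |- Cder _ _ ?x -> _ =>
    replace x with (Cexp z); [trivial|ring] end. }
apply (Cder_ext_loc _ _ z _ 1 Rlt_0_1) with (2 := H).
intros w _; rewrite <- Cexp_plus; f_equal; ring.
Qed.

Definition slit (z : C) : Prop := 0 < Cmod z + Re z.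

Definition Clog (z : C) : C := (ln (Cmod z), Carg z).

Lemma slit_Cmod (z : C) : slit z -> 0 < Cmod z.
Proof.
unfold slit; intros H; generalize (Re_le_Cmod z); intros H1.
apply Rabs_le_between in H1; lra.
Qed.

(** The half-angle formulas for [Carg z = 2 atan T] with [T = Im z / (|z| + Re z)].
*)
Lemma Cexp_Clog (z : C) : slit z -> Cexp (Clog z) = z.
Proof.
intros Hz; assert (Hm := slit_Cmod z Hz); unfold slit in Hz.
unfold Cexp, Clog; simpl; rewrite exp_ln by exact Hm.
assert (Hm2 := Cmod2_alt z).
unfold Carg; set (m := Cmod z) in *; set (x := Re z) in *; set (y := Im z) in *.
set (T := y / (m + x)).
assert (HT : 1 + T² = 2 * m / (m + x)).
{ unfold T, Rsqr; replace (2 * m / (m + x)) with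
    ((m ^ 2 + 2 * m * x + m ^ 2) / (m + x) ^ 2) by (field; lra).
  rewrite Hm2 at 2; field; lra. }
assert (HT0 : 0 < 1 + T²) by (unfold Rsqr; nra).
assert (Hs : sqrt (1 + T²) * sqrt (1 + T²) = 1 + T²)
  by (apply sqrt_sqrt; lra).
assert (Hs0 : 0 < sqrt (1 + T²)) by (apply sqrt_lt_R0; lra).
assert (Hc : cos (2 * atan T) = x / m).
{ rewrite cos_2a_cos, cos_atan.
  replace (2 * (1 / sqrt (1 + T²)) * (1 / sqrt (1 + T²)) - 1) with
    (2 / (sqrt (1 + T²) * sqrt (1 + T²)) - 1) by (field; lra).
  rewrite Hs, HT; field; lra. }
assert (Hsn : sin (2 * atan T) = y / m).
{ rewrite sin_2a, cos_atan, sin_atan.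
  replace (2 * (T / sqrt (1 + T²)) * (1 / sqrt (1 + T²))) with
    (2 * T / (sqrt (1 + T²) * sqrt (1 + T²))) by (field; lra).
  rewrite Hs, HT; unfold T; field; lra. }
unfold cis; rewrite Hc, Hsn.
destruct z as [x0 y0]; apply injective_projections; simpl;
  unfold x, y; simpl; field; lra.
Qed.

Lemma Clog_continuous (z : C) : slit z ->
  @continuous C_UniformSpace C_UniformSpace Clog z.
Proof.
intros Hz; assert (Hm := slit_Cmod z Hz); unfold slit in Hz.
assert (H1 : continuous Cmod z).
{ apply (cont_Cmod (U := C_UniformSpace) (fun w => w)), continuous_id. }
apply (cont_pair (U := C_UniformSpace)).
- apply (continuous_comp (U := C_UniformSpace) Cmod ln z H1).
  apply continuous_ln; exact Hm.
- apply (continuous_mult (U := C_UniformSpace) (fun _ => 2)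
    (fun w : C => atan (Im w / (Cmod w + Re w)))); [apply continuous_const|].
  apply (continuous_comp (U := C_UniformSpace)
    (fun w : C => Im w / (Cmod w + Re w)) atan).
  + apply (continuous_mult (U := C_UniformSpace) (fun w : C => Im w)
      (fun w : C => / (Cmod w + Re w))).
    * apply continuous_snd.
    * apply (continuous_comp (U := C_UniformSpace) (fun w : C => Cmod w + Re w) Rinv).
      -- apply (continuous_plus (U := C_UniformSpace) (V := R_NormedModule));
           [exact H1|apply continuous_fst].
      -- apply continuous_Rinv; lra.
  + apply continuous_atan.
Qed.

(** The inverse function rule: a continuous right inverse of a function with nonzero
derivative is differentiable. *)
Lemma Cder_right_inverse (g f : C -> C) (z l : C) (d : R) : 0 < d ->
  (forall w, Cmod (w - z) < d -> f (g w) = w) ->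
  @continuous C_UniformSpace C_UniformSpace g z ->
  Cder f (g z) l -> l <> RtoC 0 -> Cder g z (/ l)%C.
Proof.
intros Hd Hfg Hg Hf Hl eps Heps.
assert (Hm := proj1 (Cmod_gt_0 l) Hl); set (m := Cmod l) in *.
assert (He : 0 < Rmin (m / 2) (eps * m * m / 2)).
{ apply Rmin_glb_lt; [lra|]; assert (0 < eps * m * m) by
    (repeat apply Rmult_lt_0_compat; assumption); lra. }
destruct (Hf _ He) as [d1 [Hd1 H1]].
assert (H2 := proj1 (Ccont_iff g z) Hg d1 Hd1).
apply locally_C in H2; destruct H2 as [d2 H2].
exists (Rmin d d2); split; [apply Rmin_glb_lt; [assumption|apply cond_pos]|].
intros w Hw.
assert (W1 := Rlt_le_trans _ _ _ Hw (Rmin_l _ _)).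
assert (W2 := Rlt_le_trans _ _ _ Hw (Rmin_r _ _)).
specialize (H1 (g w) (H2 w W2)).
rewrite Hfg in H1 by exact W1; rewrite Hfg in H1.
2:{ replace (z - z)%C with (RtoC 0) by ring; rewrite Cmod_0; exact Hd. }
assert (E1 := Rmin_l (m / 2) (eps * m * m / 2)).
assert (E2 := Rmin_r (m / 2) (eps * m * m / 2)).
set (e := Rmin (m / 2) (eps * m * m / 2)) in *.
assert (A1 := Cmod_ge_0 (g w - g z)); assert (A2 := Cmod_ge_0 (w - z)).
assert (H3 : Cmod (g w - g z) * (m / 2) <= Cmod (w - z)).
{ generalize (Cmod_triangle_minus (l * (g w - g z)) (l * (g w - g z) - (w - z))).
  rewrite Cmod_mult; fold m.
  rewrite (Cmod_minus_sym (l * (g w - g z))).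
  replace (l * (g w - g z) - (l * (g w - g z) - (w - z)))%C with (w - z)%C by ring.
  nra. }
replace (g w - g z - / l * (w - z))%C with
  (- ((w - z - l * (g w - g z)) / l))%C by (field; exact Hl).
rewrite Cmod_opp, Cmod_div by exact Hl; fold m.
apply Rle_div_l; [assumption|].
eapply Rle_trans; [exact H1|].
apply Rle_trans with (eps * m * m / 2 * Cmod (g w - g z)); [nra|].
replace (eps * m * m / 2 * Cmod (g w - g z)) with
  (eps * m * (Cmod (g w - g z) * (m / 2))) by field.
replace (eps * Cmod (w - z) * m) with (eps * m * Cmod (w - z)) by ring.
apply Rmult_le_compat_l; [|exact H3].
apply Rlt_le, Rmult_lt_0_compat; assumption.
Qed.

Lemma slit_open (z : C) : slit z -> exists d, 0 < d /\
  forall w, Cmod (w - z) < d -> slit w.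
Proof.
unfold slit; intros Hz; exists ((Cmod z + Re z) / 2); split; [lra|].
intros w Hw.
generalize (Cmod_triangle_minus z w) (Re_le_Cmod (w - z)).
rewrite Cmod_minus_sym; intros H1 H2; apply Rabs_le_between in H2.
unfold Cminus in H2; rewrite re_plus, re_opp in H2; fold (w - z)%C in H2; lra.
Qed.

Lemma Clog_Cdif (z : C) : slit z -> Cdif Clog z.
Proof.
intros Hz; destruct (slit_open z Hz) as [d [Hd Hs]].
exists (/ z)%C; apply (Cder_right_inverse Clog Cexp z z d Hd).
- intros w Hw; apply Cexp_Clog, Hs, Hw.
- apply Clog_continuous, Hz.
- rewrite <- (Cexp_Clog z Hz) at 2; apply Cexp_Cder.
- apply Cmod_neq_0, slit_Cmod, Hz.
Qed.

Lemma Croot_Cexp (p : R) (z : C) : Croot p z = Cexp (RtoC (1 / p) * Clog z).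
Proof.
unfold Croot, Cexp, Rpower; rewrite re_scal_l, im_scal_l.
replace (Carg z / p) with (1 / p * Carg z) by (unfold Rdiv; ring); reflexivity.
Qed.

Lemma Croot_Cdif (p : R) (z : C) : slit z -> Cdif (Croot p) z.
Proof.
intros Hz; apply (Cdif_ext_loc (fun w => Cexp (RtoC (1 / p) * Clog w)) _ z 1).
- lra.
- intros w _; symmetry; apply Croot_Cexp.
- apply (Cdif_comp Cexp (fun w => RtoC (1 / p) * Clog w)%C).
  + eexists; apply Cexp_Cder.
  + apply Cdif_mult; [apply Cdif_const | apply Clog_Cdif, Hz].
Qed.

Lemma Re_szego_den_pos (a z : C) : disc a -> disc z -> 0 < Re (szego_den a z).
Proof.
unfold disc; intros Ha Hz.
generalize (Re_le_Cmod (Cconj a * z)).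
rewrite Cmod_mult, Cmod_conj; intros H; apply Rabs_le_between in H.
assert (A := Cmod_ge_0 a); assert (B := Cmod_ge_0 z).
unfold szego_den, Cminus; rewrite re_plus, re_opp.
change (Re 1) with 1; nra.
Qed.

(** The weight is a positive multiple of the square of the conjugate of a number
with positive real part, so it avoids the nonpositive reals, where the principal
root is discontinuous. *)
Lemma aut_weight_slit (phi : Aut) (z : C) : disc z -> slit (aut_weight phi z).
Proof.
intros Hz; assert (Ha := proj1 (disc_sq _) (aut_a_disc phi)).
assert (Hre := Re_szego_den_pos _ z (aut_a_disc phi) Hz).
assert (Hq := szego_den_pos _ z (aut_a_disc phi) Hz).
unfold slit, aut_weight; fold (szego_den (aut_a phi) z).
set (q := szego_den (aut_a phi) z) in *; set (c := 1 - Cmod (aut_a phi) ^ 2) in *.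
assert (Hq0 : q <> RtoC 0) by (apply Cmod_neq_0, Hq).
set (k := c / Cmod q ^ 4).
assert (Hk : 0 < k) by (apply Rdiv_lt_0_compat; [|apply pow_lt]; assumption).
assert (E : (c / q ^ 2)%C = (k * (Cconj q * Cconj q))%C).
{ unfold k; rewrite RtoC_div by (apply Rgt_not_eq, pow_lt; assumption).
  replace (Cmod q ^ 4) with (Cmod q ^ 2 * Cmod q ^ 2) by ring.
  rewrite RtoC_mult, Cmod2_conj.
  assert (Hqc : Cconj q <> RtoC 0)
    by (apply Cmod_neq_0; rewrite Cmod_conj; exact Hq).
  field; split; assumption. }
rewrite E, Cmod_mult, re_scal_l, Cmod_R, Rabs_pos_eq, Cmod_mult, Cmod_conj by lra.
rewrite re_mult, re_conj, im_conj.
assert (H2 := Cmod2_alt q).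
match goal with |- 0 < ?x =>
  replace x with (k * (Cmod q ^ 2 + Re q ^ 2 - Im q ^ 2)) by ring end.
rewrite H2; apply Rmult_lt_0_compat; [exact Hk | nra].
Qed.

Lemma aut_weight_Cdif (phi : Aut) (z : C) : disc z -> Cdif (aut_weight phi) z.
Proof.
intros Hz; apply Cdif_div; [apply Cdif_const| |].
- assert (H : Cdif (fun w => 1 - Cconj (aut_a phi) * w)%C z).
  { apply Cdif_minus; [apply Cdif_const|].
    apply Cdif_mult; [apply Cdif_const | apply Cdif_id]. }
  apply (Cdif_mult _ _ z H), (Cdif_mult _ _ z H), Cdif_const.
- apply Cpow_nz, (szego_den_neq_0 (aut_a phi) z (aut_a_disc phi) Hz).
Qed.

Lemma aut_Cdif (phi : Aut) (z : C) : disc z -> Cdif phi z.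
Proof.
intros Hz; apply Cdif_div.
- apply Cdif_mult; [apply Cdif_const|].
  apply Cdif_minus; [apply Cdif_id | apply Cdif_const].
- apply Cdif_minus; [apply Cdif_const|].
  apply Cdif_mult; [apply Cdif_const | apply Cdif_id].
- exact (szego_den_neq_0 _ z (aut_a_disc phi) Hz).
Qed.

Definition inv_weight (p : R) (phi : Aut) (z : C) : C :=
  (/ Croot p (aut_weight phi z))%C.

Lemma Croot_weight_neq_0 (p : R) (phi : Aut) (z : C) :
  Croot p (aut_weight phi z) <> RtoC 0.
Proof. apply Cmod_neq_0; rewrite Croot_Cmod; apply exp_pos. Qed.

(** The inverse of the weight of U is bounded because the weight is bounded below:
[|1 - conj a * z| <= 2]. *)
Lemma inv_weight_Hinf (p : R) (phi : Aut) : 0 < p -> Hinf (inv_weight p phi).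
Proof.
intros Hp; split.
- intros z Hz.
  apply (Cdif_comp Cinv (fun w => Croot p (aut_weight phi w))).
  + eexists; apply Cder_inv, Croot_weight_neq_0.
  + apply (Cdif_comp (Croot p) (aut_weight phi)).
    * apply Croot_Cdif, aut_weight_slit, Hz.
    * apply aut_weight_Cdif, Hz.
- assert (Ha := proj1 (disc_sq _) (aut_a_disc phi)).
  set (c := 1 - Cmod (aut_a phi) ^ 2) in *.
  exists (/ Rpower (c / 4) (1 / p)); intros z Hz.
  unfold inv_weight; rewrite Cmod_inv by apply Croot_weight_neq_0.
  rewrite Croot_Cmod.
  apply Rinv_le_contravar; [apply exp_pos|].
  apply Rle_Rpower_l; [apply Rlt_le, Rdiv_lt_0_compat; lra|].
  split; [lra|].
  unfold aut_weight; fold (szego_den (aut_a phi) z).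
  assert (Hq := szego_den_pos _ z (aut_a_disc phi) Hz).
  rewrite Cmod_div by (apply Cpow_nz, Cmod_neq_0, Hq).
  rewrite Cmod_R, Cmod_pow; fold c; rewrite Rabs_pos_eq by lra.
  assert (H2 := szego_den_le_2 _ z (aut_a_disc phi) Hz).
  apply Rmult_le_compat_l; [lra|].
  apply Rinv_le_contravar; [apply pow_lt, Hq | nra].
Qed.

(** * Bounded holomorphic functions in the range of an iterate *)

Lemma Hinf_mult (f g : C -> C) : Hinf f -> Hinf g -> Hinf (fun z => f z * g z)%C.
Proof.
intros [Hf [M HM]] [Hg [N HN]]; split.
- intros z Hz; apply Cdif_mult; auto.
- exists (M * N); intros z Hz; rewrite Cmod_mult.
  apply Rmult_le_compat; auto using Cmod_ge_0.
Qed.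

Lemma Hinf_comp (f : C -> C) (psi : Aut) : Hinf f -> Hinf (fun z => f (psi z)).
Proof.
intros [Hf [M HM]]; split.
- intros z Hz; apply Cdif_comp; [apply Hf, aut_disc, Hz | apply aut_Cdif, Hz].
- exists M; intros z Hz; apply HM, aut_disc, Hz.
Qed.

Lemma inv_lam_unit (phi : Aut) : Cmod (Cconj (aut_lam phi)) = 1.
Proof. rewrite Cmod_conj; apply aut_lam_unit. Qed.

Lemma inv_a_disc (phi : Aut) : disc (- (aut_lam phi * aut_a phi))%C.
Proof.
unfold disc; rewrite Cmod_opp, Cmod_mult, aut_lam_unit, Rmult_1_l.
apply aut_a_disc.
Qed.

Definition aut_inv (phi : Aut) : Aut :=
  mkAut (Cconj (aut_lam phi)) (- (aut_lam phi * aut_a phi))%C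
    (inv_lam_unit phi) (inv_a_disc phi).

Lemma aut_invK (phi : Aut) (z : C) : disc z -> aut_inv phi (phi z) = z.
Proof.
intros Hz.
assert (H1 := szego_den_neq_0 _ _ (aut_a_disc (aut_inv phi)) (aut_disc phi z Hz)).
assert (H2 := szego_den_neq_0 _ z (aut_a_disc phi) Hz).
assert (Hl := aut_lam_unit phi).
assert (H3 : (aut_lam phi * Cconj (aut_lam phi))%C = RtoC 1)
  by (rewrite <- Cmod2_conj, Hl; f_equal; ring).
assert (Hc := szego_den_neq_0 _ _ (aut_a_disc phi) (aut_a_disc phi)).
unfold aut_map at 1; unfold szego_den at 1 in H1; cbn [aut_lam aut_a aut_inv] in *.
unfold szego_den in H2, Hc.
rewrite Copp_conj, Cmult_conj in H1 |- *.
set (lam := aut_lam phi) in *; set (a := aut_a phi) in *.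
unfold aut_map in H1 |- *; fold lam a in H1 |- *.
set (D := (1 - Cconj a * z)%C) in *.
assert (E1 : (1 - - (Cconj lam * Cconj a) * (lam * (z - a) / D))%C =
  ((1 - Cconj a * a) / D)%C).
{ transitivity ((D + (lam * Cconj lam) * (Cconj a * (z - a))) / D)%C.
  - field; exact H2.
  - rewrite H3; unfold D; field; exact H2. }
rewrite E1.
transitivity ((lam * Cconj lam) * ((z - a) + a * D) / (1 - Cconj a * a))%C.
- field; split; assumption.
- rewrite H3; unfold D; field; exact Hc.
Qed.

Section Range.

Variable p : R.
Variable S : (C -> C) -> (C -> C).
Variable phi : Aut.
Variable Psi : C -> C.
Hypothesis hp1 : 1 <= p.
Hypothesis hS : Hp_isometry p S.
Hypothesis hform : forall f, Hp p f -> eqD (S f) (mult_op Psi (U_op p phi f)).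

(** The Blaschke factor that S accumulates in n iterations. *)
Fixpoint orbit_prod (n : nat) (z : C) : C :=
  match n with
  | O => RtoC 1
  | Datatypes.S m => (Psi z * orbit_prod m (phi z))%C
  end.

(** Given h, the argument for the remaining n iterations is h divided by the weight
and composed with the inverse of [phi]; one more application of S then gives back h
multiplied by [Psi] and by the shifted orbit product. *)
Lemma orbit_prod_range (n : nat) (h : C -> C) : Hinf h ->
  exists g, Hinf g /\ eqD (Nat.iter n S g) (fun z => orbit_prod n z * h z)%C.
Proof.
assert (Hp : 0 < p) by lra.
revert h; induction n as [|n IH]; intros h Hh.
- exists h; split; [exact Hh|]; intros z _; simpl; ring.
- destruct (IH (fun w => h (aut_inv phi w) * inv_weight p phi (aut_inv phi w))%C)
    as [g [Hg Eg]].
  { apply Hinf_mult; apply Hinf_comp; [exact Hh | apply inv_weight_Hinf, Hp]. }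
  exists g; split; [exact Hg|]; intros z Hz; simpl.
  rewrite (hform (Nat.iter n S g)); [|apply iter_Hp, Hinf_Hp; assumption|exact Hz].
  unfold mult_op, U_op, mult_op, comp_op.
  rewrite Eg by (apply aut_disc, Hz).
  rewrite aut_invK by exact Hz.
  unfold inv_weight; field; apply Croot_weight_neq_0.
Qed.

End Range.

(** * Fixed points and orbits through SU(1,1) *)

(** The map f is the action on the disc of a matrix of SU(1,1) with first row [(al,
be)]; the denominator is multiplied out. *)
Definition su11 (f : C -> C) (al be : C) : Prop :=
  Cmod al ^ 2 - Cmod be ^ 2 = 1 /\
  forall z, disc z -> (f z * (Cconj be * z + Cconj al))%C = (al * z + be)%C.

Lemma su11_lt (al be : C) : Cmod al ^ 2 - Cmod be ^ 2 = 1 -> Cmod be < Cmod al.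
Proof. generalize (Cmod_ge_0 al) (Cmod_ge_0 be); nra. Qed.

Lemma su11_den (al be z : C) : Cmod al ^ 2 - Cmod be ^ 2 = 1 -> disc z ->
  Cmod al * (1 - Cmod z) <= Cmod (Cconj be * z + Cconj al) /\
  (Cconj be * z + Cconj al)%C <> RtoC 0.
Proof.
unfold disc; intros Hab Hz; assert (H := su11_lt _ _ Hab).
assert (A := Cmod_ge_0 be); assert (B := Cmod_ge_0 z).
assert (H1 : Cmod al * (1 - Cmod z) <= Cmod (Cconj be * z + Cconj al)).
{ generalize (Cmod_triangle_minus (Cconj al) (- (Cconj be * z))).
  replace (Cconj al - - (Cconj be * z))%C with (Cconj be * z + Cconj al)%C by ring.
  rewrite Cmod_opp, Cmod_mult, !Cmod_conj; nra. }
split; [exact H1|]; apply Cmod_neq_0; nra.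
Qed.

Lemma su11_comp (f g : C -> C) (al be al' be' : C) :
  (forall z, disc z -> disc (g z)) -> su11 f al be -> su11 g al' be' ->
  su11 (fun z => f (g z)) (al * al' + be * Cconj be')%C (al * be' + be * Cconj al')%C.
Proof.
intros Hg [Hf1 Hf2] [Hg1 Hg2]; split.
- apply RtoC_inj; rewrite RtoC_minus, !Cmod2_conj, !Cplus_conj, !Cmult_conj, !Cconj_conj.
  transitivity ((al * Cconj al - be * Cconj be) *
    (al' * Cconj al' - be' * Cconj be'))%C; [ring|].
  rewrite <- !Cmod2_conj, <- !RtoC_minus, Hf1, Hg1; ring.
- intros z Hz.
  assert (E1 := Hf2 (g z) (Hg z Hz)); assert (E2 := Hg2 z Hz).
  rewrite !Cplus_conj, !Cmult_conj, !Cconj_conj.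
  transitivity (f (g z) * (Cconj be * (al' * z + be') +
    Cconj al * (Cconj be' * z + Cconj al')))%C; [ring|].
  rewrite <- E2.
  transitivity (f (g z) * (Cconj be * g z + Cconj al) *
    (Cconj be' * z + Cconj al'))%C; [ring|].
  rewrite E1.
  transitivity (al * (g z * (Cconj be' * z + Cconj al')) +
    be * (Cconj be' * z + Cconj al'))%C; [ring|].
  rewrite E2; ring.
Qed.

Lemma unit_sqrt (lam : C) : Cmod lam = 1 ->
  exists mu, Cmod mu = 1 /\ (mu * mu)%C = lam.
Proof.
intros Hl; destruct (Rlt_dec 0 (Cmod lam + Re lam)) as [Hs|Hs].
- exists (Croot 2 lam); split.
  + rewrite Croot_Cmod, Hl; unfold Rpower; rewrite ln_1, Rmult_0_r; apply exp_0.
  + rewrite Croot_Cexp, <- Cexp_plus, <- Cmult_plus_distr_r, <- RtoC_plus.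
    replace (1 / 2 + 1 / 2) with 1 by field; rewrite Cmult_1_l.
    apply Cexp_Clog, Hs.
(* Outside the slit plane the only unimodular number is -1. *)
- exists Ci; split; [apply Cmod_Ci|].
  rewrite Hl in Hs; assert (H2 := Cmod2_alt lam); rewrite Hl in H2.
  assert (Hre := Re_le_Cmod lam); rewrite Hl in Hre; apply Rabs_le_between in Hre.
  assert (Re lam = -1) by lra; assert (Im lam = 0) by nra.
  destruct lam as [x y]; simpl in *; subst.
  apply injective_projections; simpl; ring.
Qed.

(** The automorphism with data [lam], [a] is the action of the matrix with first row
[(mu, - mu a) / sqrt (1 - |a|^2)], where [mu^2 = lam]. *)
Lemma aut_su11 (phi : Aut) : exists al be, su11 phi al be.
Proof.
destruct (unit_sqrt _ (aut_lam_unit phi)) as [mu [Hmu Hmu2]].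
assert (Ha := proj1 (disc_sq _) (aut_a_disc phi)).
set (a := aut_a phi) in *; set (s := sqrt (1 - Cmod a ^ 2)).
assert (Hs : 0 < s) by (apply sqrt_lt_R0, Ha).
assert (Hs2 : s * s = 1 - Cmod a ^ 2) by (apply sqrt_sqrt; lra).
assert (Hs0 : RtoC s <> RtoC 0) by (intros E; apply RtoC_inj in E; lra).
assert (Hinv : Cmod (/ s)%C = / s)
  by (rewrite Cmod_inv, Cmod_R, Rabs_pos_eq; [reflexivity|lra|exact Hs0]).
exists (/ s * mu)%C, (/ s * - (mu * a))%C; split.
- rewrite !Cmod_mult, Cmod_opp, Cmod_mult, Hinv, Hmu.
  transitivity ((1 - Cmod a ^ 2) / (s * s)); [field; lra|].
  rewrite Hs2; field; lra.
- intros z Hz; assert (Hq := szego_den_neq_0 a z (aut_a_disc phi) Hz); unfold szego_den in Hq.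
  unfold aut_map; fold a; rewrite <- Hmu2.
  rewrite !Cmult_conj, Copp_conj, Cmult_conj.
  rewrite Cinv_conj by exact Hs0.
  replace (Cconj s) with (RtoC s) by (apply injective_projections; simpl; ring).
  assert (Hu : (mu * Cconj mu)%C = RtoC 1)
    by (rewrite <- Cmod2_conj, Hmu; f_equal; ring).
  transitivity (/ s * (mu * Cconj mu) * (mu * (z - a)))%C.
  + field; split; assumption.
  + rewrite Hu; field; exact Hs0.
Qed.

Lemma su11_fixed (f : C -> C) (al be z : C) : su11 f al be -> disc z ->
  (Cconj be * (z * z) + (Cconj al - al) * z - be)%C = RtoC 0 -> f z = z.
Proof.
intros [H1 H2] Hz E; destruct (su11_den al be z H1 Hz) as [_ Hd].
specialize (H2 z Hz).
replace (f z) with (f z * (Cconj be * z + Cconj al) / (Cconj be * z + Cconj al))%C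
  by (field; exact Hd).
rewrite H2.
replace (al * z + be)%C with (z * (Cconj be * z + Cconj al) -
  (Cconj be * (z * z) + (Cconj al - al) * z - be))%C by ring.
rewrite E; field; exact Hd.
Qed.

(** A matrix of SU(1,1) with trace [2 Re al] in (-2, 2) has a fixed point in the
disc. *)
Lemma su11_elliptic (f : C -> C) (al be : C) : su11 f al be -> Re al ^ 2 < 1 ->
  exists z, disc z /\ f z = z.
Proof.
intros Hf Hre; assert (H1 := proj1 Hf).
assert (Ha := Cmod2_alt al).
set (x := Re al) in *; set (y := Im al) in *.
assert (Hb := Cmod_ge_0 be); set (b := Cmod be) in *.
assert (Hyb : b ^ 2 < y ^ 2) by lra.
set (s := sqrt (y ^ 2 - b ^ 2)).
assert (Hs : 0 <= s) by apply sqrt_pos.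
assert (Hs2 : s * s = y ^ 2 - b ^ 2) by (apply sqrt_sqrt; lra).
(* The fixed point is Ci * be / m, where m is the root of larger modulus of
   the quadratic equation; the product of its roots is b ^ 2. *)
assert (Hm : exists m, b < Rabs m /\ m * m - 2 * y * m + b ^ 2 = 0).
{ destruct (Rle_or_lt 0 y) as [Hy|Hy].
  - exists (y + s); split; [rewrite Rabs_pos_eq by lra|]; nra.
  - exists (y - s); split; [rewrite Rabs_left by lra|]; nra. }
destruct Hm as [m [Hm1 Hm2]].
assert (Hm0 : m <> 0) by (intros ->; rewrite Rabs_R0 in Hm1; lra).
assert (Hmc : RtoC m <> RtoC 0) by (intros E; apply RtoC_inj in E; lra).
exists (Ci * be / m)%C.
assert (Hd : disc (Ci * be / m)%C).
{ unfold disc; rewrite Cmod_div, Cmod_mult, Cmod_Ci, Cmod_R by exact Hmc; fold b.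
  apply Rlt_div_l; lra. }
split; [exact Hd|].
apply (su11_fixed f al be _ Hf Hd).
replace (Cconj al - al)%C with (- (Ci * RtoC (2 * y)))%C
  by (apply injective_projections; unfold y, Im; simpl; ring).
assert (HCi : (Ci * Ci)%C = RtoC (-1)) by (apply injective_projections; simpl; ring).
transitivity ((- be / (m * m)) * (- (Ci * Ci) * (be * Cconj be)
   + Ci * Ci * RtoC (2 * y) * m + m * m))%C; [field; exact Hmc|].
rewrite HCi, <- Cmod2_conj; fold b.
rewrite <- RtoC_opp, <- !RtoC_mult, <- !RtoC_plus.
replace (- -1 * b ^ 2 + -1 * (2 * y) * m + m * m) with (m * m - 2 * y * m + b ^ 2)
  by ring.
rewrite Hm2; ring.
Qed.

Section NoFixedPoint.

Variable phi : Aut.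
Hypothesis nofix : forall z, disc z -> phi z <> z.

(** Let [B k] be the upper right entry of the k-th power of the matrix. By the
Cayley-Hamilton theorem [B (k+2) = t B (k+1) - B k], where t is the trace. Without a
fixed point [|t| >= 2], so the increments of [|B k|] do not decrease, and the first
one is nonzero. *)
Lemma iterate_growth : exists (A B : nat -> C) (b : R), 0 < b /\
  (forall k, su11 (Nat.iter k phi) (A k) (B k)) /\
  forall k, INR k * b <= Cmod (B k).
Proof.
destruct (aut_su11 phi) as [al [be Hphi]].
assert (Hdet := proj1 Hphi).
assert (Hbe : be <> RtoC 0).
{ intros E; apply (nofix (RtoC 0)).
  - unfold disc; rewrite Cmod_0; lra.
  - apply (su11_fixed phi al be _ Hphi); [unfold disc; rewrite Cmod_0; lra|].
    rewrite E; ring. }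
assert (Hb := proj1 (Cmod_gt_0 be) Hbe).
assert (Htr : 1 <= Re al ^ 2).
{ destruct (Rle_or_lt 1 (Re al ^ 2)) as [|Hlt]; [assumption|exfalso].
  destruct (su11_elliptic phi al be Hphi Hlt) as [z [Hz Hfix]].
  exact (nofix z Hz Hfix). }
set (step := fun M : C * C =>
  ((al * fst M + be * Cconj (snd M))%C, (al * snd M + be * Cconj (fst M))%C)).
set (M := fun k => Nat.iter k step (RtoC 1, RtoC 0)).
set (B := fun k => snd (M k)).
exists (fun k => fst (M k)), B, (Cmod be).
assert (Hrec : forall k, B (S (S k)) = ((al + Cconj al) * B (S k) - B k)%C).
{ intros k; unfold B, M; simpl; fold (M k).
  rewrite Cplus_conj, !Cmult_conj, Cconj_conj.
  transitivity ((al + Cconj al) * (al * snd (M k) + be * Cconj (fst (M k)))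
    - (al * Cconj al - be * Cconj be) * snd (M k))%C; [ring|].
  rewrite <- !Cmod2_conj, <- RtoC_minus, Hdet; ring. }
split; [exact Hb|]; split.
- induction k as [|k IH].
  + split; unfold B, M; simpl.
    * rewrite Cmod_1, Cmod_0; ring.
    * intros z _; apply injective_projections; simpl; ring.
  + exact (su11_comp phi (Nat.iter k phi) al be _ _
      (fun z Hz => iter_disc phi k z Hz) Hphi IH).
- assert (H0 : B 0%nat = RtoC 0) by reflexivity.
  assert (H1 : B 1%nat = be).
  { unfold B, M; simpl; apply injective_projections; simpl; ring. }
  assert (Hinc : forall k, Cmod be <= Cmod (B (S k)) - Cmod (B k)).
  { induction k as [|k IH]; [rewrite H0, H1, Cmod_0; lra|].
    assert (Ht : 2 <= Cmod (al + Cconj al)).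
    { replace (al + Cconj al)%C with (RtoC (2 * Re al))
        by (apply injective_projections; unfold Re; simpl; ring).
      rewrite Cmod_R; 
      rewrite <- (Rabs_pos_eq 2) at 1 by lra.
      apply Rsqr_le_abs_0; unfold Rsqr; nra. }
    generalize (Cmod_triangle_minus ((al + Cconj al) * B (S k)) (B k)).
    rewrite <- Hrec, Cmod_mult.
    assert (A1 := Cmod_ge_0 (B (S k))).
    nra. }
  induction k as [|k IH]; [rewrite H0, Cmod_0; simpl; lra|].
  rewrite S_INR; specialize (Hinc k); lra.
Qed.

(** Normalize f so that its value at 0 is some x in [0, 1]. Then [1 - c f] equals [1
- x] times a quotient that is bounded on compact sets, and [1 - x] is at most [1 -
x^2 = 1 / |al|^2]. *)
Lemma su11_near_unit (f : C -> C) (al be : C) : su11 f al be ->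
  exists c, Cmod c = 1 /\ forall z, disc z ->
    Cmod (1 - c * f z) <= 2 / (Cmod al ^ 2 * (1 - Cmod z)).
Proof.
intros [Hdet Hf]; assert (Hlt := su11_lt _ _ Hdet).
assert (Hb := Cmod_ge_0 be).
assert (Ha : 0 < Cmod al) by lra.
(* For be = 0 the map is a rotation about 0 and the bound is at least 2. *)
destruct (Req_dec (Cmod be) 0) as [H0|H0].
- exists (RtoC 1); split; [apply Cmod_1|]; intros z Hz.
  destruct (su11_den al be z Hdet Hz) as [Hd Hd0].
  assert (Hbe := Cmod_eq_0 be H0); assert (Hz' : Cmod z < 1) by exact Hz.
  assert (Hal : Cmod al = 1) by (rewrite H0 in Hdet; nra).
  assert (Hfz : Cmod (f z) <= 1).
  { specialize (Hf z Hz); apply (f_equal Cmod) in Hf; rewrite Hbe in Hf.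
    replace (Cconj 0 * z + Cconj al)%C with (Cconj al) in Hf
      by (apply injective_projections; simpl; ring).
    replace (al * z + 0)%C with (al * z)%C in Hf by ring.
    rewrite !Cmod_mult, Cmod_conj, Hal in Hf; lra. }
  apply Rle_trans with 2.
  + eapply Rle_trans; [apply Cmod_triangle|].
    rewrite Cmod_opp, Cmod_mult, Cmod_1; lra.
  + rewrite Hal; generalize (Cmod_ge_0 z); intros.
    apply Rle_div_r; [nra|]; nra.
- assert (Hbe : be <> RtoC 0) by (intros E; apply H0; rewrite E; apply Cmod_0).
  set (x := Cmod be / Cmod al).
  assert (Hx : 0 < x < 1).
  { unfold x; split; [apply Rdiv_lt_0_compat; lra | apply Rlt_div_l; lra]. }
  exists (x * Cconj al / be)%C; split.
  + rewrite Cmod_div, Cmod_mult, Cmod_conj, Cmod_R, Rabs_pos_eq by (assumption || lra).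
    unfold x; field; lra.
  + intros z Hz; destruct (su11_den al be z Hdet Hz) as [Hd Hd0].
    assert (Hz' : Cmod z < 1) by exact Hz.
    set (D := (Cconj be * z + Cconj al)%C) in *.
    assert (Hxc : RtoC x <> RtoC 0) by (intros E; apply RtoC_inj in E; lra).
    assert (Hxx : (x * x * (al * Cconj al))%C = (be * Cconj be)%C).
    { rewrite <- !Cmod2_conj, <- !RtoC_mult; f_equal; unfold x; field; lra. }
    assert (E : (1 - x * Cconj al / be * f z)%C =
      ((1 - x)%R * (Cconj al - Cconj be * z / x) / D)%C).
    { replace (f z) with ((al * z + be) / D)%C
        by (rewrite <- (Hf z Hz); fold D; field; exact Hd0).
      rewrite RtoC_minus.
      transitivity ((D - (x * x * (al * Cconj al)) * z / (x * be) - x * Cconj al) / D)%C.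
      - field; repeat split; assumption.
      - rewrite Hxx; unfold D; field; repeat split; assumption. }
    rewrite E, Cmod_div, Cmod_mult, Cmod_R, Rabs_pos_eq by (assumption || lra).
    assert (HN : Cmod (Cconj al - Cconj be * z / x) <= 2 * Cmod al).
    { eapply Rle_trans; [apply Cmod_triangle|].
      rewrite Cmod_opp, Cmod_div, Cmod_mult, !Cmod_conj, Cmod_R, Rabs_pos_eq
        by (assumption || lra).
      replace (Cmod be * Cmod z / x) with (Cmod al * Cmod z) by (unfold x; field; lra).
      nra. }
    assert (H1x : 1 - x <= / Cmod al ^ 2).
    { apply Rle_trans with (1 - x * x); [nra|]; apply Req_le.
      unfold x; apply Rmult_eq_reg_r with (Cmod al ^ 2); [|nra].
      transitivity (Cmod al ^ 2 - Cmod be ^ 2); [field; lra|].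
      rewrite Hdet; field; lra. }
    apply Rle_trans with (/ Cmod al ^ 2 * (2 * Cmod al) / (Cmod al * (1 - Cmod z))).
    * unfold Rdiv; apply Rmult_le_compat.
      -- apply Rmult_le_pos; [lra|apply Cmod_ge_0].
      -- apply Rlt_le, Rinv_0_lt_compat, Cmod_gt_0, Hd0.
      -- apply Rmult_le_compat; [lra|apply Cmod_ge_0|exact H1x|exact HN].
      -- apply Rinv_le_contravar; [apply Rmult_lt_0_compat; lra|exact Hd].
    * apply Req_le; field; lra.
Qed.

(** The matrix entry of [psi o phi^k] grows linearly in k, so [su11_near_unit] gives
a bound of order [1 / (k+1)^2]. It is stated as a telescoping difference, which
makes sums of such bounds explicit. *)
Lemma orbit_near_unit (psi : Aut) : exists (K : R) (c : nat -> C), 0 <= K /\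
  forall k, Cmod (c k) = 1 /\ forall z, disc z ->
    Cmod (1 - c k * psi (Nat.iter k phi z)) <=
      K / (1 - Cmod z) * (/ (INR k + 1) - / (INR k + 2)).
Proof.
destruct iterate_growth as [A [B [b [Hb [Hsu Hgrow]]]]].
destruct (aut_su11 psi) as [al [be Hpsi]].
assert (Hdet := proj1 Hpsi); assert (Hlt := su11_lt _ _ Hdet).
set (kap := Cmod al - Cmod be); assert (Hkap : 0 < kap) by (unfold kap; lra).
set (L := 1 + / (kap * b)).
assert (Hkb : 0 < kap * b) by (apply Rmult_lt_0_compat; assumption).
assert (HL : 1 < L) by (unfold L; generalize (Rinv_0_lt_compat _ Hkb); lra).
assert (Hcomp := fun k => su11_comp psi (Nat.iter k phi) al be (A k) (B k)
  (fun z Hz => iter_disc phi k z Hz) Hpsi (Hsu k)).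
assert (Hc : forall k, exists c, Cmod c = 1 /\ forall z, disc z ->
    Cmod (1 - c * psi (Nat.iter k phi z)) <=
      4 * L ^ 2 / (1 - Cmod z) * (/ (INR k + 1) - / (INR k + 2))).
{ intros k; specialize (Hcomp k).
  destruct (su11_near_unit _ _ _ Hcomp) as [c [Hc1 Hc2]].
  exists c; split; [exact Hc1|]; intros z Hz.
  eapply Rle_trans; [apply Hc2, Hz|].
  set (A' := (al * A k + be * Cconj (B k))%C) in *.
  set (B' := (al * B k + be * Cconj (A k))%C) in *.
  assert (HA1 : 1 <= Cmod A').
  { assert (HH := proj1 Hcomp); generalize (Cmod_ge_0 A') (pow2_ge_0 (Cmod B')); nra. }
  assert (HA2 : kap * b * INR k <= Cmod A').
  { assert (Hk := su11_lt _ _ (proj1 (Hsu k))).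
    generalize (Cmod_triangle_minus (al * A k) (- (be * Cconj (B k)))).
    replace (al * A k - - (be * Cconj (B k)))%C with A' by (unfold A'; ring).
    rewrite Cmod_opp, !Cmod_mult, Cmod_conj; intros HT.
    assert (A0 := Cmod_ge_0 be); assert (A1 := Cmod_ge_0 (B k)).
    assert (Cmod be * Cmod (B k) <= Cmod be * Cmod (A k))
      by (apply Rmult_le_compat_l; lra).
    assert (kap * (INR k * b) <= kap * Cmod (A k)).
    { apply Rmult_le_compat_l; [lra|]; specialize (Hgrow k); lra. }
    unfold kap in *; nra. }
  assert (Hk0 := pos_INR k).
  (* The bound |A'| >= 1 serves for k = 0, where the linear bound is void. *)
  assert (HA3 : INR k + 1 <= L * Cmod A').
  { unfold L; apply Rle_trans with (1 * Cmod A' + / (kap * b) * (kap * b * INR k)).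
    - rewrite <- Rmult_assoc, Rinv_l by lra; lra.
    - rewrite Rmult_plus_distr_r; apply Rplus_le_compat_l.
      apply Rmult_le_compat_l; [apply Rlt_le, Rinv_0_lt_compat, Hkb|exact HA2]. }
  assert (HA4 : (INR k + 1) ^ 2 <= L ^ 2 * Cmod A' ^ 2).
  { rewrite <- Rpow_mult_distr; apply pow_incr; lra. }
  unfold disc in Hz; assert (0 < Cmod A' ^ 2) by nra.
  replace (2 / (Cmod A' ^ 2 * (1 - Cmod z))) with
    (2 * / Cmod A' ^ 2 * / (1 - Cmod z)) by (field; lra).
  replace (4 * L ^ 2 / (1 - Cmod z) * (/ (INR k + 1) - / (INR k + 2))) with
    (4 * L ^ 2 / ((INR k + 1) * (INR k + 2)) * / (1 - Cmod z)) by (field; lra).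
  apply Rmult_le_compat_r; [apply Rlt_le, Rinv_0_lt_compat; lra|].
  assert (Hkk : 0 < (INR k + 1) * (INR k + 2)) by (apply Rmult_lt_0_compat; lra).
  apply (proj1 (Rle_div_r _ _ _ Hkk)).
  apply Rle_trans with (2 * / Cmod A' ^ 2 * (2 * (L ^ 2 * Cmod A' ^ 2))).
  - apply Rmult_le_compat_l.
    + apply Rmult_le_pos; [lra|]; apply Rlt_le, Rinv_0_lt_compat; assumption.
    + apply Rle_trans with (2 * (INR k + 1) ^ 2); [nra|lra].
  - apply Req_le; field; lra. }
destruct (choice _ Hc) as [c Hc'].
exists (4 * L ^ 2), c; split; [nra|exact Hc'].
Qed.

End NoFixedPoint.

(** * Infinite products *)

Lemma Cseq_lim_unique (u : nat -> C) (l m : C) :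
  Cseq_lim u l -> Cseq_lim u m -> l = m.
Proof.
intros Hl Hm; apply Ceq_minus, Cmod_eq_0, Rle_antisym; [|apply Cmod_ge_0].
apply le_epsilon; intros eps Heps; rewrite Rplus_0_l.
destruct (Hl (eps / 2)) as [N1 H1]; [lra|].
destruct (Hm (eps / 2)) as [N2 H2]; [lra|].
specialize (H1 (N1 + N2)%nat ltac:(lia)); specialize (H2 (N1 + N2)%nat ltac:(lia)).
replace (l - m)%C with (- (u (N1 + N2)%nat - l) + (u (N1 + N2)%nat - m))%C by ring.
eapply Rle_trans; [apply Cmod_triangle|]; rewrite Cmod_opp; lra.
Qed.

Lemma Cseq_lim_Cmod_le (u : nat -> C) (l : C) (M : R) : Cseq_lim u l ->
  (forall n, Cmod (u n) <= M) -> Cmod l <= M.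
Proof.
intros Hl HM; apply le_epsilon; intros eps Heps.
destruct (Hl eps Heps) as [N HN]; specialize (HN N (le_n N)); specialize (HM N).
generalize (Cmod_triangle_minus l (u N)); rewrite Cmod_minus_sym; lra.
Qed.

Lemma Cseq_lim_Cmod_ge (u : nat -> C) (l : C) (m : R) : Cseq_lim u l ->
  (forall n, m <= Cmod (u n)) -> m <= Cmod l.
Proof.
intros Hl Hm; apply le_epsilon; intros eps Heps.
destruct (Hl eps Heps) as [N HN]; specialize (HN N (le_n N)); specialize (Hm N).
generalize (Cmod_triangle_minus (u N) l); lra.
Qed.

(** Factors bounded by 1 and within a telescoping error of 1: the product converges
at each point of the disc. *)
Section InfiniteProduct.

Variable F : nat -> C -> C.
Variable K : R.
Hypothesis hK : 0 <= K.
Hypothesis F_dif : forall k z, disc z -> Cdif (F k) z.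
Hypothesis F_le_1 : forall k z, disc z -> Cmod (F k z) <= 1.
Hypothesis F_near_1 : forall k z, disc z ->
  Cmod (1 - F k z) <= K / (1 - Cmod z) * (/ (INR k + 1) - / (INR k + 2)).

(** The product of the m factors of index n, n + 1, and so on. *)
Fixpoint partial_prod (n m : nat) (z : C) : C :=
  match m with
  | O => RtoC 1
  | S j => (partial_prod n j z * F (n + j) z)%C
  end.

Lemma partial_prod_Cdif (n m : nat) (z : C) : disc z -> Cdif (partial_prod n m) z.
Proof.
intros Hz; induction m as [|m IH]; [apply Cdif_const|].
apply (Cdif_mult (partial_prod n m) (F (n + m)) z IH), F_dif, Hz.
Qed.

Lemma partial_prod_le_1 (n m : nat) (z : C) : disc z -> Cmod (partial_prod n m z) <= 1.
Proof.
intros Hz; induction m as [|m IH]; simpl; [rewrite Cmod_1; lra|].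
rewrite Cmod_mult; assert (H := F_le_1 (n + m) z Hz).
assert (A := Cmod_ge_0 (partial_prod n m z)); assert (B := Cmod_ge_0 (F (n + m) z)); nra.
Qed.

Lemma partial_prod_add (n m : nat) (z : C) :
  partial_prod 0 (n + m) z = (partial_prod 0 n z * partial_prod n m z)%C.
Proof.
induction m as [|m IH]; [rewrite Nat.add_0_r; simpl; ring|].
rewrite Nat.add_succ_r; simpl; rewrite IH; ring.
Qed.

Lemma partial_prod_cauchy (n m j : nat) (z : C) : disc z ->
  Cmod (partial_prod n (m + j) z - partial_prod n m z) <=
    K / (1 - Cmod z) * (/ (INR (n + m) + 1) - / (INR (n + m + j) + 1)).
Proof.
intros Hz; induction j as [|j IH].
- rewrite !Nat.add_0_r.
  replace (partial_prod n m z - partial_prod n m z)%C with (RtoC 0) by ring.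
  rewrite Cmod_0; lra.
- rewrite !Nat.add_succ_r; simpl partial_prod.
  replace (partial_prod n (m + j) z * F (n + (m + j)) z - partial_prod n m z)%C with
    ((partial_prod n (m + j) z - partial_prod n m z) -
      partial_prod n (m + j) z * (1 - F (n + (m + j)) z))%C
    by ring.
  eapply Rle_trans; [apply Cmod_triangle|]; rewrite Cmod_opp, Cmod_mult.
  assert (H1 := partial_prod_le_1 n (m + j) z Hz).
  assert (H2 := F_near_1 (n + (m + j)) z Hz).
  assert (A := Cmod_ge_0 (1 - F (n + (m + j)) z)).
  rewrite Nat.add_assoc in H2, A |- *.
  rewrite S_INR; replace (INR (n + m + j) + 1 + 1) with (INR (n + m + j) + 2) by ring.
  nra.
Qed.

Lemma inv_INR_small (a eps : R) : 0 <= a -> 0 < eps ->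
  exists N, forall n, (N <= n)%nat -> a * / (INR n + 1) <= eps.
Proof.
intros Ha Heps; destruct (nfloor_ex (a / eps)) as [N HN].
{ apply Rdiv_le_0_compat; assumption. }
exists N; intros n Hn; apply le_INR in Hn; assert (Hp := pos_INR N).
apply Rle_div_l; [lra|].
assert (H : a / eps * eps <= (INR n + 1) * eps)
  by (apply Rmult_le_compat_r; lra).
replace (a / eps * eps) with a in H by (field; lra); lra.
Qed.

Lemma partial_prod_lim (n : nat) (z : C) : disc z ->
  exists l, Cseq_lim (fun m => partial_prod n m z) l.
Proof.
intros Hz; apply Cseq_cauchy; intros eps Heps.
assert (Hz' : Cmod z < 1) by exact Hz.
destruct (inv_INR_small (K / (1 - Cmod z)) (eps / 2)) as [N HN].
{ apply Rdiv_le_0_compat; lra. } { lra. }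
assert (H : forall m, (N <= m)%nat ->
  Cmod (partial_prod n m z - partial_prod n N z) <= eps / 2).
{ intros m Hm; replace m with (N + (m - N))%nat by lia.
  eapply Rle_trans; [apply partial_prod_cauchy, Hz|].
  specialize (HN (n + N)%nat ltac:(lia)).
  assert (0 <= / (INR (n + N + (m - N)) + 1)).
  { apply Rlt_le, Rinv_0_lt_compat; generalize (pos_INR (n + N + (m - N))); lra. }
  assert (0 <= K / (1 - Cmod z)) by (apply Rdiv_le_0_compat; lra).
  nra. }
exists N; intros m1 m2 H1 H2; apply H in H1; apply H in H2.
replace (partial_prod n m1 z - partial_prod n m2 z)%C with
  ((partial_prod n m1 z - partial_prod n N z) -
    (partial_prod n m2 z - partial_prod n N z))%C by ring.
eapply Rle_trans; [apply Cmod_triangle|]; rewrite Cmod_opp; lra.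
Qed.

Lemma tail_exists (n : nat) : exists T, Hinf T /\
  forall z, disc z -> Cseq_lim (fun m => partial_prod n m z) (T z).
Proof.
assert (H : forall z, exists l, disc z -> Cseq_lim (fun m => partial_prod n m z) l).
{ intros z; destruct (classic (disc z)) as [Hz|Hz].
  - destruct (partial_prod_lim n z Hz) as [l Hl]; exists l; intros _; exact Hl.
  - exists (RtoC 0); intros H; contradiction. }
destruct (choice _ H) as [T HT]; exists T; split; [split|exact HT].
- apply (bounded_limit_dif (partial_prod n) T 1); [lra| | |exact HT].
  + intros m z; apply partial_prod_Cdif.
  + intros m z; apply partial_prod_le_1.
- exists 1; intros z Hz; apply (Cseq_lim_Cmod_le _ _ 1 (HT z Hz)).
  intros m; apply partial_prod_le_1, Hz.
Qed.

(** The limit is divisible by each of its partial products, with the tail product as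
quotient. *)
Lemma infinite_product : exists T, Hinf T /\
  (forall z, disc z -> Cseq_lim (fun m => partial_prod 0 m z) (T z)) /\
  forall n, exists h, Hinf h /\ forall z, disc z -> T z = (partial_prod 0 n z * h z)%C.
Proof.
destruct (tail_exists 0) as [T [HT1 HT2]]; exists T; split; [exact HT1|].
split; [exact HT2|]; intros n.
destruct (tail_exists n) as [h [Hh1 Hh2]]; exists h; split; [exact Hh1|].
intros z Hz; apply (Cseq_lim_unique (fun m => partial_prod 0 (n + m) z)).
- intros eps Heps; destruct (HT2 z Hz eps Heps) as [N HN].
  exists N; intros m Hm; apply HN; lia.
- intros eps Heps; destruct (Hh2 z Hz eps Heps) as [N HN].
  exists N; intros m Hm; specialize (HN m Hm).
  rewrite partial_prod_add.
  replace (partial_prod 0 n z * partial_prod n m z - partial_prod 0 n z * h z)%C with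
    (partial_prod 0 n z * (partial_prod n m z - h z))%C by ring.
  rewrite Cmod_mult; assert (H := partial_prod_le_1 0 n z Hz).
  assert (A := Cmod_ge_0 (partial_prod 0 n z)).
  assert (B := Cmod_ge_0 (partial_prod n m z - h z)).
  nra.
Qed.

(** A product is at least one minus the sum of the defects of its factors, and the
defects telescope. *)
Lemma partial_prod_lower_bound (z : C) (N : nat) : disc z ->
  (forall k, 1 - Cmod (F k z) <= K * (/ (INR (N + k) + 1) - / (INR (N + k) + 2))) ->
  K * / (INR N + 1) <= 1 / 2 ->
  forall m, 1 / 2 <= Cmod (partial_prod 0 m z).
Proof.
intros Hz HF HN.
assert (Hpos : forall k, 0 < / (INR (N + k) + 1)).
{ intros k; apply Rinv_0_lt_compat; generalize (pos_INR (N + k)); lra. }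
assert (Hm : forall m, 1 - K * (/ (INR N + 1) - / (INR (N + m) + 1)) <=
  Cmod (partial_prod 0 m z)).
{ induction m as [|m IH].
  - rewrite Nat.add_0_r; simpl; rewrite Cmod_1; lra.
  - simpl; rewrite Cmod_mult; specialize (HF m).
    rewrite Nat.add_succ_r, S_INR.
    replace (INR (N + m) + 1 + 1) with (INR (N + m) + 2) by ring.
    assert (P1 := partial_prod_le_1 0 m z Hz); assert (P2 := F_le_1 m z Hz).
    nra. }
intros m; eapply Rle_trans; [|apply Hm].
specialize (Hpos m); nra.
Qed.

End InfiniteProduct.

(** * Functions divisible by all orbit products *)

Lemma orbit_prod_succ_r (phi : Aut) (Psi : C -> C) (n : nat) (z : C) :
  orbit_prod phi Psi (S n) z =
  (orbit_prod phi Psi n z * Psi (Nat.iter n phi z))%C.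
Proof.
revert z; induction n as [|n IH]; intros z; [simpl; ring|].
change (orbit_prod phi Psi (S (S n)) z) with
  (Psi z * orbit_prod phi Psi (S n) (phi z))%C.
rewrite IH; simpl; rewrite <- Nat.iter_succ, Nat.iter_succ_r; ring.
Qed.

Lemma orbit_prod_mult (phi : Aut) (F G : C -> C) (n : nat) (z : C) :
  orbit_prod phi (fun w => F w * G w)%C n z =
  (orbit_prod phi F n z * orbit_prod phi G n z)%C.
Proof.
revert z; induction n as [|n IH]; intros z; simpl; [ring|rewrite IH; ring].
Qed.

Lemma orbit_prod_eqD (phi : Aut) (F G : C -> C) (n : nat) : eqD F G ->
  eqD (orbit_prod phi F n) (orbit_prod phi G n).
Proof.
intros H; induction n as [|n IH]; intros z Hz; simpl; [reflexivity|].
rewrite H, IH; [reflexivity|apply aut_disc, Hz|exact Hz].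
Qed.

Lemma Hinf_const (c : C) : Hinf (fun _ => c).
Proof.
split; [intros z _; apply Cdif_const | exists (Cmod c); intros; lra].
Qed.

Section Divisible.

Variable phi : Aut.
Hypothesis nofix : forall z, disc z -> phi z <> z.

(** The nonvanishing condition is placed at the far points of the orbit of 0 because
it has to be common to all Blaschke factors: a product of functions that are nonzero
at possibly different points would not do. *)
Definition orbit_divisible (Psi f : C -> C) : Prop :=
  Hinf f /\
  (exists N0, forall N, (N0 <= N)%nat -> f (Nat.iter N phi (RtoC 0)) <> RtoC 0) /\
  forall n, exists h, Hinf h /\
    forall z, disc z -> f z = (orbit_prod phi Psi n z * h z)%C.

Lemma disc_0 : disc (RtoC 0).
Proof. unfold disc; rewrite Cmod_0; lra. Qed.

(** At [phi^N(0)] the k-th factor of the product has the modulus of the factor of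
index [N + k] at 0, so all the defects are part of the tail of a convergent series
and their sum is small for large N. *)
Lemma aut_orbit_divisible (psi : Aut) : exists f, orbit_divisible psi f.
Proof.
destruct (orbit_near_unit phi nofix psi) as [K [c [HK Hc]]].
set (F := fun k z => (c k * psi (Nat.iter k phi z))%C).
assert (Fd : forall k z, disc z -> Cdif (F k) z).
{ intros k z Hz; apply Cdif_mult; [apply Cdif_const|].
  apply (Cdif_comp psi (Nat.iter k phi)); [apply aut_Cdif, iter_disc, Hz|].
  clear F; induction k as [|k IH]; [apply Cdif_id|]; simpl.
  apply (Cdif_comp phi (Nat.iter k phi)); [apply aut_Cdif, iter_disc, Hz|exact IH]. }
assert (Fm : forall k z, Cmod (F k z) = Cmod (psi (Nat.iter k phi z))).
{ intros k z; unfold F; rewrite Cmod_mult, (proj1 (Hc k)); ring. }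
assert (F1 : forall k z, disc z -> Cmod (F k z) <= 1).
{ intros k z Hz; rewrite Fm; apply Rlt_le.
  exact (aut_disc psi _ (iter_disc phi k z Hz)). }
destruct (infinite_product F K HK Fd F1 (fun k => proj2 (Hc k)))
  as [T [HT1 [HT2 HT3]]].
exists T; split; [exact HT1|]; split.
- destruct (inv_INR_small K (1 / 2) HK ltac:(lra)) as [N0 HN0].
  exists N0; intros N HN.
  assert (Hd := iter_disc phi N _ disc_0).
  apply Cmod_neq_0, Rlt_le_trans with (1 / 2); [lra|].
  apply (Cseq_lim_Cmod_ge _ _ _ (HT2 _ Hd)).
  apply (partial_prod_lower_bound F K HK F1 _ N Hd); [|apply HN0, HN].
  intros k; rewrite Fm, <- Nat.iter_add, (Nat.add_comm k N), <- Fm.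
  generalize (proj2 (Hc (N + k)%nat) _ disc_0); fold (F (N + k)%nat (RtoC 0)).
  rewrite Cmod_0, Rminus_0_r; unfold Rdiv at 1; rewrite Rinv_1, Rmult_1_r.
  generalize (Cmod_triangle_minus 1 (F (N + k)%nat (RtoC 0))); rewrite Cmod_1; lra.
- intros n; destruct (HT3 n) as [h [Hh1 Hh2]].
  assert (Hpart : exists u, forall z,
    partial_prod F 0 n z = (orbit_prod phi psi n z * u)%C).
  { clear - F; induction n as [|n [u IH]]; [exists (RtoC 1); intros; simpl; ring|].
    exists (u * c n)%C; intros z; rewrite orbit_prod_succ_r; simpl.
    rewrite IH; unfold F; ring. }
  destruct Hpart as [u Hu].
  exists (fun z => u * h z)%C; split.
  + apply (Hinf_mult (fun _ => u) h (Hinf_const u) Hh1).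
  + intros z Hz; rewrite Hh2, Hu by exact Hz; ring.
Qed.

Lemma bprod_orbit_divisible (l : list Aut) : exists f, orbit_divisible (bprod l) f.
Proof.
induction l as [|psi l [g [Hg1 [[N1 HN1] Hg3]]]].
- exists (fun _ => RtoC 1); split; [apply Hinf_const|]; split.
  + exists 0%nat; intros _ _; apply C1_nz.
  + intros n; exists (fun _ => RtoC 1); split; [apply Hinf_const|].
    intros z _; replace (orbit_prod phi (bprod nil) n z) with (RtoC 1); [ring|].
    revert z; induction n as [|n IH]; intros z; simpl; [reflexivity|].
    rewrite <- IH; simpl; ring.
- destruct (aut_orbit_divisible psi) as [f [Hf1 [[N2 HN2] Hf3]]].
  exists (fun z => f z * g z)%C; split; [apply Hinf_mult; assumption|]; split.
  + exists (N1 + N2)%nat; intros N HN; apply Cmult_neq_0; [apply HN2|apply HN1]; lia.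
  + intros n; destruct (Hf3 n) as [h1 [Hh1 E1]]; destruct (Hg3 n) as [h2 [Hh2 E2]].
    exists (fun z => h1 z * h2 z)%C; split; [apply Hinf_mult; assumption|].
    intros z Hz; rewrite E1, E2 by exact Hz.
    change (bprod (psi :: l)) with (fun w => psi w * bprod l w)%C.
    rewrite orbit_prod_mult; ring.
Qed.

End Divisible.

(* The identity is listed next to the elliptic automorphisms because [elliptic]
   excludes it, while for S = M_Psi the intersection is (0) as well. *)
Theorem mainTheorem8 (p : R) (d : nat) (S : (C -> C) -> (C -> C))
    (phi : Aut) (Psi : C -> C)
    (hp1 : 1 <= p) (hp2 : p <> 2) (hd : (1 <= d)%nat)
    (hS : Hp_isometry p S) (hcodim : Hp_codim p S d)
    (hPsi : blaschke d Psi)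
    (hform : forall f, Hp p f -> eqD (S f) (mult_op Psi (U_op p phi f))) :
  trivial_core p S <-> (elliptic phi \/ is_identity phi).
Proof.
split.
- intros Hcore.
  destruct (classic (exists z, disc z /\ phi z = z)) as [Hfix|Hno].
  { destruct (classic (is_identity phi)) as [Hid|Hid]; [right; exact Hid|].
    left; split; assumption. }
  exfalso.
  assert (nofix : forall z, disc z -> phi z <> z)
    by (intros z Hz E; apply Hno; exists z; split; assumption).
  destruct hPsi as [l [_ Hl]].
  destruct (bprod_orbit_divisible phi nofix l) as [f [Hf1 [[N0 HN0] Hf3]]].
  apply (HN0 N0 (le_n _)).
  apply (proj1 (Hcore f (Hinf_Hp p f ltac:(lra) Hf1))).
  + intros n _; destruct (Hf3 n) as [h [Hh Eh]].
    destruct (orbit_prod_range p S phi Psi hp1 hS hform n h Hh) as [g [Hg Eg]].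
    exists g; split; [apply Hinf_Hp; [lra|exact Hg]|].
    intros z Hz; rewrite Eg, Eh by exact Hz.
    rewrite (orbit_prod_eqD phi Psi (bprod l) n Hl z Hz); reflexivity.
  + apply iter_disc, disc_0.
- intros Hphi f Hf.
  assert (Hfix : exists z0, disc z0 /\ phi z0 = z0).
  { destruct Hphi as [[_ Hfix]|Hid]; [exact Hfix|].
    exists (RtoC 0); split; [exact disc_0 | exact (Hid _ disc_0)]. }
  destruct Hfix as [z0 [H0 Hfix]]; split.
  + exact (core_trivial_of_fixed p d S phi Psi hp1 hd hS hPsi hform z0 f H0 Hfix Hf).
  + intros Hz n _; exact (iter_range_zero p S phi Psi hp1 hS hform n f Hz).
Qed.
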